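(* Let $S$ be a 0-F-inverse semigroup, $G$ a group and $\sigma:(S^1)^\times\to G$ a morphism injective on the set $M(S^1)$ of maximal elements. Let $E$ be the semilattice of idempotents of $S$ and $\theta$ the partial action of $G$ on $E$ attached to $S$ and $\sigma$, with enveloping semilattice $\mathrm{Env}(E)$ and dilated action $\tau$. Then $C^*_r(S)$ is isomorphic to the full corner $1\,(C^*_u(\mathrm{Env}(E))\rtimes_{\tau,r}G)\,1$ of $C^*_u(\mathrm{Env}(E))\rtimes_{\tau,r}G$ via $\Lambda(es_g)\mapsto e\cdot(1U_g1)=eU_g1$ ($e\in E$, $g\in G$).
   Context: Groups are discrete and countable. A semilattice is a commutative semigroup of idempotents, always with a zero $0$; $f\le e$ means $ef=f$. $E^1$ is $E$ if $E$ has a unit and $E\cup\{1\}$ otherwise. $C^*_u(E)$ is the universal C*-algebra generated by projections $p_e$, $e\in E$, with $p_0=0$, $p_{de}=p_dp_e$; write $e$ for $p_e$. $S$ is an inverse semigroup with zero, $S^\times:=S\setminus\{0\}$, and $S^1$ is $S$ if $S$ is unital and the unitalization $S\cup\{1\}$ otherwise; $\le$ is the natural partial order ($s\le t$ iff $s=ss^*t$). $S$ is 0-F-inverse if every nonzero element of $S^1$ lies below a unique maximal element of $S^1$; $M(S^1)$ is the set of maximal elements. A morphism $\sigma:(S^1)^\times\to G$ is a map with $\sigma(st)=\sigma(s)\sigma(t)$ whenever $st\neq0$. For $g\in G$, $s_g$ is the maximal element of $\sigma^{-1}(g)$ if this set is non-empty, and $s_g:=0$ otherwise. The attached partial action $\theta$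 of $G$ on $E$ is $d(g):=s_g^*s_g$, $r(g):=s_gs_g^*$, $\theta_g:d(g)Ed(g)\to r(g)Er(g)$, $e\mapsto s_ges_g^*$. For $s\in S$, $\Lambda(s)$ is the partial isometry on $\ell^2S^\times$ with $\Lambda(s)\varepsilon_x=\varepsilon_{sx}$ if $s^*sx=x$ and $\Lambda(s)\varepsilon_x=0$ otherwise; $C^*_r(S)$ is the C*-algebra generated by all $\Lambda(s)$, $s\in S$. $\mathrm{Env}(E):=(G\times E)/\!\sim$, where $(g,d)\sim(h,e)$ iff $d\le d(h^{-1}g)$ and $\theta_{h^{-1}g}(d)=e$, with product $[g,d]\cdot[h,e]:=[g,d\,\theta_{g^{-1}h}(e\,d(g^{-1}h))]$; it is a semilattice. $E$ embeds via $e\mapsto[1,e]$. $\tau$ is the action $\tau_g[h,e]=[gh,e]$ of $G$ on $\mathrm{Env}(E)$ and the induced action on $C^*_u(\mathrm{Env}(E))$. $1$ denotes the projection in the multiplier algebra of $C^*_u(\mathrm{Env}(E))$ (and hence of its crossed product) coming from the unit of $E^1$, determined by $1\cdot[h,e]=[1,\theta_h(e\,d(h))]$; $1\,C^*_u(\mathrm{Env}(E))\,1=C^*_u(E)$. $U_g$ are the canonical unitaries in the multiplier algebra of $C^*_u(\mathrm{Env}(E))\rtimes_{\tau,r}G$. A corner $pBp$ is full if $BpB$ spans a dense subspace of $B$. *)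

(* Defs.v *)
From HB Require Import structures.
From mathcomp Require Import all_boot all_order all_algebra finmap.
From mathcomp Require Import all_classical all_reals all_analysis complex.
From mathcomp Require Import ring.
From mathcomp Require Import analysis.showcase.summability.

Set Implicit Arguments.
Unset Strict Implicit.
Unset Printing Implicit Defensive.

Import numFieldNormedType.Exports.
Import Order.TTheory GRing.Theory Num.Theory.

Local Open Scope classical_set_scope.
Local Open Scope ring_scope.

(* The inner product is linear in the first variable. *)
HB.mixin Record CompleteNormedModule_isHilbert (R : realType) H
    & CompleteNormedModule R[i] H := {
  hdot : H -> H -> R[i] ;
  hdotPl : forall (a : R[i]) (x y z : H),
    hdot (a *: x + y) z = a * hdot x z + hdot y z ;
  hdotC : forall x y : H, hdot y x = (hdot x y)^* ;
  hdot_normE : forall x : H, hdot x x = `|x| ^+ 2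
}.

#[short(type="hilbertType")]
HB.structure Definition Hilbert (R : realType) :=
  {H of CompleteNormedModule R[i] H & CompleteNormedModule_isHilbert R H}.

Section HilbertTheory.
Variables (R : realType) (H : hilbertType R).
Implicit Types (x y z : H) (a : R[i]).

Lemma hdotDl x y z : hdot (x + y) z = hdot x z + hdot y z.
Proof. by rewrite -[x]scale1r hdotPl mul1r scale1r. Qed.

Lemma hdot0l z : hdot 0 z = 0.
Proof. by apply: (@addrI _ (hdot 0 z)); rewrite -hdotDl !addr0. Qed.

Lemma hdotZl a x z : hdot (a *: x) z = a * hdot x z.
Proof. by rewrite -[a *: x]addr0 hdotPl hdot0l addr0. Qed.

Lemma hdotDr x y z : hdot z (x + y) = hdot z x + hdot z y.
Proof. by rewrite hdotC hdotDl rmorphD /= -!hdotC. Qed.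

Lemma hdotZr a x z : hdot z (a *: x) = a^* * hdot z x.
Proof. by rewrite hdotC hdotZl rmorphM /= -hdotC. Qed.

End HilbertTheory.

Section ComplexScalars.
Variable R : realType.

Lemma normc_le_ReDIm (z : R[i]) :
  `|z| <= (`|complex.Re z| + `|complex.Im z|)%:C%C.
Proof.
rewrite {1}[z]complexE; apply: le_trans (ler_normD _ _) _.
rewrite rmorphD /= lerD //.
  by rewrite normc_def /= expr0n /= addr0 sqrtr_sqr.
by rewrite normrM normCi mul1r normc_def /= expr0n /= addr0 sqrtr_sqr.
Qed.

Lemma normc_ge_Im (z : R[i]) : `|complex.Im z|%:C%C <= `|z|.
Proof.
by rewrite normc_def lecR -sqrtr_sqr ler_wsqrtr // lerDr sqr_ge0.
Qed.

Lemma complex_complete (F : set_system R[i]^o) :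
  ProperFilter F -> cauchy F -> cvg F.
Proof.
move=> FF Fc.
have cF (f : R[i]^o -> R^o) : (forall x y, `|f x - f y|%:C%C <= `|x - y|) ->
    cvg (f @ F).
  move=> fle; apply: cauchy_cvg; apply/cauchy_ballP => e e0.
  have e0' : 0 < e%:C%C :> R[i] by rewrite ltcR.
  have /cauchy_ballP/(_ _ e0') := Fc.
  rewrite !near_simpl => -[[A B] /= [FA FB] AB].
  exists (f @` A, f @` B) => /=.
    by split; [apply: filterS FA|apply: filterS FB] => x xA /=; exists x.
  move=> [_ _] /= [[x Ax <-] [y By <-]].
  have := AB (x, y) (conj Ax By); rewrite /ball /= => h.
  by rewrite -ltcR; apply: le_lt_trans h; rewrite fle.
have /cvg_ex[a Fa] : cvg ((fun z : R[i] => complex.Re z) @ F).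
  apply: (cF (fun z : R[i] => complex.Re z)) => x y.
  by apply: le_trans (normc_ge_Re (x - y)); rewrite raddfB.
have /cvg_ex[b Fb] : cvg ((fun z : R[i] => complex.Im z) @ F).
  apply: (cF (fun z : R[i] => complex.Im z)) => x y.
  by apply: le_trans (normc_ge_Im (x - y)); rewrite raddfB.
apply/cvg_ex; exists (a +i* b)%C; apply/(@cvgrPdist_lt _ R[i]^o) => e e0.
have eR : e = (complex.Re e)%:C%C by rewrite RRe_real // ger0_real // ltW.
have e0' : 0 < complex.Re e / 2 by rewrite divr_gt0 // -ltcR -eR.
move/cvgrPdist_lt: Fa => /(_ _ e0') Fa; move/cvgrPdist_lt: Fb => /(_ _ e0') Fb.
apply: filterS2 Fa Fb => z /= ha hb.
apply: le_lt_trans (normc_le_ReDIm _) _.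
rewrite eR ltcR [X in _ < X]splitr !raddfB /=; exact: ltrD.
Qed.

End ComplexScalars.

(* The one-dimensional Hilbert space; an alias is needed since the library
   already has a completeness instance on [R^o] for [R : realType]. *)
Definition hscalar (R : realType) : Type := R[i]^o.

HB.instance Definition _ (R : realType) :=
  NormedModule.copy (hscalar R) R[i]^o.
HB.instance Definition _ (R : realType) :=
  Uniform_isComplete.Build (hscalar R) (@complex_complete R).

Section ComplexHilbert.
Variable R : realType.

Fact complex_hdotPl (a : R[i]) (x y z : hscalar R) :
  (a *: x + y : R[i]) * z^* = a * ((x : R[i]) * z^*) + (y : R[i]) * z^*.
Proof. by rewrite mulrDl -mulrA. Qed.

Fact complex_hdotC (x y : hscalar R) :
  (y : R[i]) * x^* = ((x : R[i]) * y^*)^*.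
Proof. by rewrite rmorphM /= conjCK mulrC. Qed.

Fact complex_hdot_normE (x : hscalar R) : (x : R[i]) * x^* = `|x| ^+ 2.
Proof. by rewrite -normCK. Qed.

HB.instance Definition _ :=
  CompleteNormedModule_isHilbert.Build R (hscalar R)
    complex_hdotPl complex_hdotC complex_hdot_normE.

End ComplexHilbert.

Section Polarization.
Variables (R : realType) (H : hilbertType R).
Implicit Types (x y z : H) (a : R[i]).

Lemma hdotNl x z : hdot (- x) z = - hdot x z.
Proof. by rewrite -scaleN1r hdotZl mulN1r. Qed.

Lemma hdotNr x z : hdot z (- x) = - hdot z x.
Proof. by rewrite hdotC hdotNl rmorphN /= -hdotC. Qed.

Lemma parallelogram x y :
  `|x + y| ^+ 2 + `|x - y| ^+ 2 = 2 * (`|x| ^+ 2 + `|y| ^+ 2).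
Proof. by rewrite -!hdot_normE !(hdotDl, hdotDr, hdotNl, hdotNr); ring. Qed.

Lemma sqnormD_le x y : `|x + y| ^+ 2 <= 2 * (`|x| ^+ 2 + `|y| ^+ 2).
Proof. by rewrite -parallelogram lerDl exprn_ge0. Qed.

Lemma hdot_polar x y : hdot x y = 4^-1 *
  (`|x + y| ^+ 2 - `|x - y| ^+ 2
   + 'i * (`|x + 'i *: y| ^+ 2 - `|x - 'i *: y| ^+ 2)).
Proof.
rewrite -!hdot_normE !(hdotDl, hdotDr, hdotNl, hdotNr, hdotZl, hdotZr) conjCi.
set u := hdot x y; set v := hdot y x; set w := hdot x x; set t := hdot y y.
have -> : w + u + (v + t) - (w - u + (- v - - t)) +
 'i * (w + - 'i * u + ('i * v + 'i * (- 'i * t)) -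
   (w - - 'i * u + (- ('i * v) - - ('i * (- 'i * t))))) =
   2 * u + 2 * v + ('i ^+ 2) * (2 * v - 2 * u) :> R[i] by ring.
by rewrite sqrCi; field.
Qed.

End Polarization.

Section SquareSummable.
Variables (R : realType) (X : choiceType) (H : hilbertType R).

Definition square_summable (f : X -> H) : Prop :=
  exists M : R[i], forall J : {fset X}, \sum_(x <- J) `|f x| ^+ 2 <= M.

Definition square_summable_pred : {pred X -> H} :=
  fun f => `[< square_summable f >].

Lemma square_summable_submod : submod_closed square_summable_pred.
Proof.
split=> [|a f g /asboolP[M fM] /asboolP[N gN]]; apply/asboolP.
  by exists 0 => J; rewrite big1 // => x _; rewrite normr0 expr0n.
exists (2 * (`|a| ^+ 2 * M + N)) => J.
apply: (@le_trans _ _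
    (\sum_(x <- J) 2 * (`|a| ^+ 2 * `|f x| ^+ 2 + `|g x| ^+ 2))).
  by apply: ler_sum => x _; rewrite -exprMn -normrZ sqnormD_le.
rewrite -mulr_sumr big_split /= -mulr_sumr ler_wpM2l // lerD //.
by rewrite ler_wpM2l // exprn_ge0.
Qed.

HB.instance Definition _ := GRing.isSubmodClosed.Build _ _
  square_summable_pred square_summable_submod.

End SquareSummable.

Record l2 (R : realType) (X : choiceType) (H : hilbertType R) := L2 {
  l2_fun :> X -> H ;
  _ : l2_fun \in @square_summable_pred R X H
}.

HB.instance Definition _ (R : realType) (X : choiceType) (H : hilbertType R) :=
  [isSub for @l2_fun R X H].
HB.instance Definition _ (R : realType) (X : choiceType) (H : hilbertType R) :=
  [Choice of l2 X H by <:].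
HB.instance Definition _ (R : realType) (X : choiceType) (H : hilbertType R) :=
  [SubChoice_isSubLmodule of l2 X H by <:].

#[export] Existing Instance totally_filter.

Section l2Hilbert.
Variables (R : realType) (X : choiceType) (H : hilbertType R).
Implicit Types (f g h : l2 X H) (a : R[i]).
Local Notation psum := (@partial_sum X R[i]^o).

Lemma l2P f : square_summable f.
Proof. by case: f => f /= /asboolP. Qed.

Lemma l2E f g : (forall x, f x = g x) -> f = g.
Proof. by move=> fg; apply/val_inj/funext. Qed.

Lemma l2D f g x : (f + g) x = f x + g x. Proof. by []. Qed.
Lemma l2Z a f x : (a *: f) x = a *: f x. Proof. by []. Qed.
Lemma l2N f x : (- f) x = - f x. Proof. by []. Qed.
Lemma l20 x : (0 : l2 X H) x = 0. Proof. by []. Qed.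

Lemma psumE (u : X -> R[i]^o) (J : {fset X}) : psum u J = \sum_(x <- J) u x.
Proof. by rewrite /partial_sum big_seq_fsetE. Qed.

Lemma psum_le (u : X -> R[i]^o) (J K : {fset X}) : (forall x, 0 <= u x) ->
  (J `<=` K)%fset -> (psum u J <= psum u K :> R[i]).
Proof.
move=> u0 /fsubsetP JK; rewrite !psumE (big_fsetID _ (mem J) K) /=.
rewrite (_ : [fset x in K | x \in J]%fset = J); last first.
  by apply/fsetP => x; rewrite !inE andbC; case: (boolP (x \in J)) => // /JK ->.
by rewrite lerDl sumr_ge0.
Qed.

Lemma psum_cvg (u : X -> R[i]^o) (M : R[i]) : (forall x, 0 <= u x) ->
  (forall J, (psum u J <= M :> R[i])) ->
  exists l : R[i]^o, [/\ psum u @ totally --> l, (l <= M :> R[i]) &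
    forall J, (psum u J <= l :> R[i])].
Proof.
move=> u0 uM; pose A := [set complex.Re (psum u J) | J in [set: {fset X}]].
have pR J : psum u J = (complex.Re (psum u J))%:C%C.
  by rewrite RRe_real // ger0_real // psumE sumr_ge0.
have MR : M = (complex.Re M)%:C%C.
  rewrite RRe_real // ger0_real //; apply: le_trans (uM fset0).
  by rewrite psumE sumr_ge0.
have supA : has_sup A.
  split; first by exists (complex.Re (psum u fset0)); exists fset0.
  exists (complex.Re M) => _ [J _ <-].
  by rewrite -lecR -pR -MR.
exists (sup A)%:C%C; split; last 2 first.
- rewrite MR lecR; apply: ge_sup; first exact: supA.1.
  by move=> _ [J _ <-]; rewrite -lecR -pR -MR.
- by move=> J; rewrite pR lecR; apply: sup_upper_bound => //; exists J.
apply/(@cvgrPdist_lt _ R[i]^o) => e e0.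
have eR : e = (complex.Re e)%:C%C by rewrite RRe_real // ger0_real // ltW.
have e0' : 0 < complex.Re e by rewrite -ltcR -eR.
have [_ [J _ <-] Jlt] := sup_adherent e0' supA.
exists J => //= K JK; rewrite pR -rmorphB /= normc_def /= expr0n /= addr0.
rewrite sqrtr_sqr eR ltcR ger0_norm; last first.
  by rewrite subr_ge0; apply: sup_upper_bound => //; exists K.
have JKR : complex.Re (psum u J) <= complex.Re (psum u K).
  by rewrite -lecR -!pR psum_le.
by rewrite ltrBlDl -ltrBlDr; exact: lt_le_trans Jlt JKR.
Qed.

Lemma l2_sq_cvg f : cvg (psum (fun x => `|f x| ^+ 2 : R[i]^o) @ totally).
Proof.
have [M fM] := l2P f; apply/cvg_ex.
have [x|J|l [fl _ _]] := @psum_cvg (fun x => `|f x| ^+ 2 : R[i]^o) M.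
- exact: exprn_ge0.
- by rewrite psumE.
by exists l.
Qed.

Lemma psumD (u v : X -> R[i]^o) J : psum (u \+ v) J = psum u J + psum v J.
Proof. by rewrite !psumE big_split. Qed.

Lemma psumZ a (u : X -> R[i]^o) J :
  psum (fun x => a * u x : R[i]^o) J = a * psum u J.
Proof. by rewrite !psumE mulr_sumr. Qed.

Lemma l2_dot_cvg f g :
  cvg (psum (fun x => hdot (f x) (g x) : R[i]^o) @ totally).
Proof.
rewrite (_ : psum _ = fun J => (4^-1 : R[i]^o) *:
  (psum (fun x => `|(f + g) x| ^+ 2 : R[i]^o) J
   - psum (fun x => `|(f - g) x| ^+ 2 : R[i]^o) J
   + ('i : R[i]) *: (psum (fun x => `|(f + 'i *: g) x| ^+ 2 : R[i]^o) J
   - psum (fun x => `|(f - 'i *: g) x| ^+ 2 : R[i]^o) J))); last first.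
  apply/funext => J; rewrite !psumE -!sumrB scaler_sumr -big_split scaler_sumr.
  by apply: eq_bigr => x _; rewrite hdot_polar.
apply: is_cvgZr; apply: is_cvgD; first by apply: is_cvgB; exact: l2_sq_cvg.
by apply: is_cvgZr; apply: is_cvgB; exact: l2_sq_cvg.
Qed.

Definition l2_dot f g : R[i] :=
  summability.sum (fun x => hdot (f x) (g x) : R[i]^o).

Fact l2_dotPl a f g h : l2_dot (a *: f + g) h = a * l2_dot f h + l2_dot g h.
Proof.
rewrite /l2_dot /summability.sum; apply: (@cvg_lim R[i]^o) => //.
rewrite (_ : partial_sum _ = fun J =>
  (a *: psum (fun x => hdot (f x) (h x) : R[i]^o) J : R[i]^o)
  + psum (fun x => hdot (g x) (h x) : R[i]^o) J); last first.
  apply/funext => J; rewrite !psumE scaler_sumr -big_split.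
  by apply: eq_bigr => x _; rewrite hdotPl.
by apply: cvgD; [apply: cvgZr|]; exact: l2_dot_cvg.
Qed.

Fact l2_dotC f g : l2_dot g f = (l2_dot f g)^*.
Proof.
rewrite /l2_dot /summability.sum; apply: (@cvg_lim R[i]^o) => //.
have /(@cvgrPdist_lt _ R[i]^o) fgl := @l2_dot_cvg f g.
apply/(@cvgrPdist_lt _ R[i]^o) => e /fgl; apply: filterS => J /=.
rewrite -norm_conjC rmorphB /= !psumE rmorph_sum /=.
by under eq_bigr do rewrite -hdotC.
Qed.

Lemma l2_dot_sup f :
  (forall J : {fset X}, \sum_(x <- J) `|f x| ^+ 2 <= l2_dot f f) /\
  (forall M, (forall J : {fset X}, \sum_(x <- J) `|f x| ^+ 2 <= M) ->
     l2_dot f f <= M).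
Proof.
have E M : (forall J : {fset X}, \sum_(x <- J) `|f x| ^+ 2 <= M) ->
  (forall J : {fset X}, \sum_(x <- J) `|f x| ^+ 2 <= l2_dot f f) /\
  l2_dot f f <= M.
  move=> fM; have [x|J|l [fl lM ul]] :=
      @psum_cvg (fun x => `|f x| ^+ 2 : R[i]^o) M.
  - exact: exprn_ge0.
  - by rewrite psumE.
  have -> : l2_dot f f = l.
    rewrite /l2_dot /summability.sum; apply: (@cvg_lim R[i]^o) => //.
    rewrite (_ : (fun x => hdot (f x) (f x) : R[i]^o) =
      fun x => `|f x| ^+ 2) //.
    by apply/funext => x; rewrite hdot_normE.
  by split=> // J; rewrite -psumE.
split; first by have [M /E[]] := l2P f.
by move=> M /E[].
Qed.

Lemma psum_le_dot f (J : {fset X}) :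
  \sum_(x <- J) `|f x| ^+ 2 <= l2_dot f f.
Proof. by case: (l2_dot_sup f). Qed.

Lemma l2_dot_le f M :
  (forall J : {fset X}, \sum_(x <- J) `|f x| ^+ 2 <= M) -> l2_dot f f <= M.
Proof. by case: (l2_dot_sup f) => _; apply. Qed.

Lemma norm_le_dot f x : `|f x| ^+ 2 <= l2_dot f f.
Proof. by have := psum_le_dot f [fset x]%fset; rewrite big_seq_fset1. Qed.

Lemma l2_dot_ge0 f : 0 <= l2_dot f f.
Proof. by have := psum_le_dot f fset0; rewrite big_seq_fset0. Qed.

Lemma l2_dot_eq0 f : l2_dot f f = 0 -> f = 0.
Proof.
move=> f0; apply: l2E => x; apply/eqP; rewrite -normr_eq0 -sqrf_eq0.
by rewrite eq_le exprn_ge0 // -{1}f0 norm_le_dot.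
Qed.

Lemma l2_dotDl f g h : l2_dot (f + g) h = l2_dot f h + l2_dot g h.
Proof. by rewrite -[f in LHS]scale1r l2_dotPl mul1r. Qed.

Lemma l2_dot0l h : l2_dot 0 h = 0.
Proof. by apply: (@addrI _ (l2_dot 0 h)); rewrite -l2_dotDl !addr0. Qed.

Lemma l2_dotZl a f h : l2_dot (a *: f) h = a * l2_dot f h.
Proof. by rewrite -[a *: f]addr0 l2_dotPl l2_dot0l addr0. Qed.

Lemma l2_dotDr f g h : l2_dot h (f + g) = l2_dot h f + l2_dot h g.
Proof. by rewrite l2_dotC l2_dotDl rmorphD /= -!l2_dotC. Qed.

Lemma l2_dotZr a f h : l2_dot h (a *: f) = a^* * l2_dot h f.
Proof. by rewrite l2_dotC l2_dotZl rmorphM /= -l2_dotC. Qed.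

Lemma l2_CauchySchwarz f g :
  `|l2_dot f g| ^+ 2 <= l2_dot f f * l2_dot g g.
Proof.
have := l2_dot_ge0 g; rewrite le_eqVlt => /predU1P[/esym/l2_dot_eq0->|g0].
  by rewrite l2_dotC !l2_dot0l rmorph0 normr0 expr0n /= mulr0.
have gR : (l2_dot g g)^* = l2_dot g g by rewrite -l2_dotC.
have := l2_dot_ge0 (l2_dot g g *: f + (- l2_dot f g) *: g).
have -> : l2_dot (l2_dot g g *: f + - l2_dot f g *: g)
    (l2_dot g g *: f + - l2_dot f g *: g) =
    l2_dot g g * (l2_dot f f * l2_dot g g - `|l2_dot f g| ^+ 2).
  rewrite !(l2_dotDl, l2_dotDr, l2_dotZl, l2_dotZr) rmorphN /= gR normCK.
  by rewrite -!(l2_dotC f g); ring.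
by rewrite pmulr_rge0 // subr_ge0.
Qed.

Definition l2_norm f : R[i] := sqrtC (l2_dot f f).

Fact l2_ler_normD f g : l2_norm (f + g) <= l2_norm f + l2_norm g.
Proof.
rewrite /l2_norm -(@ler_pXn2r _ 2) ?nnegrE ?addr_ge0 ?sqrtC_ge0 ?l2_dot_ge0 //.
rewrite sqrrD !sqrtCK.
have -> : l2_dot (f + g) (f + g) =
    l2_dot f f + 'Re (l2_dot f g) *+ 2 + l2_dot g g.
  rewrite ReE -(l2_dotC f g) -[X in _ + X + _]mulr_natr divfK ?pnatr_eq0 //.
  by rewrite l2_dotDl !l2_dotDr; ring.
rewrite lerD2r lerD2l.
rewrite lerMn2r /=; apply: le_trans (leif_Re_Creal _) _.
rewrite -(@ler_pXn2r _ 2) ?nnegrE ?mulr_ge0 ?sqrtC_ge0 ?l2_dot_ge0 //.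
by rewrite exprMn !sqrtCK l2_CauchySchwarz.
Qed.

Fact l2_normrZ a f : l2_norm (a *: f) = `|a| * l2_norm f.
Proof.
rewrite /l2_norm l2_dotZl l2_dotZr mulrA -normCK.
by rewrite sqrtCM ?nnegrE ?exprn_ge0 ?l2_dot_ge0 // exprCK.
Qed.

Fact l2_normr0_eq0 f : l2_norm f = 0 -> f = 0.
Proof.
by move=> /eqP; rewrite sqrtC_eq0 => /eqP; exact: l2_dot_eq0.
Qed.

End l2Hilbert.

HB.instance Definition _ (R : realType) (X : choiceType) (H : hilbertType R) :=
  Lmodule_isNormed.Build R[i] (l2 X H)
    (@l2_ler_normD R X H) (@l2_normrZ R X H) (@l2_normr0_eq0 R X H).

Section l2Complete.
Variables (R : realType) (X : choiceType) (H : hilbertType R).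
Implicit Types (f g h : l2 X H) (a : R[i]).

Fact l2_hdot_normE f : l2_dot f f = `|f| ^+ 2.
Proof. by rewrite sqrtCK. Qed.

Lemma l2_norm_eval f x : `|f x| <= `|f|.
Proof.
rewrite -(@ler_pXn2r _ 2) ?nnegrE ?normr_ge0 //.
by rewrite -l2_hdot_normE norm_le_dot.
Qed.

Lemma l2_complete (F : set_system (l2 X H)) :
  ProperFilter F -> cauchy F -> cvg F.
Proof.
move=> FF Fc.
have Fx x : cvg ((fun f => f x) @ F).
  apply: cauchy_cvg; apply/cauchy_ballP => e e0.
  have /cauchy_ballP/(_ _ e0) := Fc.
  rewrite !near_simpl => -[[A B] /= [FA FB] AB].
  exists ((fun f => f x) @` A, (fun f => f x) @` B) => /=.
    by split; [apply: filterS FA|apply: filterS FB] => f fA /=; exists f.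
  move=> [_ _] /= [[f Af <-] [g Bg <-]].
  have := AB (f, g) (conj Af Bg); rewrite -!ball_normE /= => h.
  exact: le_lt_trans (l2_norm_eval (f - g) x) h.
pose l x := lim ((fun f => f x) @ F).
have Fd e : 0 < e -> exists2 A, F A & forall f g, A f -> A g -> `|f - g| < e.
  move=> e0; have e20 : 0 < e / 2 by rewrite divr_gt0.
  have /cauchyP/(_ _ e20)[f0 Ff0] := Fc.
  exists (ball f0 (e / 2)) => // f g; rewrite -!ball_normE /= => f0f f0g.
  rewrite -[f](subrK f0) -addrA [e]splitr; apply: le_lt_trans (ler_normD _ _) _.
  by rewrite ltrD // distrC.
have key e A : 0 < e -> F A -> (forall f g, A f -> A g -> `|f - g| < e) ->
    forall f, A f -> forall J : {fset X},
    \sum_(x <- J) `|f x - l x| ^+ 2 <= 4 * e ^+ 2.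
  move=> e0 FA Ae f Af J.
  pose d : R[i] := e / (#|` J|.+1)%:R.
  have d0 : 0 < d by rewrite divr_gt0.
  have FJ (s : seq X) : F [set g : l2 X H | forall x, x \in s ->
      `|g x - l x| < d].
    elim: s => [|y s IH]; first exact: filterE.
    have /cvgrPdist_lt/(_ _ d0) := Fx y; apply: filterS2 IH => g gs gy x.
    by rewrite inE => /predU1P[->|/gs //]; rewrite distrC.
  have [g [Ag gJ]] := filter_ex (filterI FA (FJ J)).
  apply: (@le_trans _ _
    (2 * (\sum_(x <- J) `|(f - g) x| ^+ 2 + \sum_(x <- J) `|g x - l x| ^+ 2))).
    rewrite -big_split mulr_sumr; apply: ler_sum => x _ /=.
    by rewrite -[f x - l x](subrKA (g x)) sqnormD_le.
  rewrite (_ : 4 = 2 * 2); last by rewrite -natrM.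
  rewrite -mulrA ler_wpM2l // mulrDl mul1r lerD //.
    apply: le_trans (psum_le_dot (f - g) J) _.
    by rewrite l2_hdot_normE lerXn2r ?nnegrE ?normr_ge0 ?ltW ?Ae.
  apply: (@le_trans _ _ (\sum_(x <- J) d ^+ 2)).
    rewrite big_seq [X in _ <= X]big_seq; apply: ler_sum => x xJ.
    by rewrite lerXn2r ?nnegrE ?normr_ge0 ?ltW // gJ.
  rewrite big_const_seq count_predT iter_addr_0.
  rewrite -[X in X <= _]mulr_natr /d expr_div_n -mulrA -[X in _ <= X]mulr1.
  rewrite ler_wpM2l ?exprn_ge0 ?(ltW e0) // mulrC ler_pdivrMr ?exprn_gt0 // mul1r.
  by rewrite -natrX ler_nat (leq_trans (leqnSn _)) // -mulnn leq_pmulr.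
have lP : square_summable l.
  have [A FA A1] := Fd 1 ltr01; have [f Af] := filter_ex FA.
  have fl : square_summable (fun x => f x - l x).
    by exists (4 * 1 ^+ 2); exact: (key 1 A).
  suff : l \in @square_summable_pred R X H by move=> /asboolP.
  rewrite (_ : l = l2_fun f - (fun x => f x - l x)); last first.
    by apply/funext => x /=; rewrite !fctE opprB addrCA subrr addr0.
  by rewrite rpredB //; [exact: valP|apply/asboolP].
apply/cvg_ex; exists (L2 (asboolT lP)); apply/cvgrPdist_le => e e0.
have e20 : 0 < e / 2 by rewrite divr_gt0.
have [A FA Ae] := Fd _ e20; have fA := key _ _ e20 FA Ae.
apply: filterS FA => f /fA {}fA.
rewrite distrC -(@ler_pXn2r _ 2) ?nnegrE ?normr_ge0 ?(ltW e0) //.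
rewrite -l2_hdot_normE. apply: l2_dot_le => J.
have -> : e ^+ 2 = 4 * (e / 2) ^+ 2 by field.
exact: fA.
Qed.

HB.instance Definition _ := Uniform_isComplete.Build (l2 X H) l2_complete.

HB.instance Definition _ := CompleteNormedModule_isHilbert.Build R (l2 X H)
  (@l2_dotPl R X H) (@l2_dotC R X H) l2_hdot_normE.

End l2Complete.

Section l2Theory.
Variables (R : realType) (X : choiceType) (H : hilbertType R).

(* [f] viewed in l2; the value 0 for non-square-summable [f] is junk. *)
Definition l2_of (f : X -> H) : l2 X H := insubd 0 f.

Lemma l2_ofE f : square_summable f -> forall x, l2_of f x = f x.
Proof. by move=> fP x; rewrite /l2_of insubdK //; apply/asboolP. Qed.

Lemma l2_norm_le (f : l2 X H) (M : R[i]) : 0 <= M ->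
  (forall J : {fset X}, \sum_(x <- J) `|f x| ^+ 2 <= M ^+ 2) -> `|f| <= M.
Proof.
move=> M0 fM; rewrite -(@ler_pXn2r _ 2) ?nnegrE ?normr_ge0 //.
by rewrite -l2_hdot_normE l2_dot_le.
Qed.

Definition l2_delta (x : X) (v : H) : l2 X H :=
  l2_of (fun y => if y == x then v else 0).

End l2Theory.

Section Pullback.
Variables (R : realType) (X Y : choiceType) (H : hilbertType R).
Variable f : Y -> option X.
Hypothesis f_inj : forall y y' x, f y = Some x -> f y' = Some x -> y = y'.

Lemma sum_pullback (xi : l2 X H) (J : {fset Y}) :
  \sum_(y <- J) `|oapp xi 0 (f y)| ^+ 2 <= `|xi| ^+ 2.
Proof.
pose K : {fset X} := [fset x in pmap f J]%fset.
suff -> : \sum_(y <- J) `|oapp xi 0 (f y)| ^+ 2 = \sum_(x <- K) `|xi x| ^+ 2.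
  by rewrite -l2_hdot_normE psum_le_dot.
have uK : uniq (pmap f J).
  have : uniq J by [].
  elim: (enum_fset J) => //= y s IH /andP[ys us].
  case E : (f y) => [x|] /=; last exact: IH.
  rewrite IH // andbT mem_pmap; apply/mapP => -[y' y's fy'].
  by move: ys; rewrite (f_inj E (esym fy')) y's.
have pK : perm_eq K (pmap f J) by apply: uniq_perm => // x; rewrite !inE.
rewrite (perm_big _ pK) /=.
elim: (enum_fset J) => [|y s IH]; first by rewrite !big_nil.
rewrite big_cons IH /=; case: (f y) => [x|] /=; first by rewrite big_cons.
by rewrite normr0 expr0n add0r.
Qed.

End Pullback.

HB.mixin Record CompleteNormedModule_isCstar (R : realType) A
    & CompleteNormedModule R[i] A := {
  cmul : A -> A -> A ;
  cstar : A -> A ;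
  cmulA : forall x y z : A, cmul x (cmul y z) = cmul (cmul x y) z ;
  cmulPl : forall (a : R[i]) (x y z : A),
    cmul (a *: x + y) z = a *: cmul x z + cmul y z ;
  cmulPr : forall (a : R[i]) (x y z : A),
    cmul z (a *: x + y) = a *: cmul z x + cmul z y ;
  cstarP : forall (a : R[i]) (x y : A),
    cstar (a *: x + y) = a^* *: cstar x + cstar y ;
  cstarK : forall x : A, cstar (cstar x) = x ;
  cstarM : forall x y : A, cstar (cmul x y) = cmul (cstar y) (cstar x) ;
  cnormM_le : forall x y : A, `|cmul x y| <= `|x| * `|y| ;
  cnorm_star : forall x : A, `|cmul (cstar x) x| = `|x| ^+ 2
}.

#[short(type="cstarType")]
HB.structure Definition Cstar (R : realType) :=
  {A of CompleteNormedModule R[i] A & CompleteNormedModule_isCstar R A}.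

Section Cstar.
Variable R : realType.

Definition star_hom (A B : cstarType R) (f : A -> B) : Prop :=
  [/\ linear f, (forall x y, f (cmul x y) = cmul (f x) (f y)) &
      forall x, f (cstar x) = cstar (f x)].

Definition cstar_subalg (A : cstarType R) (D : set A) : Prop :=
  [/\ D 0, (forall a x y, D x -> D y -> D (a *: x + y)),
      (forall x y, D x -> D y -> D (cmul x y)),
      (forall x, D x -> D (cstar x)) & closed D].

Definition cprojection (A : cstarType R) (x : A) : Prop :=
  cstar x = x /\ cmul x x = x.

Definition semilattice_rep (T : Type) (meet : T -> T -> T) (zero : T)
    (B : cstarType R) (q : T -> B) : Prop :=
  [/\ (forall t, cprojection (q t)), q zero = 0 &
      forall s t, q (meet s t) = cmul (q s) (q t)].

(* The homomorphism [f] is unique, since the [p t] generate [A]. *)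
Definition is_Cstar_u (T : Type) (meet : T -> T -> T) (zero : T)
    (A : cstarType R) (p : T -> A) : Prop :=
  [/\ semilattice_rep meet zero p,
      smallest (@cstar_subalg A) (range p) = setT &
      forall (B : cstarType R) (q : T -> B), semilattice_rep meet zero q ->
        exists f : A -> B, star_hom f /\ forall t, f (p t) = q t].

End Cstar.

Section Operators.
Variable R : realType.
Implicit Types H K : hilbertType R.

Definition bounded_op H : set (H -> H) :=
  [set T | linear T /\ exists M : R[i], forall x, `|T x| <= M * `|x|].

Definition adjoint H (T T' : H -> H) : Prop :=
  forall x y, hdot (T x) y = hdot x (T' y).

Definition op_closure H (D : set (H -> H)) : set (H -> H) :=
  [set T | bounded_op T /\ forall e : R[i], 0 < e ->
     exists2 T', D T' & forall x, `|T x - T' x| <= e * `|x|].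

Definition op_subspace H (D : set (H -> H)) : Prop :=
  D 0 /\ forall (a : R[i]) T T', D T -> D T' -> D (a *: T + T').

Definition op_cstar_subalg H (D : set (H -> H)) : Prop :=
  [/\ D `<=` @bounded_op H, op_subspace D,
      (forall T T', D T -> D T' -> D (T \o T')),
      (forall T T', D T -> adjoint T T' -> D T') & op_closure D `<=` D].

Definition op_cstar H (D : set (H -> H)) : set (H -> H) :=
  smallest (@op_cstar_subalg H) D.

Definition op_span H (D : set (H -> H)) : set (H -> H) :=
  smallest (@op_subspace H) D.

Definition op_projection H (P : H -> H) : Prop :=
  [/\ bounded_op P, adjoint P P & P \o P = P].

(* The multiplier algebra of a C*-algebra of operators acting
   nondegenerately, realised as its idealiser. *)
Definition multipliers H (B : set (H -> H)) : set (H -> H) :=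
  [set T | bounded_op T /\ forall b, B b -> B (T \o b) /\ B (b \o T)].

Definition corner H (B : set (H -> H)) (P : H -> H) : set (H -> H) :=
  [set P \o b \o P | b in B].

Definition full_corner H (B : set (H -> H)) (P : H -> H) : Prop :=
  B `<=` op_closure (op_span
    [set T | exists b c, [/\ B b, B c & T = b \o P \o c]]).

Definition op_star_iso H K (B : set (H -> H)) (C : set (K -> K))
    (phi : (H -> H) -> (K -> K)) : Prop :=
  [/\ set_bij B C phi,
      (forall (a : R[i]) T T', B T -> B T' ->
         phi (a *: T + T') = a *: phi T + phi T'),
      (forall T T', B T -> B T' -> phi (T \o T') = phi T \o phi T') &
      forall T T', B T -> B T' -> adjoint T T' -> adjoint (phi T) (phi T')].

Definition cstar_rep (A : cstarType R) H (pi : A -> H -> H) : Prop :=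
  [/\ linear pi, (forall a, bounded_op (pi a)),
      (forall a b, pi (cmul a b) = pi a \o pi b) &
      forall a, adjoint (pi a) (pi (cstar a))].

Definition faithful_rep (A : cstarType R) H (pi : A -> H -> H) : Prop :=
  cstar_rep pi /\ injective pi.

Definition nondegenerate_rep (A : cstarType R) H (pi : A -> H -> H) : Prop :=
  forall x, (forall a, pi a x = 0) -> x = 0.

End Operators.

Section Contractive.
Variable R : realType.

Lemma geometric_cvg (V : completeNormedModType R[i]) (u : nat -> V) (r : R[i]) :
  0 <= r -> r < 1 -> (forall n, `|u n.+1 - u n| <= r ^+ n.+1) ->
  cvg (u @ \oo).
Proof.
move=> r0 r1 ur.
have ud n k : `|u (n + k)%N - u n| * (1 - r) <= r ^+ n * (1 - r ^+ k).
  elim: k => [|k IH]; first by rewrite addn0 subrr normr0 mul0r expr0 subrr mulr0.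
  rewrite addnS -[u _ - u n](subrKA (u (n + k)%N)).
  have r1' : 0 <= 1 - r by rewrite subr_ge0 ltW.
  apply: le_trans (ler_wpM2r r1' (ler_normD _ _)) _; rewrite mulrDl.
  apply: le_trans (lerD (ler_wpM2r r1' (ur _)) IH) _.
  rewrite -subr_ge0.
  have -> : r ^+ n * (1 - r ^+ k.+1) - (r ^+ (n + k).+1 * (1 - r) +
     r ^+ n * (1 - r ^+ k)) = r ^+ n * r ^+ k * (1 - r) * (1 - r).
    by rewrite !exprS exprD; ring.
  by rewrite !mulr_ge0 ?exprn_ge0.
have rR : r = (complex.Re r)%:C%C by rewrite RRe_real // ger0_real.
have rn0 (e : R[i]) : 0 < e -> exists n, r ^+ n < e.
  move=> e0.
  have eR : e = (complex.Re e)%:C%C by rewrite RRe_real // ger0_real // ltW.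
  have e0' : 0 < complex.Re e by rewrite -ltcR -eR.
  have /cvg_expr : `|complex.Re r| < 1.
    by rewrite ger0_norm; [rewrite -ltcR -rR|rewrite -ler0c -rR].
  move/cvgrPdist_lt => /(_ _ e0')[n _ /(_ n)] /=.
  rewrite leqnn sub0r normrN => /(_ isT) h; exists n.
  rewrite rR eR -rmorphXn ltcR; apply: le_lt_trans h; exact: ler_norm.
apply: cauchy_cvg; apply: cauchy_exP => e e0.
have [n rn] : exists n, r ^+ n < e * (1 - r).
  by apply: rn0; rewrite mulr_gt0 // subr_gt0.
exists (u n); exists n => // m /= nm; rewrite -ball_normE /= distrC.
have := ud n (m - n)%N; rewrite subnKC // => h.
rewrite -(@ltr_pM2r _ (1 - r)) ?subr_gt0 //.
apply: le_lt_trans h _; apply: le_lt_trans rn.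
by rewrite ler_piMr ?exprn_ge0 // gerBl exprn_ge0.
Qed.

End Contractive.

Section CstarTheory.
Variables (R : realType) (A : cstarType R).
Implicit Types (x y z : A) (a : R[i]).

Lemma cmulDl x y z : cmul (x + y) z = cmul x z + cmul y z.
Proof. by rewrite -[x in LHS]scale1r cmulPl scale1r. Qed.
Lemma cmulDr x y z : cmul z (x + y) = cmul z x + cmul z y.
Proof. by rewrite -[x in LHS]scale1r cmulPr scale1r. Qed.
Lemma cmul0l z : cmul 0 z = 0.
Proof. by apply: (@addrI _ (cmul 0 z)); rewrite -cmulDl !addr0. Qed.
Lemma cmul0r z : cmul z 0 = 0.
Proof. by apply: (@addrI _ (cmul z 0)); rewrite -cmulDr !addr0. Qed.
Lemma cmulZl a x z : cmul (a *: x) z = a *: cmul x z.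
Proof. by rewrite -[a *: x]addr0 cmulPl cmul0l addr0. Qed.
Lemma cmulZr a x z : cmul z (a *: x) = a *: cmul z x.
Proof. by rewrite -[a *: x]addr0 cmulPr cmul0r addr0. Qed.
Lemma cmulNl x z : cmul (- x) z = - cmul x z.
Proof. by rewrite -scaleN1r cmulZl scaleN1r. Qed.
Lemma cmulNr x z : cmul z (- x) = - cmul z x.
Proof. by rewrite -scaleN1r cmulZr scaleN1r. Qed.
Lemma cstarD x y : cstar (x + y) = cstar x + cstar y.
Proof. by rewrite -[x in LHS]scale1r cstarP rmorph1 scale1r. Qed.
Lemma cstar0 : cstar (0 : A) = 0.
Proof. by apply: (@addrI _ (cstar 0)); rewrite -cstarD !addr0. Qed.
Lemma cstarZ a x : cstar (a *: x) = a^* *: cstar x.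
Proof. by rewrite -[a *: x]addr0 cstarP cstar0 addr0. Qed.
Lemma cstarN x : cstar (- x) = - cstar x.
Proof. by rewrite -scaleN1r cstarZ rmorphN rmorph1 scaleN1r. Qed.

Lemma cnorm_starE x : `|cstar x| = `|x|.
Proof.
have le y : `|y| <= `|cstar y|.
  have := normr_ge0 y; rewrite le_eqVlt => /predU1P[<- //|y0].
  by rewrite -(ler_pM2r y0) -expr2 -cnorm_star cnormM_le.
by apply/eqP; rewrite eq_le -{2}[x]cstarK !le.
Qed.

Lemma self_adjoint_sqrt (h : A) : `|h| < 1 -> cstar h = h ->
  exists2 f : A, cstar f = f & h = (2 : R[i]) *: f - cmul f f.
Proof.
set r := `|h| => r1 hs; have r0 : 0 <= r by exact: normr_ge0.
pose F (f : A) : A := (2^-1 : R[i]) *: (h + cmul f f).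
pose u n := iter n F (0 : A).
have ur n : `|u n| <= r.
  elim: n => [|n IH] /=; first by rewrite normr0.
  rewrite /F normrZ ger0_norm // ler_pdivrMl // mulr_natl mulr2n.
  apply: le_trans (ler_normD _ _) _; rewrite lerD //.
  apply: le_trans (cnormM_le _ _) _; apply: le_trans _ (IH).
  by rewrite ler_piMr // (le_trans IH (ltW r1)).
have us n : cstar (u n) = u n.
  elim: n => [|n IH] /=; first exact: cstar0.
  rewrite /F cstarZ cstarD cstarM hs -/(u n) IH fmorphV.
  by rewrite rmorph_nat.
have ud n : `|u n.+1 - u n| <= r ^+ n.+1.
  elim: n => [|n IH].
    rewrite /= subr0 /F cmul0l addr0 normrZ ger0_norm // ler_pdivrMl // expr1.
    by rewrite mulr_natl mulr2n lerDl.
  have -> : u n.+2 - u n.+1 = (2^-1 : R[i]) *: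
      (cmul (u n.+1) (u n.+1 - u n) + cmul (u n.+1 - u n) (u n)).
    rewrite [u n.+2]/= [in X in _ - X]/= -/(u n) -/(u n.+1) {1}/F.
    rewrite {3}/F -scalerBr; congr (_ *: _).
    rewrite cmulDr cmulDl cmulNr cmulNl subrKA.
    by rewrite opprD addrACA subrr add0r.
  rewrite normrZ ger0_norm // ler_pdivrMl // mulr_natl mulr2n.
  apply: le_trans (ler_normD _ _) _; rewrite lerD //.
    apply: le_trans (cnormM_le _ _) _.
    by rewrite [in X in _ <= X]exprS ler_pM.
  apply: le_trans (cnormM_le _ _) _.
  by rewrite [in X in _ <= X]exprSr ler_pM.
have /cvg_ex[f uf] := geometric_cvg r0 r1 ud.
have cvg_dist (v : A) : (forall e : R[i], 0 < e -> `|v| <= e) -> v = 0.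
  move=> ve; apply/eqP; rewrite -normr_eq0; apply/negPn/negP => v0.
  have v0' : 0 < `|v| by rewrite lt_def v0 normr_ge0.
  have := ve (`|v| / 2) (divr_gt0 v0' (ltr0n _ 2)).
  rewrite ler_pdivlMr // mulr_natr mulr2n gerDl => /(lt_le_trans v0').
  by rewrite ltxx.
move/cvgrPdist_lt: uf => uf.
have near_f e : 0 < e -> exists n, `|f - u n| < e /\ `|f - u n.+1| < e.
  move=> /uf[n _ un]; exists n; split; apply: un => //=.
exists f.
  apply/eqP; rewrite -subr_eq0; apply/eqP/cvg_dist => e e0.
  have e20 : 0 < e / 2 by rewrite divr_gt0.
  have [n [fn _]] := near_f _ e20.
  rewrite -(subrKA (u n)) [e]splitr; apply: le_trans (ler_normD _ _) _.
  apply: lerD; last by rewrite distrC ltW.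
  by rewrite -{1}[u n]us -cstarN -cstarD cnorm_starE ltW.
apply/eqP; rewrite eq_sym -subr_eq0; apply/eqP/cvg_dist => e e0.
pose M := 2 + (`|f| + r).
have M0 : 0 < M by rewrite ltr_wpDr // addr_ge0.
have [n [fn fn1]] := near_f (e / M) (divr_gt0 e0 M0).
have -> : (2 : R[i]) *: f - cmul f f - h = (2 : R[i]) *: (f - u n.+1)
    - (cmul f (f - u n) + cmul (f - u n) (u n)).
  have -> : h = (2 : R[i]) *: u n.+1 - cmul (u n) (u n).
    rewrite [u n.+1]/= -/(u n) /F scalerA divff ?pnatr_eq0 // scale1r.
    by rewrite addrK.
  rewrite cmulDr cmulDl cmulNr cmulNl subrKA scalerBr.
  by rewrite !opprB addrACA [RHS]addrACA; congr (_ + _); rewrite addrC.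
apply: le_trans (ler_normB _ _) _.
apply: (@le_trans _ _ (2 * (e / M) + (`|f| * (e / M) + (e / M) * r))).
  apply: lerD; first by rewrite normrZ ger0_norm // ler_wpM2l // ltW.
  apply: le_trans (ler_normD _ _) _; apply: lerD.
    by apply: le_trans (cnormM_le _ _) _; rewrite ler_wpM2l // ltW.
  by apply: le_trans (cnormM_le _ _) _; rewrite ler_pM // ltW.
by rewrite [e / M * r]mulrC -mulrDl -mulrDl -/M mulrC divfK // gt_eqF.
Qed.

End CstarTheory.

Section Contractive.
Variables (R : realType) (A : cstarType R) (H : hilbertType R).
Variable pi : A -> H -> H.

Hypothesis piP : cstar_rep pi.

Lemma cstar_repD a b x : pi (a + b) x = pi a x + pi b x.
Proof. by case: piP => piL _ _ _; rewrite -[a]scale1r piL !scale1r. Qed.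

Lemma cstar_repZ (c : R[i]) a x : pi (c *: a) x = c *: pi a x.
Proof.
have pi0 y : pi 0 y = 0.
  by apply: (@addrI _ (pi 0 y)); rewrite -cstar_repD !addr0.
case: piP => piL _ _ _; rewrite -[c *: a]addr0 piL.
by change (c *: pi a x + pi 0 x = c *: pi a x); rewrite pi0 addr0.
Qed.

(* For [`|a| < 1] write a* a = 2 f - f^2 with f self-adjoint; then
   |x|^2 - |pi a x|^2 = |x - pi f x|^2 >= 0. *)
Lemma cstar_rep_contractive a x : `|pi a x| <= `|a| * `|x|.
Proof.
case: (piP) => piL piB piM piS.
have lt1 b : `|b| < 1 -> `|pi b x| <= `|x|.
  move=> b1; have [||f fs fE] := @self_adjoint_sqrt _ _ (cmul (cstar b) b).
  - by rewrite cnorm_star expr_lt1.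
  - by rewrite cstarM cstarK.
  rewrite -(@ler_pXn2r _ 2) ?nnegrE // -subr_ge0.
  suff -> : `|x| ^+ 2 - `|pi b x| ^+ 2 = `|x - pi f x| ^+ 2.
    by rewrite exprn_ge0.
  have piE : pi (cstar b) (pi b x) = (2 : R[i]) *: pi f x - pi f (pi f x).
    rewrite -[LHS]/((pi (cstar b) \o pi b) x) -piM fE cstar_repD cstar_repZ.
    by rewrite -scaleN1r cstar_repZ scaleN1r piM.
  have fx : hdot (pi f x) x = hdot x (pi f x) by rewrite piS fs.
  have ffx : hdot x (pi f (pi f x)) = hdot (pi f x) (pi f x) by rewrite piS fs.
  rewrite -!hdot_normE [X in _ - X]piS piE.
  rewrite !(hdotDl, hdotDr, hdotNl, hdotNr, hdotZr) fx ffx rmorph_nat.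
  by ring.
have [->|x0] := eqVneq x 0.
  suff -> : pi a 0 = 0 by rewrite normr0 mulr_ge0.
  have [linpi _] := piB a.
  have := linpi 1 0 0; rewrite !scale1r !addr0 => e.
  by apply: (@addrI _ (pi a 0)); rewrite addr0 -e.
have t0 : 0 < `|x| by rewrite normr_gt0.
rewrite real_leNgt ?realM ?normr_real //; apply/negP => lt.
pose c := (`|a| * `|x| + `|pi a x|) / 2 / `|x|.
have nc : `|a| < c.
  by rewrite /c ltr_pdivlMr // ltr_pdivlMr // mulr_natr mulr2n ltrD2l.
have cs : c * `|x| < `|pi a x|.
  rewrite /c divfK ?gt_eqF // ltr_pdivrMr // mulr_natr mulr2n.
  by rewrite ltrD2r.
have c0 : 0 < c by apply: le_lt_trans nc.
have : `|pi (c^-1 *: a) x| <= `|x|.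
  apply: lt1; rewrite normrZ gtr0_norm ?invr_gt0 //.
  by rewrite ltr_pdivrMl // mulr1.
rewrite cstar_repZ normrZ gtr0_norm ?invr_gt0 // ler_pdivrMl //.
by move=> /(lt_le_trans cs); rewrite ltxx.
Qed.

End Contractive.

Section CrossedProduct.
Variables (R : realType) (G : groupType) (A : cstarType R) (H : hilbertType R).
Variables (tau : G -> A -> A) (pi : A -> H -> H).

Definition cstar_action : Prop :=
  [/\ (forall g, star_hom (tau g)), (forall a, tau 1%g a = a) &
      forall g h a, tau (g * h)%g a = tau g (tau h a)].

(* The regular representation of (A, G, tau) on l2(G, H) induced by [pi]; the
   coordinates are always square-summable, see [cp_embE]. *)
Definition cp_emb (a : A) (xi : l2 G H) : l2 G H :=
  l2_of (fun h => pi (tau h^-1%g a) (xi h)).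

Definition cp_unitary (g : G) (xi : l2 G H) : l2 G H :=
  l2_of (fun h => xi (g^-1 * h)%g).

Lemma cp_embE a xi h : cstar_action -> cstar_rep pi ->
  cp_emb a xi h = pi (tau h^-1%g a) (xi h).
Proof.
move=> [tauP _ tauM] piP; rewrite /cp_emb l2_ofE //.
exists (`|a| ^+ 2 * `|xi| ^+ 2) => J.
apply: (@le_trans _ _ (\sum_(h <- J) `|a| ^+ 2 * `|xi h| ^+ 2)).
  apply: ler_sum => k _; rewrite -exprMn lerXn2r ?nnegrE ?mulr_ge0 //.
  apply: (@cstar_rep_contractive _ _ _ (fun b => pi (tau k^-1%g b))) => //.
  have [tL tM tS] := tauP k^-1%g; case: piP => piL piB piM piS.
  split => //= [c b b'|b b'|b]; first by rewrite tL piL.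
    by rewrite tM piM.
  by rewrite tS.
rewrite -mulr_sumr ler_wpM2l ?exprn_ge0 //.
by rewrite -[X in _ <= X]l2_hdot_normE psum_le_dot.
Qed.

Lemma cp_unitaryE g xi h : cp_unitary g xi h = xi (g^-1 * h)%g.
Proof.
rewrite /cp_unitary l2_ofE //; exists (`|xi| ^+ 2) => J.
apply: (@sum_pullback _ _ _ _ (fun h => Some (g^-1 * h)%g) _ xi J).
by move=> y y' x [<-] [/mulgI].
Qed.

Definition crossed_product : set (l2 G H -> l2 G H) :=
  op_cstar [set T | exists a g, T = cp_emb a \o cp_unitary g].

End CrossedProduct.

HB.mixin Record Semigroup_isInverse0 S & Semigroup S := {
  sstar : S -> S ;
  szero : S ;
  smulVK : forall s : S, (s * sstar s * s)%g = s ;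
  sstarVK : forall s : S, (sstar s * s * sstar s)%g = sstar s ;
  sstar_uniq : forall s t : S,
    (s * t * s)%g = s -> (t * s * t)%g = t -> t = sstar s ;
  smul0 : forall s : S, (szero * s)%g = szero ;
  smulr0 : forall s : S, (s * szero)%g = szero
}.

#[short(type="invSemigroup0Type")]
HB.structure Definition InvSemigroup0 := {S of Semigroup S & Semigroup_isInverse0 S}.

Arguments szero {_}.

Section InverseSemigroup.
Local Open Scope group_scope.
Variable S : invSemigroup0Type.
Implicit Types s t e f : S.

Definition idem : {pred S} := fun e => e * e == e.

Lemma idemP e : reflect (e * e = e) (e \in idem).
Proof. exact: eqP. Qed.

Lemma sstarK s : sstar (sstar s) = s.
Proof. by apply/esym/sstar_uniq; rewrite ?sstarVK ?smulVK. Qed.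

Lemma sstar_idem e : e \in idem -> sstar e = e.
Proof. by move=> /idemP ee; apply/esym/sstar_uniq; rewrite !ee. Qed.

Lemma idem_sVs s : sstar s * s \in idem.
Proof. by apply/idemP; rewrite mulgA sstarVK. Qed.

Lemma idem_ssV s : s * sstar s \in idem.
Proof. by apply/idemP; rewrite mulgA smulVK. Qed.

Lemma idemM e f : e \in idem -> f \in idem -> e * f \in idem.
Proof.
move=> /idemP ee /idemP ff; set x := sstar (e * f).
have xE : f * x * e = x.
  apply: sstar_uniq.
    rewrite !mulgA -(mulgA e f f) ff -(mulgA _ e e) ee.
    have := smulVK (e * f); rewrite -/x => {2}<-.
    by rewrite !mulgA.
  have := sstarVK (e * f); rewrite -/x => xx.
  rewrite !mulgA -[f * x * e * e]mulgA ee -(mulgA _ f f) ff.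
  by rewrite -{3}xx !mulgA.
have xi : x \in idem.
  apply/idemP; rewrite -{1}xE -{2}xE; have := sstarVK (e * f); rewrite -/x => xx.
  transitivity (f * (x * (e * f) * x) * e); first by rewrite !mulgA.
  by rewrite xx.
by rewrite -[e * f]sstarK -/x (sstar_idem xi).
Qed.

Lemma idemC e f : e \in idem -> f \in idem -> e * f = f * e.
Proof.
move=> ie jf; have /idemP ii := idemM ie jf; have /idemP jj := idemM jf ie.
have ff := idemP _ jf; have ee := idemP _ ie.
rewrite -[LHS](sstar_idem (idemM ie jf)); apply/esym/sstar_uniq.
  by rewrite !mulgA -(mulgA e f f) ff -(mulgA _ e e) ee -!mulgA (mulgA e) ii.
by rewrite !mulgA -(mulgA f e e) ee -(mulgA _ f f) ff -!mulgA (mulgA f) jj.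
Qed.

Lemma sstarM s t : sstar (s * t) = sstar t * sstar s.
Proof.
apply/esym/sstar_uniq.
  transitivity (s * ((t * sstar t) * (sstar s * s)) * t); first by rewrite !mulgA.
  rewrite (idemC (idem_ssV _) (idem_sVs _)) !mulgA smulVK.
  by rewrite -!mulgA [t * _]mulgA smulVK.
transitivity (sstar t * ((sstar s * s) * (t * sstar t)) * sstar s).
  by rewrite !mulgA.
rewrite (idemC (idem_sVs _) (idem_ssV _)) !mulgA sstarVK.
by rewrite -!mulgA [sstar s * _]mulgA sstarVK.
Qed.

Lemma idem_conj s e : e \in idem -> s * e * sstar s \in idem.
Proof.
move=> ie; apply/idemP.
transitivity (s * (e * (sstar s * s)) * e * sstar s); first by rewrite !mulgA.
rewrite (idemC ie (idem_sVs _)) !mulgA smulVK -(mulgA _ e e).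
by rewrite (idemP _ ie).
Qed.

Lemma sstar0 : sstar szero = szero :> S.
Proof. by apply/esym/sstar_uniq; rewrite !smul0. Qed.

Lemma idem0 : szero \in idem.
Proof. by apply/idemP; rewrite smul0. Qed.

(* The formal unitization of S is [option S] with [None] as the new unit;
   [S1] cuts out S^1, i.e. it contains [None] only if S is not unital. *)
Definition unital : Prop := exists u : S, forall s, u * s = s /\ s * u = s.

Definition S1 : set (option S) := [set x | x = None -> ~ unital].

Definition omul (x y : option S) : option S :=
  match x, y with
  | Some s, Some t => Some (s * t)
  | None, _ => y
  | _, None => x
  end.

Definition ostar (x : option S) : option S := omap sstar x.

Definition ole (x y : option S) : Prop := x = omul (omul x (ostar x)) y.

Definition maximal_elt : set (option S) :=
  [set m | S1 m /\ forall n, S1 n -> ole m n -> n = m].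

Definition zero_F_inverse : Prop :=
  forall x, S1 x -> x <> Some szero -> exists! m, maximal_elt m /\ ole x m.

Definition smulr1 (s : S) (x : option S) : S := oapp (fun t => s * t) s x.

Definition conj1 (x : option S) (s : S) : S :=
  oapp (fun t => t * s * sstar t) s x.

(* E; its unitization E^1 lives in [option semilat], as for S^1. *)
Definition semilat : Type := {e : S | e \in idem}.
HB.instance Definition _ := Choice.on semilat.

Definition smeet (e f : semilat) : semilat :=
  exist _ (val e * val f) (idemM (valP e) (valP f)).

Definition smeet1 (e : semilat) (f : option semilat) : semilat :=
  oapp (smeet e) e f.

Definition semilat0 : semilat := exist _ szero idem0.

Lemma idem_conj1 x e : e \in idem -> conj1 x e \in idem.
Proof. by case: x => //= t; exact: idem_conj. Qed.

End InverseSemigroup.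

Section LeftRegular.
Local Open Scope group_scope.
Variables (R : realType) (S : invSemigroup0Type).

Definition nonzero : Type := {s : S | s != szero}.
HB.instance Definition _ := Choice.on nonzero.
HB.instance Definition _ := [isSub of nonzero for @sval _ _].

Local Notation l2S := (l2 nonzero (hscalar R)).

(* [(Lambda s xi) y = xi (s^* y)] if [s s^* y = y], and 0 otherwise; see
   [Lambda_delta] for the values on the canonical basis *)
Definition Lambda_dom (s : S) (y : nonzero) : option nonzero :=
  if s * (sstar s * val y) == val y then insub (sstar s * val y)
  else None.

Definition Lambda (s : S) (xi : l2S) : l2S :=
  l2_of (fun y => oapp xi 0%R (Lambda_dom s y)).

Lemma Lambda_domP s x y :
  Lambda_dom s y = Some x <-> (sstar s * s * val x = val x /\ val y = s * val x).
Proof.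
rewrite /Lambda_dom; split.
  case: eqP => // sy; case: insubP => // u _ us [<-]; rewrite us sy; split=> //.
  by rewrite !mulgA sstarVK.
move=> [sx yx]; rewrite yx [sstar s * (s * _)]mulgA sx eqxx.
by rewrite (insubT (fun s : S => s != szero) (valP x)); congr Some; apply/val_inj.
Qed.

Lemma LambdaE s xi y : Lambda s xi y = oapp xi 0%R (Lambda_dom s y).
Proof.
rewrite /Lambda l2_ofE //; exists (`|xi| ^+ 2)%R => J.
apply: sum_pullback => u v x /Lambda_domP[_ ux] /Lambda_domP[_ vx].
by apply/val_inj; rewrite ux vx.
Qed.

Definition basis (x : nonzero) : l2S := l2_delta x (1%R : hscalar R).

Lemma l2_deltaE (X : choiceType) (H : hilbertType R) (x : X) (v : H) y :
  l2_delta x v y = if y == x then v else 0%R.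
Proof.
rewrite /l2_delta l2_ofE //; exists (`|v| ^+ 2)%R => J.
have [xJ|xJ] := boolP (x \in J).
  rewrite (big_fsetD1 x) //= eqxx big1_fset ?addr0 // => i.
  by rewrite !inE => /andP[/negPf-> _] _; rewrite normr0 expr0n.
rewrite big1_fset ?exprn_ge0 // => i iJ _; case: eqP => [ix|_].
  by move: xJ; rewrite -ix iJ.
by rewrite normr0 expr0n.
Qed.

Lemma Lambda_delta s x : Lambda s (basis x) =
  if sstar s * s * val x == val x then oapp basis 0%R (insub (s * val x)) else 0%R.
Proof.
apply: l2E => y; rewrite LambdaE.
case: eqP => sx.
  have sx0 : s * val x != szero.
    apply: contra_not_neq (elimN eqP (valP x)) => sx0; rewrite -sx.
    by rewrite -mulgA sx0 smulr0.
  rewrite (insubT (fun s : S => s != szero) sx0) /= l2_deltaE.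
  case: eqP => [yx|yx].
    have -> : Lambda_dom s y = Some x by apply/Lambda_domP; rewrite yx.
    by rewrite /= l2_deltaE eqxx.
  case E : (Lambda_dom s y) => [z|] //=; rewrite l2_deltaE; case: eqP => // zx.
  move/Lambda_domP: E => [_ yz]; case: yx; apply/val_inj => /=.
  by rewrite yz zx.
case E : (Lambda_dom s y) => [z|] //=; rewrite l2_deltaE; case: eqP => // zx.
by move/Lambda_domP: E => [sz _]; case: sx; rewrite -zx.
Qed.

Definition Cstar_r : set (l2S -> l2S) := op_cstar (range Lambda).

End LeftRegular.

Section PartialAction.
Local Open Scope group_scope.
Variables (S : invSemigroup0Type) (G : groupType) (sigma : option S -> G).
Local Notation E := (semilat S).

(* sigma is only considered on the nonzero elements of S^1 *)
Definition morphism_to_group : Prop := forall s t, S1 s -> S1 t ->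
  omul s t <> Some szero -> sigma (omul s t) = sigma s * sigma t.

Definition fiber (g : G) : set (option S) :=
  [set t | [/\ S1 t, t <> Some szero & sigma t = g]].

Definition s_ (g : G) : option S :=
  xget (Some szero)
    [set m | fiber g m /\ forall t, fiber g t -> ole m t -> t = m].

(* [None] stands for the unit of E^1 *)
Definition d_ (g : G) : option E :=
  omap (fun s => exist _ (sstar s * s) (idem_sVs s)) (s_ g).

(* Only used on d(g) E d(g). *)
Definition theta (g : G) (e : E) : E :=
  exist _ (conj1 (s_ g) (val e)) (idem_conj1 (s_ g) (valP e)).

Definition env_rel (x y : G * E) : Prop :=
  smeet1 x.2 (d_ (y.1^-1 * x.1)) = x.2 /\ theta (y.1^-1 * x.1) x.2 = y.2.

Definition Env : Type :=
  {C : set (G * E) | exists x, C = [set y | env_rel x y]}.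

Definition env_class (g : G) (e : E) : Env :=
  exist _ [set y | env_rel (g, e) y] (ex_intro _ (g, e) erefl).

Definition env_repr (C : Env) : G * E := projT1 (cid (svalP C)).

(* The product does not depend on the representatives when S is 0-F-inverse
   and sigma is a morphism injective on the maximal elements. *)
Definition env_mul (C D : Env) : Env :=
  let: (g, d) := env_repr C in let: (h, e) := env_repr D in
  env_class g (smeet d
    (theta (g^-1 * h) (smeet1 e (d_ (g^-1 * h))))).

Definition env_zero : Env := env_class 1 (semilat0 S).

(* Likewise independent of the representative. *)
Definition env_act (g : G) (C : Env) : Env :=
  let: (h, e) := env_repr C in env_class (g * h) e.

Definition env_emb (e : E) : Env := env_class 1 e.

End PartialAction.

Section EnvelopingCrossedProduct.
Variables (R : realType) (S : invSemigroup0Type) (G : groupType).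
Variable sigma : option S -> G.
Variables (A : cstarType R) (p : Env sigma -> A).
Variables (H : hilbertType R) (tau : G -> A -> A) (pi : A -> H -> H).

Definition induced_action : Prop :=
  cstar_action tau /\ forall g x, tau g (p x) = p (env_act g x).

(* [P] is the projection 1 coming from the unit of E^1, acting as a multiplier
   of the crossed product. *)
Definition unit_projection (P : l2 G H -> l2 G H) : Prop :=
  [/\ op_projection P, multipliers (crossed_product tau pi) P &
      forall h e, P \o cp_emb tau pi (p (env_class sigma h e)) =
        cp_emb tau pi (p (env_class sigma 1%g
          (theta sigma h (smeet1 e (d_ sigma h)))))].

End EnvelopingCrossedProduct.

(* Main.v *)
Require Import Defs.
From HB Require Import structures.
From mathcomp Require Import all_boot all_order all_algebra finmap.
From mathcomp Require Import all_classical all_reals all_analysis complex.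
From mathcomp Require Import ring.
From mathcomp Require Import analysis.showcase.summability.

(** Both algebras are closures of spans of an image of [S]: of the operators
    [Lambda s] on the one side, and on the other of
    [V s := U_g p(s^* s)], where [g] is the degree of [s]. The map
    [Lambda s |-> V s] respects products and adjoints, so everything rests on the
    equality of the norms of [sum_i c_i Lambda s_i] and [sum_i c_i V s_i]; the
    isomorphism is then its continuous extension ([op_star_iso_extension]).

    The enveloping semilattice is handled through points. A pair [(k, f)] with [f]
    a nonzero idempotent lies below a class [[g, e]] when some [s] in [S] has domain
    [f], range below [e] and degree [g^-1 k]. A class is determined by the points
    below it ([points_inj]), a product of classes corresponds to the intersection
    ([points_mul]), so each point defines a character of the semilattice, and, by
    universality, of [A].

    Both norms are determined by the representations induced from these characters.
    The character of [(1, f)] induces a representation on l2(G) in which [V] acts,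
    on the span of the [delta_g] with [f <= d(g)], exactly as [S] acts by left
    multiplication on its elements with domain [f], by matching the element [x] of
    domain [f] with its degree. This is [compare_lincomb]. The two estimates follow.

    - [lambda_le_corner]: left multiplication preserves domains, so l2(S) splits
      orthogonally by domain. For finitely many projections and one domain [f], the
      character of [(1, f)] is realised by a unit vector of [H], because [pi] is
      faithful ([character_vector]).

    - [corner_le_lambda]: on a finitely supported vector of l2(G, H) only finitely
      many projections [p C] occur, and they commute. So the vector splits
      orthogonally into joint eigenvectors, whose eigenvalues are given by the
      character of a point ([bounded_on_eigen]). A joint eigenvector splits further
      into vectors with values on a line, where the comparison applies.

    The crossed product is the closed span of the [p(C) U_g] with [C] a class
    ([crossed_productE]). Compressing [p(C) U_g] by the unit gives some [V s]
    ([emb_unitary_unit]), which identifies the corner ([cornerE]). The corner is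
    full since [[h, e]] is the translate by [h] of an idempotent [e] below the unit
    ([unit_full_corner]). *)

Set Implicit Arguments.
Unset Strict Implicit.
Unset Printing Implicit Defensive.

Import numFieldNormedType.Exports.
Import Order.TTheory GRing.Theory Num.Theory.

Local Open Scope classical_set_scope.
Local Open Scope ring_scope.

(** * Hilbert space preliminaries *)

Section Hilbert.
Variable R : realType.
Implicit Types H K : hilbertType R.

Lemma hdot0r H (x : H) : hdot x 0 = 0.
Proof. by rewrite hdotC hdot0l rmorph0. Qed.

Lemma hdot_suml H (I : Type) (r : seq I) (v : I -> H) (y : H) :
  hdot (\sum_(i <- r) v i) y = \sum_(i <- r) hdot (v i) y.
Proof.
elim: r => [|i r IH]; first by rewrite !big_nil hdot0l.
by rewrite !big_cons hdotDl IH.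
Qed.

Lemma hdot_sumr H (I : Type) (r : seq I) (v : I -> H) (y : H) :
  hdot y (\sum_(i <- r) v i) = \sum_(i <- r) hdot y (v i).
Proof.
elim: r => [|i r IH]; first by rewrite !big_nil hdot0r.
by rewrite !big_cons hdotDr IH.
Qed.

Lemma hdot_eq0 H (x : H) : hdot x x = 0 -> x = 0.
Proof.
by rewrite hdot_normE => /eqP; rewrite sqrf_eq0 normr_eq0 => /eqP.
Qed.

Lemma hdot_inj H (x y : H) : (forall z, hdot x z = hdot y z) -> x = y.
Proof.
move=> xy; apply/eqP; rewrite -subr_eq0; apply/eqP/hdot_eq0.
by rewrite hdotDl hdotNl xy subrr.
Qed.

Lemma norm_sqD H (x y : H) : hdot x y = 0 ->
  `|x + y| ^+ 2 = `|x| ^+ 2 + `|y| ^+ 2.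
Proof.
move=> xy; rewrite -!hdot_normE hdotDl !hdotDr xy (hdotC x y) xy rmorph0.
by rewrite addr0 add0r.
Qed.

(** The Cauchy-Schwarz inequality: subtracting from [x] its component along [y]
    cannot increase the norm. *)
Lemma hdot_le_norm H (x y : H) : `|hdot x y| <= `|x| * `|y|.
Proof.
have [->|y0] := eqVneq y 0; first by rewrite hdot0r !normr0 mulr0.
have yp : 0 < `|y| by rewrite normr_gt0.
pose c := hdot x y / `|y| ^+ 2.
have xc : hdot (c *: y) (x - c *: y) = 0.
  rewrite hdotDr hdotNr hdotZl hdotZl hdotZr hdot_normE (hdotC x y) /c.
  have yr : (`|y| : R[i])^* = `|y| by apply: conj_Creal; exact: normr_real.
  rewrite rmorphM /= fmorphV rmorphXn /= yr divfK ?subrr ?mulr0 //.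
  by rewrite expf_neq0 // normr_eq0.
have := norm_sqD xc; rewrite addrC subrK => /eqP; rewrite eq_sym => /eqP E.
have : `|c *: y| ^+ 2 <= `|x| ^+ 2 by rewrite -E lerDl exprn_ge0.
rewrite ler_pXn2r ?nnegrE // normrZ normrM normfV normrX normr_id => cx.
rewrite -ler_pdivrMr //; apply: le_trans cx.
by rewrite expr2 invfM !mulrA divfK ?gt_eqF.
Qed.

(** The two Hilbert spaces may differ: this is how operators on the space of the
    semigroup and on that of the crossed product are compared. *)
Lemma norm_sum_gram H K (I : eqType) (r : seq I) (v : I -> H) (w : I -> K) :
  (forall i j, i \in r -> j \in r -> hdot (v i) (v j) = hdot (w i) (w j)) ->
  `|\sum_(i <- r) v i| = `|\sum_(i <- r) w i|.
Proof.
move=> vw; apply/eqP; rewrite -(@eqrXn2 _ 2) // -!hdot_normE !hdot_suml.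
apply/eqP; rewrite [LHS]big_seq [RHS]big_seq; apply: eq_bigr => i ir.
by rewrite !hdot_sumr [LHS]big_seq [RHS]big_seq; apply: eq_bigr => j jr; exact: vw.
Qed.

Lemma norm_sq_sum_orth H (I : eqType) (r : seq I) (v : I -> H) : uniq r ->
  (forall i j, i \in r -> j \in r -> i != j -> hdot (v i) (v j) = 0) ->
  `|\sum_(i <- r) v i| ^+ 2 = \sum_(i <- r) `|v i| ^+ 2.
Proof.
move=> ur vo; rewrite -hdot_normE hdot_suml [LHS]big_seq [RHS]big_seq.
apply: eq_bigr => i ir; rewrite hdot_sumr (big_rem i) //= hdot_normE.
rewrite big_seq big1 ?addr0 // => j; rewrite mem_rem_uniq // inE => /andP[ji jr].
by rewrite vo // eq_sym.
Qed.

(** The order on the scalars is partial, but positive scalars are real numbers. *)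
Lemma complex_archi (e : R[i]) : 0 < e -> exists n : nat, (n.+1%:R : R[i])^-1 < e.
Proof.
move=> e0; have eR : e = (complex.Re e)%:C%C by rewrite RRe_real // ger0_real // ltW.
have e0' : 0 < complex.Re e by rewrite -ltcR -eR.
have [n hn] : exists n : nat, (complex.Re e)^-1 < n.+1%:R.
  exists (Num.truncn (complex.Re e)^-1); exact: truncnS_gt.
exists n; rewrite eR -(rmorph_nat (@real_complex R)) -fmorphV ltcR.
by rewrite invf_plt ?posrE // ltr0n.
Qed.

Lemma norm_small_eq0 H (x : H) (c : R[i]) : 0 <= c ->
  (forall e : R[i], 0 < e -> `|x| <= e * c) -> x = 0.
Proof.
move=> c0 xe; apply/eqP; rewrite -normr_eq0; apply/negPn/negP => x0.
have xp : 0 < `|x| by rewrite lt_def x0 normr_ge0.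
have c1 : 0 < c + 1 by rewrite ltr_wpDl.
have := xe (`|x| / (2 * (c + 1))) (divr_gt0 xp (mulr_gt0 (ltr0n _ 2) c1)).
rewrite mulrAC ler_pdivlMr ?mulr_gt0 // ler_pM2l // => le.
have : c < 2 * (c + 1).
  by rewrite mulrDr mulr1 mulr_natl mulr2n -addrA ltrDl ltr_wpDl.
by move=> /lt_le_trans/(_ le); rewrite ltxx.
Qed.

End Hilbert.

(** * Norm-closed algebras of operators *)

Section Operators.
Variable R : realType.
Implicit Types H K : hilbertType R.

(** An upper bound for the operator norm. *)
Definition op_le H (T : H -> H) (M : R[i]) : Prop := forall x, `|T x| <= M * `|x|.

Lemma lin_add (V W : lmodType R[i]) (T : V -> W) : linear T -> forall x y, T (x + y) = T x + T y.
Proof. by move=> TL x y; rewrite -[x in LHS]scale1r TL scale1r. Qed.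

Lemma lin_0 (V W : lmodType R[i]) (T : V -> W) : linear T -> T 0 = 0.
Proof. by move=> TL; apply: (@addrI _ (T 0)); rewrite -lin_add // !addr0. Qed.

Lemma lin_scale (V W : lmodType R[i]) (T : V -> W) : linear T -> forall a x, T (a *: x) = a *: T x.
Proof. by move=> TL a x; rewrite -[a *: x]addr0 TL lin_0 // addr0. Qed.

Lemma lin_opp (V W : lmodType R[i]) (T : V -> W) : linear T -> forall x, T (- x) = - T x.
Proof. by move=> TL x; rewrite -scaleN1r lin_scale // scaleN1r. Qed.

Lemma lin_sub (V W : lmodType R[i]) (T : V -> W) : linear T -> forall x y, T (x - y) = T x - T y.
Proof. by move=> TL x y; rewrite lin_add // lin_opp. Qed.

Lemma lin_sum (V W : lmodType R[i]) (T : V -> W) : linear T ->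
  forall (I : Type) (r : seq I) (v : I -> V),
  T (\sum_(i <- r) v i) = \sum_(i <- r) T (v i).
Proof.
move=> TL I r v; elim: r => [|i r IH]; first by rewrite !big_nil lin_0.
by rewrite !big_cons lin_add // IH.
Qed.

Lemma bounded_op_le H (T : H -> H) : bounded_op T -> exists2 M, 0 <= M & op_le T M.
Proof.
move=> [_ [M TM]]; exists `|M| => // x.
have Mx : 0 <= M * `|x| := le_trans (normr_ge0 _) (TM x).
by apply: le_trans (TM x) _; rewrite -{1}(ger0_norm Mx) normrM normr_id.
Qed.

Lemma op_le_trans H (T : H -> H) M N : M <= N -> op_le T M -> op_le T N.
Proof. by move=> MN TM x; apply: le_trans (TM x) _; rewrite ler_wpM2r. Qed.

Lemma op_leD H (T T' : H -> H) M M' :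
  op_le T M -> op_le T' M' -> op_le (T + T') (M + M').
Proof.
by move=> TM TM' x; rewrite mulrDl; apply: le_trans (ler_normD _ _) _; rewrite lerD.
Qed.

Lemma op_leN H (T : H -> H) M : op_le T M -> op_le (- T) M.
Proof. by move=> TM x; rewrite -[(- T) x]/(- (T x)) normrN. Qed.

Lemma op_leB H (T T' : H -> H) M M' :
  op_le T M -> op_le T' M' -> op_le (T - T') (M + M').
Proof. by move=> TM TM'; apply: op_leD => //; exact: op_leN. Qed.

Lemma op_leZ H a (T : H -> H) M : op_le T M -> op_le (a *: T) (`|a| * M).
Proof. by move=> TM x; rewrite -[(a *: T) x]/(a *: T x) normrZ -mulrA ler_wpM2l. Qed.

Lemma op_le_comp H (T T' : H -> H) M M' : 0 <= M ->
  op_le T M -> op_le T' M' -> op_le (T \o T') (M * M').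
Proof.
by move=> M0 TM TM' x; apply: le_trans (TM _) _; rewrite -mulrA ler_wpM2l.
Qed.

Lemma bounded_opD H a (T T' : H -> H) :
  bounded_op T -> bounded_op T' -> bounded_op (a *: T + T').
Proof.
move=> Tb Tb'; have [M _ TM] := bounded_op_le Tb; have [M' _ TM'] := bounded_op_le Tb'.
case: Tb Tb' => TL _ [TL' _]; split; last first.
  by exists (`|a| * M + M'); apply: op_leD => //; exact: op_leZ.
move=> c x y; rewrite -![(a *: T + T') _]/(a *: T _ + T' _) TL TL'.
rewrite !scalerDr !scalerA addrACA [c * a]mulrC; congr (_ + _ + _).
Qed.

Lemma bounded_op0 H : bounded_op (0 : H -> H).
Proof.
split; last by exists 0 => x; rewrite normr0 mul0r.
by move=> a x y; rewrite scaler0 addr0.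
Qed.

Lemma bounded_op_comp H (T T' : H -> H) :
  bounded_op T -> bounded_op T' -> bounded_op (T \o T').
Proof.
move=> Tb Tb'; have [M M0 TM] := bounded_op_le Tb; have [M' _ TM'] := bounded_op_le Tb'.
case: Tb Tb' => TL _ [TL' _]; split; last by exists (M * M'); exact: op_le_comp.
by move=> a x y /=; rewrite TL' TL.
Qed.

Lemma adjointC H (T T' : H -> H) : adjoint T T' -> adjoint T' T.
Proof. by move=> TT' x y; rewrite hdotC -TT' -hdotC. Qed.

Lemma adjoint_uniq H (T T1 T2 : H -> H) : adjoint T T1 -> adjoint T T2 -> T1 = T2.
Proof.
move=> /adjointC T1P /adjointC T2P; apply/funext => x.
by apply: hdot_inj => y; rewrite T1P T2P.
Qed.

Lemma adjoint_comp H (T T' U U' : H -> H) :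
  adjoint T T' -> adjoint U U' -> adjoint (T \o U) (U' \o T').
Proof. by move=> TT' UU' x y /=; rewrite TT' UU'. Qed.

Lemma adjointD H a (T T' U U' : H -> H) :
  adjoint T T' -> adjoint U U' -> adjoint (a *: T + U) (a^* *: T' + U').
Proof.
move=> TT' UU' x y; rewrite -[(a *: T + U) x]/(a *: T x + U x).
rewrite -[(a^* *: T' + U') y]/(a^* *: T' y + U' y).
by rewrite hdotPl hdotDr hdotZr conjCK TT' UU'.
Qed.

Lemma adjoint0 H : adjoint (0 : H -> H) 0.
Proof. by move=> x y; rewrite hdot0l hdot0r. Qed.

Lemma adjoint_linear H (T T' : H -> H) : adjoint T T' -> linear T'.
Proof.
move=> /adjointC TT' a x y; apply: hdot_inj => z.
by rewrite TT' !hdotPl !TT'.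
Qed.

(** An operator and its adjoint have the same norm, because
    [`|T' x| ^+ 2 = hdot (T (T' x)) x]. *)
Lemma adjoint_le H (T T' : H -> H) M : adjoint T T' -> op_le T M -> op_le T' M.
Proof.
move=> TT' TM x; have [E|n0] := eqVneq `|T' x| 0.
  have [->|x0] := eqVneq x 0; first by rewrite lin_0 ?normr0 ?mulr0 //; exact: adjoint_linear TT'.
  rewrite E; exact: le_trans (normr_ge0 _) (TM x).
have np : 0 < `|T' x| by rewrite lt_def n0 normr_ge0.
rewrite -(ler_pM2l np) -expr2 -[X in X <= _]ger0_norm ?exprn_ge0 // -hdot_normE -TT'.
apply: le_trans (hdot_le_norm _ _) _.
by rewrite mulrCA mulrA ler_wpM2r.
Qed.

End Operators.

Section Closure.
Variables (R : realType) (H : hilbertType R).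
Implicit Types (D E : set (H -> H)) (T : H -> H).

(** Errors in the approximation arguments come with a constant; shrinking the
    tolerance absorbs it. *)
Lemma op_closure_le D T (C : R[i]) : bounded_op T -> 0 <= C ->
  (forall e : R[i], 0 < e -> e <= 1 -> exists2 T', D T' & op_le (T - T') (C * e)) ->
  op_closure D T.
Proof.
move=> Tb C0 TD; split=> // e e0.
have s0 : 0 < C + 1 + e by rewrite addr_gt0 // ltr_wpDl.
(* This tolerance is at most 1, and [C] times it is at most [e]. *)
have [||T' DT' TT'] := TD (e / (C + 1 + e)); first exact: divr_gt0.
  by rewrite ler_pdivrMr // mul1r lerDr addr_ge0.
exists T' => // x; apply: le_trans (TT' x) _; rewrite ler_wpM2r //.
by rewrite mulrA ler_pdivrMr // mulrC ler_wpM2l ?(ltW e0) // -addrA lerDl addr_ge0 ?(ltW e0).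
Qed.

Lemma op_closureP D T e : op_closure D T -> 0 < e ->
  exists2 T', D T' & op_le (T - T') e.
Proof. by case=> _; exact. Qed.

Lemma op_closure_sub D : D `<=` @bounded_op R H -> D `<=` op_closure D.
Proof.
move=> Db T DT; split=> [|e e0]; first exact: Db.
by exists T => // x; rewrite subrr normr0 mulr_ge0 // ltW.
Qed.

Lemma op_closureS D E : D `<=` E -> op_closure D `<=` op_closure E.
Proof. by move=> DE T [Tb TD]; split=> // e /TD[T' /DE ET' TT']; exists T'. Qed.

Lemma op_closure_idem D : op_closure (op_closure D) `<=` op_closure D.
Proof.
move=> T TD; apply: (@op_closure_le _ _ (1 + 1)) => //; first by case: TD.
move=> e e0 _; have [T' T'D TT'] := op_closureP TD e0.
have [U DU T'U] := op_closureP T'D e0.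
by exists U => //; rewrite mulrDl mul1r -[T - U](subrKA T'); exact: op_leD.
Qed.

Lemma op_closure_lin D (a : R[i]) T T' :
  (forall U U', D U -> D U' -> D (a *: U + U')) ->
  op_closure D T -> op_closure D T' -> op_closure D (a *: T + T').
Proof.
move=> Dl TD TD'; apply: (@op_closure_le _ _ (`|a| + 1)).
- by apply: bounded_opD; [case: TD|case: TD'].
- by rewrite addr_ge0.
move=> e e0 _; have [U DU TU] := op_closureP TD e0.
have [U' DU' TU'] := op_closureP TD' e0.
exists (a *: U + U'); first exact: Dl.
rewrite opprD addrACA -scalerBr mulrDl mul1r.
by apply: op_leD => //; exact: op_leZ.
Qed.

(** [T T' - U U' = T (T' - U') + (T - U) U'], where [U'] has norm at most that of
    [T'] plus the tolerance. *)
Lemma op_approx_comp T T' U U' M M' e : 0 <= M -> 0 < e -> e <= 1 -> linear T ->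
  op_le T M -> op_le T' M' ->
  op_le (T - U) e -> op_le (T' - U') e -> op_le ((T \o T') - (U \o U')) ((M + M' + 1) * e).
Proof.
move=> M0 e0 e1 TL TM TM' TU TU'.
have -> : (T \o T') - (U \o U') = (T \o (T' - U')) + ((T - U) \o U').
  apply/funext => x; rewrite -[RHS]/(T (T' x - U' x) + (T (U' x) - U (U' x))).
  by rewrite (lin_sub TL) subrKA.
have UM' : op_le U' (M' + e).
  have -> : U' = T' - (T' - U') by rewrite opprB addrC subrK.
  exact: op_leB.
apply: (@op_le_trans _ _ _ (M * e + e * (M' + e))); last first.
  by apply: op_leD; apply: op_le_comp => //; exact: ltW.
rewrite mulrDl mulrDl mul1r mulrDr -addrA lerD2l [M' * e]mulrC lerD2l.
by rewrite ler_piMl // ltW.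
Qed.

Lemma op_closure_comp D T T' :
  (forall U U', D U -> D U' -> D (U \o U')) ->
  op_closure D T -> op_closure D T' -> op_closure D (T \o T').
Proof.
move=> Dm TD TD'; have [M M0 TM] := bounded_op_le TD.1.
have [M' M'0 TM'] := bounded_op_le TD'.1.
apply: (@op_closure_le _ _ (M + M' + 1)).
- by apply: bounded_op_comp; [case: TD|case: TD'].
- by rewrite !addr_ge0.
move=> e e0 e1; have [U DU TU] := op_closureP TD e0.
have [U' DU' TU'] := op_closureP TD' e0.
exists (U \o U'); first exact: Dm.
by apply: op_approx_comp => //; case: TD => -[].
Qed.

Lemma adjointB T T' U U' : adjoint T T' -> adjoint U U' -> adjoint (T - U) (T' - U').
Proof.
move=> TT' UU' x y; rewrite -[(T - U) x]/(T x - U x) -[(T' - U') y]/(T' y - U' y).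
by rewrite hdotDl hdotDr hdotNl hdotNr TT' UU'.
Qed.

Lemma op_closure_adj D T T' :
  (forall U, D U -> exists2 U', D U' & adjoint U U') ->
  op_closure D T -> adjoint T T' -> op_closure D T'.
Proof.
move=> Da TD TT'; split.
  have [M _ TM] := bounded_op_le TD.1.
  by split; [exact: adjoint_linear TT'|exists M; exact: adjoint_le TM].
move=> e e0; have [U DU TU] := op_closureP TD e0.
have [U' DU' UU'] := Da _ DU; exists U' => //.
by apply: (adjoint_le _ TU); exact: adjointB.
Qed.

End Closure.

Section StarRep.
Variables (R : realType) (I : Type) (mul : I -> I -> I) (star : I -> I).
Implicit Types (H K : hilbertType R) (L : seq (R[i] * I)).

(** The index set is bare: multiplication and involution are only required of the
    operators, so that the same notion serves an inverse semigroup and the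
    generators of a crossed product. *)
Definition star_rep H (u : I -> H -> H) : Prop :=
  [/\ forall s, bounded_op (u s), forall s t, u (mul s t) = u s \o u t &
      forall s, adjoint (u s) (u (star s))].

Definition lincomb H (u : I -> H -> H) L : H -> H :=
  fun x => \sum_(q <- L) q.1 *: u q.2 x.

Definition lscale (a : R[i]) L := [seq (a * q.1, q.2) | q <- L].
Definition lmul L L' := [seq (q.1 * r.1, mul q.2 r.2) | q <- L, r <- L'].
Definition lstar L := [seq ((q.1)^*, star q.2) | q <- L].

Section OneRep.
Variables (H : hilbertType R) (u : I -> H -> H).

Lemma lincomb_nil : lincomb u [::] = 0.
Proof. by apply/funext => x; rewrite /lincomb big_nil. Qed.

Lemma lincomb_cons q L : lincomb u (q :: L) = q.1 *: u q.2 + lincomb u L.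
Proof. by apply/funext => x; rewrite /lincomb big_cons. Qed.

Lemma lincomb1 s : lincomb u [:: (1, s)] = u s.
Proof. by rewrite lincomb_cons lincomb_nil addr0 scale1r. Qed.

Lemma lincomb_cat L L' : lincomb u (L ++ L') = lincomb u L + lincomb u L'.
Proof. by apply/funext => x; rewrite /lincomb big_cat. Qed.

Lemma lincomb_scale a L : lincomb u (lscale a L) = a *: lincomb u L.
Proof.
apply/funext => x; rewrite !fctE /lincomb big_map scaler_sumr.
by apply: eq_bigr => q _; rewrite scalerA.
Qed.

Lemma lincomb_sub L L' : lincomb u (L ++ lscale (-1) L') = lincomb u L - lincomb u L'.
Proof. by rewrite lincomb_cat lincomb_scale scaleN1r. Qed.

Hypothesis uP : star_rep u.

Lemma lincomb_bounded L : bounded_op (lincomb u L).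
Proof.
case: uP => ub _ _; elim: L => [|q L IH].
  by rewrite lincomb_nil; exact: bounded_op0.
by rewrite lincomb_cons; exact: bounded_opD.
Qed.

Lemma lincomb_mul L L' : lincomb u (lmul L L') = lincomb u L \o lincomb u L'.
Proof.
case: uP => ub um _; apply/funext => x /=; rewrite /lincomb big_allpairs_dep /=.
apply: eq_bigr => q _; have [uL _] := ub q.2; rewrite (lin_sum uL) scaler_sumr.
by apply: eq_bigr => r _; rewrite um /= (lin_scale uL) scalerA.
Qed.

Lemma lincomb_star L : adjoint (lincomb u L) (lincomb u (lstar L)).
Proof.
case: uP => _ _ us; elim: L => [|q L IH]; first by rewrite lincomb_nil; exact: adjoint0.
by rewrite /lstar /= !lincomb_cons; exact: adjointD.
Qed.

(** Products and adjoints of the operators [u s] are again of this form, so their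
    linear combinations form a *-algebra and it remains to close it in norm. *)
Lemma op_closure_lincomb_subalg : op_cstar_subalg (op_closure (range (lincomb u))).
Proof.
have lb : range (lincomb u) `<=` @bounded_op R H.
  by move=> _ [L _ <-]; exact: lincomb_bounded.
split.
- by move=> T [].
- split; first by apply: op_closure_sub => //; exists [::]; rewrite ?lincomb_nil.
  move=> a T T'; apply: op_closure_lin => _ _ [L _ <-] [L' _ <-].
  by exists (lscale a L ++ L'); rewrite // lincomb_cat lincomb_scale.
- move=> T T'; apply: op_closure_comp => _ _ [L _ <-] [L' _ <-].
  by exists (lmul L L'); rewrite // lincomb_mul.
- move=> T T'; apply: op_closure_adj => _ [L _ <-].
  by exists (lincomb u (lstar L)); [exists (lstar L)|exact: lincomb_star].
- exact: op_closure_idem.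
Qed.

Lemma lincomb_subspace (D : set (H -> H)) L : op_subspace D -> range u `<=` D ->
  D (lincomb u L).
Proof.
move=> [D0 Dl] uD; elim: L => [|q L IH]; first by rewrite lincomb_nil.
by rewrite lincomb_cons; apply: Dl => //; apply: uD; exists q.2.
Qed.

Lemma op_closure_lincomb_sub (E : set (H -> H)) : op_cstar_subalg E ->
  range u `<=` E -> op_closure (range (lincomb u)) `<=` E.
Proof.
move=> [_ El _ _ Ec] uE; apply: subset_trans Ec; apply: op_closureS => _ [L _ <-].
exact: lincomb_subspace.
Qed.

Lemma op_cstar_lincomb : op_cstar (range u) = op_closure (range (lincomb u)).
Proof.
apply/seteqP; split; last first.
  by move=> T TD E [EP uE]; exact: op_closure_lincomb_sub TD.
apply: smallest_sub; first exact: op_closure_lincomb_subalg.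
move=> _ [s _ <-]; apply: op_closure_sub.
  by move=> _ [L _ <-]; exact: lincomb_bounded.
by exists [:: (1, s)]; rewrite ?lincomb1.
Qed.

End OneRep.
End StarRep.

(** * Extending isometric isomorphisms to closures *)

Section Limits.
Variables (R : realType) (K : hilbertType R).

Lemma le_of_addgt0 (a b : R[i]) : a \is Num.real -> b \is Num.real ->
  (forall e, 0 < e -> a <= b + e) -> a <= b.
Proof.
move=> ar br ab; rewrite real_leNgt //; apply/negP => ba.
have d0 : 0 < (a - b) / 2 by rewrite divr_gt0 // subr_gt0.
have := ab _ d0; rewrite -lerBlDl ler_pdivlMr // mulr_natr mulr2n gerDl.
by move=> /(lt_le_trans (_ : 0 < a - b)); rewrite subr_gt0 ltxx => /(_ ba).
Qed.

Lemma op_eq0_small (T : K -> K) (C : R[i]) : 0 <= C ->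
  (forall e : R[i], 0 < e -> op_le T (C * e)) -> T = 0.
Proof.
move=> C0 Te; apply/funext => x; apply: (@norm_small_eq0 _ _ _ (C * `|x|)).
  by rewrite mulr_ge0.
by move=> e /Te/(_ x); rewrite mulrAC mulrC mulrA.
Qed.

(** Pointwise limits exist because the space is complete; they inherit linearity,
    and the explicit rate makes the convergence uniform on bounded sets. *)
Lemma op_cauchy_limit (t : nat -> K -> K) :
  (forall n, bounded_op (t n)) ->
  (forall n m, op_le (t n - t m) (n.+1%:R^-1 + m.+1%:R^-1)) ->
  exists2 T, bounded_op T & forall n, op_le (T - t n) (2 * n.+1%:R^-1).
Proof.
move=> tb tc.
have inv_anti n m : (n <= m)%N -> m.+1%:R^-1 <= n.+1%:R^-1 :> R[i].
  by move=> nm; rewrite lef_pV2 ?posrE ?ltr0n // ler_nat.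
have tcx n m x : (n <= m)%N -> `|t n x - t m x| <= 2 * n.+1%:R^-1 * `|x|.
  move=> nm; apply: le_trans (tc n m x) _; rewrite ler_wpM2r //.
  by rewrite mulr_natl mulr2n lerD2l inv_anti.
have cv x : cvg ((fun n => t n x) @ \oo).
  apply: cauchy_cvg; apply: cauchy_exP => e e0.
  have x1 : 0 < 2 * (`|x| + 1) by rewrite mulr_gt0 // ltr_wpDl.
  have [n hn] := complex_archi (divr_gt0 e0 x1).
  exists (t n x); exists n => // m /= nm; rewrite -ball_normE /=.
  apply: le_lt_trans (tcx _ _ _ nm) _.
  move: hn; rewrite ltr_pdivlMr //; apply: le_lt_trans.
  by rewrite [leRHS]mulrCA mulrA ler_wpM2l // lerDl.
pose T x := lim ((fun n => t n x) @ \oo).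
have TtE n x : `|T x - t n x| <= 2 * n.+1%:R^-1 * `|x|.
  apply: le_of_addgt0; rewrite ?realM ?realV ?normr_real ?realn //.
  move=> e e0; have /cvgrPdist_lt/(_ _ e0)[k _ kP] := cv x.
  have /= h := kP (maxn n k) (leq_maxr _ _).
  rewrite -(subrKA (t (maxn n k) x)) addrC.
  apply: le_trans (ler_normD _ _) _; apply: lerD; last exact: ltW.
  by rewrite distrC tcx ?leq_maxl.
have TL : linear T.
  move=> a x y; apply/eqP; rewrite -subr_eq0; apply/eqP.
  apply: (@norm_small_eq0 _ _ _ (2 * (`|a *: x + y| + (`|a| * `|x| + `|y|)))).
    by rewrite mulr_ge0 // !addr_ge0 // mulr_ge0.
  move=> e e0; have [n /ltW hn] := complex_archi e0.
  have [tL _] := tb n.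
  have -> : T (a *: x + y) - (a *: T x + T y) =
      (T (a *: x + y) - t n (a *: x + y)) - (a *: (T x - t n x) + (T y - t n y)).
    rewrite tL scalerBr -[in RHS]addrA; congr (_ + _).
    rewrite -opprD addrACA; congr (- _).
    by congr (_ + _); rewrite addrC subrK.
  apply: (@le_trans _ _ (n.+1%:R^-1 * (2 * (`|a *: x + y| + (`|a| * `|x| + `|y|))))).
    apply: le_trans (ler_normB _ _) _; rewrite mulrA [n.+1%:R^-1 * 2]mulrC mulrDr.
    apply: lerD; first exact: TtE.
    apply: le_trans (ler_normD _ _) _; rewrite mulrDr lerD ?TtE //.
    by rewrite normrZ mulrCA ler_wpM2l.
  by rewrite ler_wpM2r // mulr_ge0 // !addr_ge0 // mulr_ge0.
exists T; last by move=> n x; exact: TtE.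
split=> //; have [M _ tM] := bounded_op_le (tb 0%N).
exists (2 * 1%:R^-1 + M) => x; rewrite -(subrK (t 0%N x) (T x)) mulrDl.
by apply: le_trans (ler_normD _ _) _; apply: lerD; [exact: TtE|exact: tM].
Qed.

End Limits.

Section Extension.
Variables (R : realType) (I : Type) (mul : I -> I -> I) (star : I -> I).

(** The closure of the graph of [lincomb u L |-> lincomb v L]; it is the graph of a
    function as soon as norms do not increase along it. *)
Definition op_graph (H K : hilbertType R) (u : I -> H -> H) (v : I -> K -> K)
    (T : H -> H) (T' : K -> K) : Prop :=
  [/\ bounded_op T, bounded_op T' & forall e : R[i], 0 < e ->
    exists L, op_le (T - lincomb u L) e /\ op_le (T' - lincomb v L) e].

Definition norm_dominated (H K : hilbertType R) (u : I -> H -> H) (v : I -> K -> K) :=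
  forall L (M : R[i]), 0 <= M -> op_le (lincomb u L) M -> op_le (lincomb v L) M.

Section OneWay.
Variables (H K : hilbertType R) (u : I -> H -> H) (v : I -> K -> K).
Hypotheses (uP : star_rep mul star u) (vP : star_rep mul star v).
Local Notation G := (op_graph u v).

Lemma op_graph_sym T T' : G T T' -> op_graph v u T' T.
Proof. by move=> [Tb Tb' TT']; split=> // e /TT'[L []]; exists L. Qed.

Lemma op_graph_closure T T' : G T T' -> op_closure (range (lincomb u)) T.
Proof.
move=> [Tb _ TT']; split=> // e /TT'[L [TL _]]; by exists (lincomb u L).
Qed.

Lemma op_graph_le T T' (C : R[i]) : bounded_op T -> bounded_op T' -> 0 <= C ->
  (forall e : R[i], 0 < e -> e <= 1 -> exists L,
    op_le (T - lincomb u L) (C * e) /\ op_le (T' - lincomb v L) (C * e)) ->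
  G T T'.
Proof.
move=> Tb Tb' C0 TT'; split=> // e e0.
have s0 : 0 < C + 1 + e by rewrite addr_gt0 // ltr_wpDl.
have [||L [TL TL']] := TT' (e / (C + 1 + e)); first exact: divr_gt0.
  by rewrite ler_pdivrMr // mul1r lerDr addr_ge0.
have le : C * (e / (C + 1 + e)) <= e.
  rewrite mulrA ler_pdivrMr // mulrC ler_wpM2l ?(ltW e0) // -addrA lerDl.
  by rewrite addr_ge0 ?(ltW e0).
by exists L; split; apply: op_le_trans le _.
Qed.

Lemma op_graph_lincomb L : G (lincomb u L) (lincomb v L).
Proof.
split; [exact: lincomb_bounded uP _|exact: lincomb_bounded vP _|].
move=> e e0; exists L; rewrite !subrr.
by split=> x; rewrite normr0 mulr_ge0 // ltW.
Qed.

Lemma op_graph_lin a T1 T1' T2 T2' : G T1 T1' -> G T2 T2' ->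
  G (a *: T1 + T2) (a *: T1' + T2').
Proof.
move=> [T1b T1b' T1P] [T2b T2b' T2P].
apply: (@op_graph_le _ _ (`|a| + 1)); try exact: bounded_opD.
  by rewrite addr_ge0.
move=> e e0 _; have [L [uL vL]] := T1P e e0; have [L' [uL' vL']] := T2P e e0.
exists (lscale a L ++ L'); rewrite !lincomb_cat !lincomb_scale.
by split; rewrite opprD addrACA -scalerBr mulrDl mul1r;
  apply: op_leD => //; exact: op_leZ.
Qed.

Lemma op_graph_comp T1 T1' T2 T2' : G T1 T1' -> G T2 T2' ->
  G (T1 \o T2) (T1' \o T2').
Proof.
move=> [T1b T1b' T1P] [T2b T2b' T2P].
have [M M0 T1M] := bounded_op_le T1b; have [M' M0' T1M'] := bounded_op_le T1b'.
have [N N0 T2N] := bounded_op_le T2b; have [N' N0' T2N'] := bounded_op_le T2b'.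
apply: (@op_graph_le _ _ ((M + N + 1) + (M' + N' + 1))); try exact: bounded_op_comp.
  by rewrite !addr_ge0.
move=> e e0 e1; have [L [uL vL]] := T1P e e0; have [L' [uL' vL']] := T2P e e0.
exists (lmul mul L L'); rewrite (lincomb_mul uP) (lincomb_mul vP).
split; [apply: (@op_le_trans _ _ _ ((M + N + 1) * e))|
        apply: (@op_le_trans _ _ _ ((M' + N' + 1) * e))].
- by rewrite ler_wpM2r ?(ltW e0) // lerDl !addr_ge0.
- by apply: op_approx_comp => //; case: T1b.
- by rewrite ler_wpM2r ?(ltW e0) // lerDr !addr_ge0.
- by apply: op_approx_comp => //; case: T1b'.
Qed.

Hypothesis uv : norm_dominated u v.

Lemma op_graph0 T' : G 0 T' -> T' = 0.
Proof.
move=> [_ _ TT']; apply: (@op_eq0_small _ _ _ 2) => // e e0.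
have [L [uL vL]] := TT' e e0; rewrite -(subrK (lincomb v L) T').
rewrite mulr_natl mulr2n; apply: op_leD => //; apply: uv; first exact: ltW.
by move: uL => /op_leN; rewrite sub0r opprK.
Qed.

Lemma op_graph_fun T T1 T2 : G T T1 -> G T T2 -> T1 = T2.
Proof.
move=> T1P T2P; have := op_graph_lin (-1) T2P T1P.
by rewrite !scaleN1r addNr => /op_graph0/eqP; rewrite addrC subr_eq0 => /eqP.
Qed.

(** The linear combination dual to one approximating [T] approximates the adjoint
    of [T], hence is close to the one chosen for [S], and their images under [v]
    are equally close. *)
Lemma op_graph_adj T T' S S' : G T T' -> G S S' -> adjoint T S -> adjoint T' S'.
Proof.
move=> [_ _ TP] [_ _ SP] TS x y; apply/eqP; rewrite -subr_eq0; apply/eqP.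
apply: (@norm_small_eq0 _ (hscalar R) _ (4 * (`|x| * `|y|))).
  by rewrite mulr_ge0 // mulr_ge0.
move=> e e0; have [L [uL vL]] := TP e e0; have [L' [uL' vL']] := SP e e0.
pose L1 := lstar star L.
have d : op_le (lincomb v L1 - lincomb v L') (e + e).
  rewrite -lincomb_sub; apply: uv; first by rewrite addr_ge0 ?(ltW e0).
  rewrite lincomb_sub -(subrK S (lincomb u L1)) -addrA; apply: op_leD => //.
  rewrite -opprB; apply: op_leN; apply: (adjoint_le _ uL).
  by apply: adjointB => //; exact: lincomb_star uP _.
have Sd : op_le (lincomb v L1 - S') (e + e + e).
  rewrite -(subrK (lincomb v L') (lincomb v L1)) -addrA; apply: op_leD => //.
  by rewrite -opprB; exact: op_leN.
have -> : hdot (T' x) y - hdot x (S' y) =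
    hdot ((T' - lincomb v L) x) y + hdot x ((lincomb v L1 - S') y).
  rewrite -[(T' - lincomb v L) x]/(T' x - lincomb v L x).
  rewrite -[(lincomb v L1 - S') y]/(lincomb v L1 y - S' y).
  rewrite hdotDl hdotDr !hdotNl !hdotNr (lincomb_star vP L x y).
  by rewrite addrA subrK.
apply: le_trans (ler_normD _ _) _.
have -> : e * (4 * (`|x| * `|y|)) = e * `|x| * `|y| + `|x| * ((e + e + e) * `|y|).
  by ring.
apply: lerD; apply: le_trans (hdot_le_norm _ _) _.
  by rewrite ler_wpM2r.
by rewrite ler_wpM2l.
Qed.

Lemma op_graph_total T : op_closure (range (lincomb u)) T -> exists T', G T T'.
Proof.
move=> [Tb TP].
have /choice[L LP] : forall n : nat, exists L,
    op_le (T - lincomb u L) n.+1%:R^-1.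
  move=> n; have [|_ [L _ <-] TL] := TP n.+1%:R^-1; first by rewrite invr_gt0.
  by exists L.
have [||T' Tb' TP'] := @op_cauchy_limit R K (fun n => lincomb v (L n)).
- by move=> n; exact: lincomb_bounded vP _.
- move=> n m; rewrite -lincomb_sub; apply: uv.
    by rewrite addr_ge0 // invr_ge0.
  rewrite lincomb_sub -(subrK T (lincomb u (L n))) -addrA; apply: op_leD => //.
  by rewrite -opprB; exact: op_leN.
exists T'; apply: (@op_graph_le _ _ 2) => // e e0 _.
have [n /ltW ne] := complex_archi e0; exists (L n); split.
  apply: op_le_trans (LP n); apply: le_trans ne _.
  by rewrite mulr_natl mulr2n lerDl ltW.
by apply: op_le_trans (TP' n); rewrite ler_wpM2l.
Qed.

End OneWay.

(** Each half of the norm estimate makes the closed graph a function, defined on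
    the whole closure, in one of the two directions. *)
Theorem op_star_iso_extension (H K : hilbertType R)
    (u : I -> H -> H) (v : I -> K -> K) :
  star_rep mul star u -> star_rep mul star v ->
  norm_dominated u v -> norm_dominated v u ->
  exists phi, op_star_iso (op_closure (range (lincomb u)))
    (op_closure (range (lincomb v))) phi /\ forall s, phi (u s) = v s.
Proof.
move=> uP vP uv vu.
have [phi phiP] : exists phi : (H -> H) -> (K -> K), forall T,
    op_closure (range (lincomb u)) T -> op_graph u v T (phi T).
  suff /choice[phi phiP] : forall T, exists T',
      op_closure (range (lincomb u)) T -> op_graph u v T T' by exists phi.
  move=> T; have [TP|nT] := pselect (op_closure (range (lincomb u)) T).
    by have [T' TT'] := op_graph_total vP uv TP; exists T'.
  by exists 0.
have phiE T T' : op_graph u v T T' -> phi T = T'.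
  by move=> TT'; apply: (op_graph_fun uv _ TT'); exact: phiP (op_graph_closure TT').
exists phi; split; last first.
  move=> s; apply: phiE; rewrite -(lincomb1 u s) -(lincomb1 v s).
  exact: op_graph_lincomb uP vP _.
split.
- split.
  + by move=> T /phiP/op_graph_sym/op_graph_closure.
  + move=> T T'; rewrite !inE => /phiP TP /phiP TP' E.
    by apply: (op_graph_fun vu (op_graph_sym TP)); rewrite E; exact: op_graph_sym.
  + move=> T' /(op_graph_total uP vu)[T /op_graph_sym TT'].
    by exists T; [exact: op_graph_closure TT'|exact: phiE].
- by move=> a T T' /phiP TP /phiP TP'; apply: phiE; exact: op_graph_lin.
- by move=> T T' /phiP TP /phiP TP'; apply: phiE; exact: op_graph_comp uP vP _ _ _ _ _ _.
- by move=> T T' /phiP TP /phiP TP'; exact: op_graph_adj uP vP uv _ _ _ _ TP TP'.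
Qed.

End Extension.

(** * Square-summable families *)

Section L2.
Variables (R : realType) (X : choiceType) (H : hilbertType R).
Implicit Types (xi zeta : l2 X H) (v w : H).
Local Notation delta := (@l2_delta R X H).

Lemma hdot_delta xi x w : hdot xi (delta x w) = hdot (xi x) w.
Proof.
rewrite -[LHS]/(l2_dot _ _) /l2_dot /summability.sum.
apply: (@cvg_lim R[i]^o) => //; apply: cvg_near_cst.
exists [fset x]%fset => //= J /fsubsetP/(_ x); rewrite inE eqxx => /(_ isT) xJ.
rewrite psumE (big_fsetD1 x) //= l2_deltaE eqxx big1_fset ?addr0 // => y.
by rewrite !inE => /andP[/negPf yx _] _; rewrite l2_deltaE yx hdot0r.
Qed.

Lemma hdot_delta2 x v y w :
  hdot (delta x v) (delta y w) = if x == y then hdot v w else 0.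
Proof. by rewrite hdot_delta l2_deltaE eq_sym; case: eqP => // _; rewrite hdot0l. Qed.

Lemma l2_deltaD x v w : delta x (v + w) = delta x v + delta x w.
Proof.
apply: l2E => y; rewrite l2D !l2_deltaE; by case: eqP => // _; rewrite addr0.
Qed.

Lemma l2_deltaZ x a v : delta x (a *: v) = a *: delta x v.
Proof.
apply: l2E => y; rewrite l2Z !l2_deltaE; by case: eqP => // _; rewrite scaler0.
Qed.

Lemma l2_delta0 x : delta x 0 = 0 :> l2 X H.
Proof. by rewrite -[X in delta _ X](scale0r 0) l2_deltaZ scale0r. Qed.

Lemma norm_delta x v : `|delta x v| = `|v|.
Proof.
apply/eqP; rewrite -(@eqrXn2 _ 2) // -!hdot_normE.
by rewrite hdot_delta2 eqxx.
Qed.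

Definition l2_fin (r : seq X) (v : X -> H) : l2 X H := \sum_(x <- r) delta x (v x).

Lemma l2_finE r (v : X -> H) y : uniq r -> l2_fin r v y = if y \in r then v y else 0.
Proof.
rewrite /l2_fin; elim: r => [|x r IH] /=; first by rewrite big_nil.
move=> /andP[xr ur]; rewrite big_cons l2D IH // l2_deltaE inE.
case: eqP => [->|_] /=; last by rewrite add0r.
by rewrite (negPf xr) addr0.
Qed.

Lemma l2_fin_norm r (v : X -> H) : uniq r -> `|l2_fin r v| ^+ 2 = \sum_(x <- r) `|v x| ^+ 2.
Proof.
move=> ur; rewrite norm_sq_sum_orth //; last first.
  by move=> x y _ _ /negPf xy; rewrite hdot_delta2 xy.
by apply: eq_bigr => x _; rewrite norm_delta.
Qed.

(** Finitely supported vectors are dense: the norm is a supremum of finite sums,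
    and the truncation is orthogonal to the remainder. *)
Lemma l2_fin_approx xi (e : R[i]) : 0 < e ->
  exists2 J : {fset X}, `|l2_fin J xi| <= `|xi| & `|xi - l2_fin J xi| <= e.
Proof.
move=> e0.
have [J hJ] : exists J : {fset X}, `|xi| ^+ 2 - e ^+ 2 <= \sum_(x <- J) `|xi x| ^+ 2.
  apply: contrapT => /forallNP nJ.
  have : `|xi| ^+ 2 <= `|xi| ^+ 2 - e ^+ 2.
    rewrite -{1}l2_hdot_normE; apply: l2_dot_le => J.
    have /negP := nJ J; rewrite -real_ltNge; first by move=> /ltW.
      by apply: sum_real => x _; rewrite realX // normr_real.
    by rewrite realB // realX // ?normr_real // ger0_real // ltW.
  rewrite lerBrDr gerDl => /(lt_le_trans (exprn_gt0 2 e0)).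
  by rewrite ltxx.
have E : `|xi| ^+ 2 = `|l2_fin J xi| ^+ 2 + `|xi - l2_fin J xi| ^+ 2.
  rewrite -{1}(subrK (l2_fin J xi) xi) addrC norm_sqD //.
  rewrite /l2_fin hdot_suml big_seq big1 // => x xJ.
  rewrite hdotC hdot_delta.
  rewrite -[(xi - _) x]/(xi x - l2_fin J xi x) l2_finE // xJ subrr.
  by rewrite hdot0l rmorph0.
exists J.
  by rewrite -(@ler_pXn2r _ 2) ?nnegrE // E lerDl exprn_ge0.
rewrite -(@ler_pXn2r _ 2) ?nnegrE ?(ltW e0) //.
by move: hJ; rewrite -l2_fin_norm // E lerBlDr lerD2l.
Qed.

Lemma op_le_l2_fin (T : l2 X H -> l2 X H) (M : R[i]) : 0 <= M -> bounded_op T ->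
  (forall r (v : X -> H), uniq r -> `|T (l2_fin r v)| <= M * `|l2_fin r v|) -> op_le T M.
Proof.
move=> M0 Tb TM xi; have [N N0 TN] := bounded_op_le Tb; case: Tb => TL _.
apply: le_of_addgt0; rewrite ?realM ?normr_real ?ger0_real // => e e0.
have N1 : 0 < N + 1 by rewrite ltr_wpDl.
have [J J1 J2] := l2_fin_approx xi (divr_gt0 e0 N1).
rewrite -{1}(subrK (l2_fin J xi) xi) (lin_add TL) addrC.
apply: le_trans (ler_normD _ _) _; apply: lerD.
  by apply: le_trans (TM _ _ _) _ => //; rewrite ler_wpM2l.
apply: le_trans (TN _) _; apply: le_trans (ler_wpM2l N0 J2) _.
by rewrite mulrCA mulrC ler_piMl ?(ltW e0) // ler_pdivrMr // mul1r lerDl.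
Qed.

End L2.

Section L2Adjoint.
Variables (R : realType) (X : choiceType) (H : hilbertType R).

(** Both sides are bounded sesquilinear forms, so they agree once they agree on
    the dense subspace spanned by the [l2_delta x v]. *)
Lemma l2_fin_adjoint (T T' : l2 X H -> l2 X H) : bounded_op T -> bounded_op T' ->
  (forall x v y w, hdot (T (@l2_delta R X H x v)) (@l2_delta R X H y w) =
                   hdot (@l2_delta R X H x v) (T' (@l2_delta R X H y w))) -> adjoint T T'.
Proof.
move=> Tb Tb' TT'; have [N N0 TN] := bounded_op_le Tb.
have [N' N0' TN'] := bounded_op_le Tb'; case: Tb Tb' => TL _ [TL' _] xi zeta.
apply/eqP; rewrite -subr_eq0; apply/eqP.
apply: (@norm_small_eq0 _ (hscalar R) _ ((N + N') * (`|zeta| + `|xi|))).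
  by rewrite mulr_ge0 // addr_ge0.
move=> e e0; have [J J1 J2] := l2_fin_approx xi e0.
have [K K1 K2] := l2_fin_approx zeta e0.
set x := l2_fin J xi in J1 J2; set z := l2_fin K zeta in K1 K2.
have Exz : hdot (T x) z = hdot x (T' z).
  rewrite /x /z /l2_fin (lin_sum TL) (lin_sum TL') !hdot_suml.
  by apply: eq_bigr => i _; rewrite !hdot_sumr; apply: eq_bigr => j _; exact: TT'.
have -> : hdot (T xi) zeta - hdot xi (T' zeta) =
    (hdot (T (xi - x)) zeta + hdot (T x) (zeta - z)) -
    (hdot (xi - x) (T' zeta) + hdot x (T' (zeta - z))).
  rewrite (lin_sub TL) (lin_sub TL') !(hdotDl, hdotDr, hdotNl, hdotNr) Exz.
  by ring.
apply: le_trans (ler_normB _ _) _.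
apply: (@le_trans _ _ (N * e * `|zeta| + N * `|xi| * e +
    (e * (N' * `|zeta|) + `|xi| * (N' * e)))).
  apply: lerD; apply: le_trans (ler_normD _ _) _; apply: lerD;
    apply: le_trans (hdot_le_norm _ _) _.
  - by rewrite ler_wpM2r // (le_trans (TN _)) // ler_wpM2l.
  - by rewrite ler_pM // (le_trans (TN _)) // ler_wpM2l.
  - by rewrite ler_pM.
  - by rewrite ler_pM // (le_trans (TN' _)) // ler_wpM2l.
by rewrite le_eqVlt; apply/orP; left; apply/eqP; ring.
Qed.

End L2Adjoint.

(** * The partial action and its enveloping semilattice *)

Section InvSemigroup.
Local Open Scope group_scope.
Variable S : invSemigroup0Type.
Implicit Types s t e f : S.

Lemma idem_mul e : e \in @idem S -> e * e = e.
Proof. by move/idemP. Qed.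

Lemma smulVK_r s t : s * (sstar s * (s * t)) = s * t.
Proof. by rewrite !mulgA smulVK. Qed.

Lemma sstar_ssV_neq0 s : s <> szero -> s * sstar s <> szero.
Proof. by move=> s0 E; apply: s0; rewrite -(smulVK s) E smul0. Qed.

Lemma sstar_sVs_neq0 s : s <> szero -> sstar s * s <> szero.
Proof. by move=> s0 E; apply: s0; rewrite -(smulVK s) -mulgA E smulr0. Qed.

Lemma sVs_eq_neq0 s t : s <> szero -> sstar t * t = sstar s * s -> t <> szero.
Proof. by move=> s0 ts t0; apply: (sstar_sVs_neq0 s0); rewrite -ts t0 smulr0. Qed.

End InvSemigroup.

Section Grading.
Local Open Scope group_scope.
Variables (S : invSemigroup0Type) (G : groupType) (sigma : option S -> G).
Hypothesis S_zero_F_inverse : zero_F_inverse S.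
Hypothesis sigma_morphism : morphism_to_group sigma.
Hypothesis sigma_injective : set_inj (@maximal_elt S) sigma.
Implicit Types (s t e f : S) (g h k : G).

Local Notation deg s := (sigma (Some s)).

Lemma degM s t : s * t <> szero -> deg (s * t) = deg s * deg t.
Proof. by move=> st; rewrite -sigma_morphism //= => -[]. Qed.

Lemma deg_idem e : e \in @idem S -> e <> szero -> deg e = 1.
Proof.
move=> /idem_mul ee e0; apply: (@mulgI _ (deg e)).
by rewrite -degM ?ee ?mulg1.
Qed.

Lemma degV s : s <> szero -> deg (sstar s) = (deg s)^-1.
Proof.
move=> s0; apply: (@mulgI _ (deg s)); have ss0 := sstar_ssV_neq0 s0.
by rewrite mulgV -degM // deg_idem // idem_ssV.
Qed.

(** The restriction of [s_ g] to the idempotent [e]; [None] acts as the unit. *)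
Definition germ g e : S := oapp (fun t => t * e) e (s_ sigma g).

Lemma s_P g : s_ sigma g = Some szero \/ fiber sigma g (s_ sigma g).
Proof. by rewrite /s_; case: xgetP => [m _ [mP _]|_]; [right|left]. Qed.

Lemma deg_s1 x e : S1 x -> x <> Some szero -> e \in @idem S ->
  (forall y, omul x (Some e) = Some y -> y <> szero -> sigma (Some y) = sigma x) /\
  (forall y, omul (Some e) x = Some y -> y <> szero -> sigma (Some y) = sigma x).
Proof.
move=> S1x x0 ie; split=> y xy y0; have e0 : e <> szero.
- by move=> e0; apply: y0; move: xy; rewrite e0; case: (x) => [m|] /= [<-] //; rewrite smulr0.
- by rewrite -xy sigma_morphism // ?deg_idem ?mulg1 // xy => -[].
- by move=> e0; apply: y0; move: xy; rewrite e0; case: (x) => [m|] /= [<-] //; rewrite smul0.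
- by rewrite -xy sigma_morphism // ?deg_idem ?mul1g // xy => -[].
Qed.

Lemma deg_germ g e : e \in @idem S -> germ g e <> szero -> deg (germ g e) = g.
Proof.
move=> ie; rewrite /germ; case: (s_P g) => [->/=|[S1s s0 sg] E].
  by rewrite smul0.
rewrite -[RHS]sg; apply: (deg_s1 S1s s0 ie).1 => //.
by case: (s_ sigma g).
Qed.

Lemma deg_smulr1 g e : e \in @idem S -> smulr1 e (s_ sigma g) <> szero ->
  deg (smulr1 e (s_ sigma g)) = g.
Proof.
move=> ie; rewrite /smulr1; case: (s_P g) => [->/=|[S1s s0 sg] E].
  by rewrite smulr0.
rewrite -[RHS]sg; apply: (deg_s1 S1s s0 ie).2 => //.
by case: (s_ sigma g).
Qed.

Lemma ole_Some s x : ole (Some s) x <-> smulr1 (s * sstar s) x = s.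
Proof. by rewrite /ole; case: x => [m|] /=; split=> [[<-]|->]. Qed.

Lemma ole_deg s m : s <> szero -> S1 m -> ole (Some s) m -> sigma m = deg s.
Proof.
move=> s0 S1m /ole_Some sm; have m0 : m <> Some szero.
  by move=> m0; apply: s0; rewrite -sm m0 /= smulr0.
apply/esym/(deg_s1 S1m m0 (idem_ssV s)).2 => //.
by rewrite -[in RHS]sm; case: (m).
Qed.

Lemma maximal_above s : s <> szero -> exists m,
  [/\ maximal_elt m, ole (Some s) m, fiber sigma (deg s) m & sigma m = deg s].
Proof.
move=> s0; have S1s : S1 (Some s) by [].
have [|m [[mM sm] _]] := S_zero_F_inverse S1s; first by case.
have S1m := mM.1; have mg := ole_deg s0 S1m sm.
exists m; split=> //; split=> // m0.
by move/ole_Some: sm; rewrite m0 /= smulr0 => /esym.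
Qed.

(** A nonzero element lies below a maximal one, which has the same degree; as
    [sigma] separates maximal elements, that one is [s_ g]. So [s_ g] is even the
    greatest element of its fibre. *)
Lemma le_s_ s : s <> szero -> smulr1 (s * sstar s) (s_ sigma (deg s)) = s.
Proof.
move=> s0; have [m [mM sm mf mg]] := maximal_above s0.
suff -> : s_ sigma (deg s) = m by apply/ole_Some.
apply: xget_unique.
  by split=> // t [S1t _ _] mt; exact: mM.2.
move=> m' [[S1m' m'0 m'g] m'max].
have [n [nM m'n]] : exists n, maximal_elt n /\ ole m' n.
  by have [n [] ] := S_zero_F_inverse S1m' m'0; exists n.
have n0 : n <> Some szero.
  move=> n0; apply: m'0; move: m'n; rewrite n0 /ole; case: (m') => [t|] //=.
  by rewrite smulr0.
have ng : sigma n = deg s.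
  case: m' S1m' m'0 m'g m'n {m'max} => [t|] S1t t0 tg tn.
    by rewrite -tg; apply: ole_deg nM.1 tn => t0'; apply: t0; rewrite t0'.
  by move: tn; rewrite /ole /= => <-.
have nm : n = m' by apply: m'max => //; split=> //; exact: nM.1.
by apply: sigma_injective; rewrite ?inE -?nm // ng mg.
Qed.

Lemma smulr1_germ s x : smulr1 (s * sstar s) x = s ->
  oapp (fun t => t * (sstar s * s)) (sstar s * s) x = s.
Proof.
case: x => [m|] /= E.
  have sV : sstar s = sstar m * (s * sstar s).
    by rewrite -{1}E sstarM (sstar_idem (idem_ssV s)).
  rewrite sV -!mulgA (mulgA s) smulVK mulgA -{1}E mulgA.
  by rewrite (idemC (idem_ssV m) (idem_ssV s)) -mulgA smulVK E.
by rewrite -E sstarM sstarK !(idem_mul (idem_ssV s)).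
Qed.

Lemma germ_deg s : s <> szero -> germ (deg s) (sstar s * s) = s.
Proof. by move=> s0; apply: smulr1_germ; exact: le_s_. Qed.

(** Both elements are the restriction of the same [s_ g] to their common domain. *)
Lemma deg_dom_inj s t : s <> szero -> deg s = deg t ->
  sstar s * s = sstar t * t -> s = t.
Proof.
move=> s0 st dst; rewrite -(germ_deg s0) st dst germ_deg //.
exact: sVs_eq_neq0 s0 (esym dst).
Qed.

(** That [theta g] is defined at [d] with value [e] is witnessed by an element of
    [S] with domain [d], range [e] and degree [g]. In this form it is evidently
    stable under inversion and composition, and elements of [S] can be multiplied
    in place of partial maps. *)
Definition arrow g (d e : S) : Prop :=
  exists s, [/\ sstar s * s = d, s * sstar s = e & s <> szero -> deg s = g].

Lemma arrow_refl e : e \in @idem S -> arrow 1 e e.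
Proof.
move=> ie; exists e; rewrite (sstar_idem ie) idem_mul //.
by split=> // e0; exact: deg_idem.
Qed.

Lemma arrow_sym g d e : arrow g d e -> arrow g^-1 e d.
Proof.
move=> [s [sd se sg]]; exists (sstar s); rewrite sstarK; split=> // s0.
have s0' : s <> szero by move=> s0'; apply: s0; rewrite s0' sstar0.
by rewrite degV // sg.
Qed.

Lemma arrow_trans g h d e f : arrow g d e -> arrow h e f -> arrow (h * g) d f.
Proof.
move=> [s [sd se sg]] [t [td te tg]]; exists (t * s); rewrite sstarM; split.
- by rewrite -mulgA (mulgA (sstar t)) td -se !mulgA sstarVK.
- by rewrite -mulgA (mulgA s) se -td !mulgA smulVK.
- move=> ts0; rewrite degM // sg ?tg // => E0; apply: ts0.
    by rewrite E0 smul0.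
  by rewrite E0 smulr0.
Qed.

Lemma germ_arrow g e : e \in @idem S ->
  oapp (fun m => e * (sstar m * m)) e (s_ sigma g) = e ->
  arrow g e (conj1 (s_ sigma g) e).
Proof.
move=> ie E; exists (germ g e); split; last by move=> g0; exact: deg_germ.
  move: E; rewrite /germ; case: (s_ sigma g) => [m|] /= E.
    by rewrite sstarM (sstar_idem ie) -mulgA (mulgA (sstar m)) mulgA E idem_mul.
  by rewrite (sstar_idem ie) idem_mul.
rewrite /germ; case: (s_ sigma g) => [m|] /=.
  by rewrite sstarM (sstar_idem ie) mulgA -(mulgA m) idem_mul.
by rewrite (sstar_idem ie) idem_mul.
Qed.

Lemma arrow_germ g d e : arrow g d e ->
  oapp (fun m => d * (sstar m * m)) d (s_ sigma g) = d /\ conj1 (s_ sigma g) d = e.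
Proof.
move=> [s [sd se sg]]; have [s0|/eqP s0] := eqVneq s szero.
  have d0 : d = szero by rewrite -sd s0 smulr0.
  have e0 : e = szero by rewrite -se s0 smul0.
  by case: (s_ sigma g) => [m|] /=; rewrite ?d0 ?e0 ?smul0 ?smulr0 ?smul0.
have := germ_deg s0; rewrite sg // /germ sd.
have dd : d * d = d by rewrite -sd !mulgA sstarVK.
have ds : sstar d = d by rewrite -sd sstarM sstarK.
case: (s_ sigma g) => [m|] /= E; last by rewrite -se -E ds dd.
split; last by rewrite -se -E sstarM ds [RHS]mulgA -(mulgA m d d) dd.
have id : d \in @idem S by apply/idemP.
have dmd : d * (sstar m * m) * d = d by rewrite -[RHS]sd -E sstarM ds !mulgA.
by rewrite -[RHS]dmd -mulgA (idemC (idem_sVs m) id) [RHS]mulgA dd.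
Qed.

Local Notation E := (semilat S).

Lemma semilat_inj (d e : E) : val d = val e -> d = e.
Proof. by case: d e => [d id] [e ie] /= de; exact: eq_exist. Qed.

Lemma env_rel_arrow (x y : G * E) :
  env_rel sigma x y <-> arrow (y.1^-1 * x.1) (val x.2) (val y.2).
Proof.
case: x y => [g d] [h e]; rewrite /env_rel /=; set k := h^-1 * g.
have vE : val (smeet1 d (d_ sigma k)) =
    oapp (fun m => val d * (sstar m * m)) (val d) (s_ sigma k).
  by rewrite /d_ /smeet1; case: (s_ sigma k).
split=> [[dk ke]|/arrow_germ[dk ke]].
  by rewrite -ke; apply: germ_arrow; [exact: (valP d)|rewrite -vE dk].
by split; apply: semilat_inj; rewrite /= ?vE.
Qed.

Lemma env_rel_refl x : env_rel sigma x x.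
Proof. by apply/env_rel_arrow; rewrite mulVg; apply: arrow_refl; exact: (valP x.2). Qed.

Lemma env_rel_sym x y : env_rel sigma x y -> env_rel sigma y x.
Proof.
move=> /env_rel_arrow/arrow_sym; rewrite invgM invgK => xy; exact/env_rel_arrow.
Qed.

Lemma env_rel_trans x y z : env_rel sigma x y -> env_rel sigma y z -> env_rel sigma x z.
Proof.
move=> /env_rel_arrow xy /env_rel_arrow yz; apply/env_rel_arrow.
have := arrow_trans xy yz; rewrite mulgA -(mulgA (z.1^-1)) mulgV mulg1; exact.
Qed.

Lemma env_class_eq g (d : E) h (e : E) : env_rel sigma (g, d) (h, e) ->
  env_class sigma g d = env_class sigma h e.
Proof.
move=> gh; apply: eq_exist; apply/seteqP; split=> y /= gy.
  exact: env_rel_trans (env_rel_sym gh) gy.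
exact: env_rel_trans gh gy.
Qed.

(** The pairs [(k, f)] with [f] nonzero whose class lies below that of [x], in the
    order of the enveloping semilattice. *)
Definition below (x : G * E) : set (G * S) :=
  [set kf | exists s, [/\ s <> szero, sstar s * s = kf.2, val x.2 * s = s &
    deg s = x.1^-1 * kf.1]].

(** Sending a class to the points below it embeds the enveloping semilattice in a
    semilattice of sets: see [points_inj] and [points_mul]. The algebra of
    [env_mul] is thereby read off from intersections, and every point is a
    character. *)
Definition points (C : Env sigma) : set (G * S) := below (env_repr C).

Lemma below_rel_sub x y : env_rel sigma x y -> below x `<=` below y.
Proof.
case: x y => [g d] [h e] /env_rel_arrow[t [/= td te tg]] [k f] [s [/= s0 sf ds sg]].
have tsE : sstar (t * s) * (t * s) = sstar s * s.
  by rewrite sstarM -mulgA (mulgA (sstar t)) td ds.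
have ts0 : t * s <> szero := sVs_eq_neq0 s0 tsE.
have t0 : t <> szero by move=> t0; apply: ts0; rewrite t0 smul0.
exists (t * s); split=> //=; first by rewrite tsE.
  by rewrite -te -mulgA smulVK_r.
by rewrite degM // sg tg // mulgA -(mulgA _ g) mulgV mulg1.
Qed.

Lemma below_rel x y : env_rel sigma x y -> below x = below y.
Proof.
by move=> xy; apply/seteqP; split; apply: below_rel_sub => //; exact: env_rel_sym.
Qed.

Lemma env_reprP C : env_class sigma (env_repr C).1 (env_repr C).2 = C.
Proof.
have : sval C = [set y | env_rel sigma (env_repr C) y].
  by rewrite /env_repr; case: (cid _).
case: (env_repr C) => g e; case: C => C CP /= CE.
by apply: eq_exist; rewrite CE.
Qed.

Lemma points_class g (e : E) : points (env_class sigma g e) = below (g, e).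
Proof.
have : (sval (env_class sigma g e)) (env_repr (env_class sigma g e)).
  rewrite -[X in sval X]env_reprP /=.
  case: (env_repr _) => h d; exact: env_rel_refl.
by move=> /= /below_rel ->.
Qed.

Lemma below0 g : below (g, semilat0 S) = set0.
Proof. by apply/seteqP; split=> // -[k f] [s [s0 _]]; rewrite /= smul0 => /esym. Qed.

Lemma below_self g (e : E) : val e <> szero -> below (g, e) (g, val e).
Proof.
move=> e0; have ie := valP e; exists (val e).
by rewrite /= (sstar_idem ie) (idem_mul ie) mulVg deg_idem.
Qed.

(** Antisymmetry of the order: if [(g, d)] and [(h, e)] lie below each other by
    [s] and [t], then [s * t] has degree 1 and domain [e], so it is [e], and [s] is
    an arrow from [d] to [e]. *)
Lemma points_inj : injective points.
Proof.
move=> C C'; rewrite -(env_reprP C) -(env_reprP C') !points_class.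
move: (env_repr C) (env_repr C') => [g d] [h e] /= gh.
apply: env_class_eq; apply/env_rel_arrow => /=.
have [d0|/eqP d0] := eqVneq (val d) szero.
  have [e0|/eqP e0] := eqVneq (val e) szero.
    by rewrite d0 e0; exists szero; rewrite smul0 smulr0.
  move: gh; rewrite (_ : d = semilat0 S); last exact: semilat_inj.
  by rewrite below0 => /esym/seteqP[/(_ _ (below_self h e0))].
have [s [/= s0 sd es sg]] : below (h, e) (g, val d) by rewrite -gh; exact: below_self.
have e0 : val e <> szero by move=> e0; apply: s0; rewrite -es e0 smul0.
have [t [/= t0 te dt tg]] : below (g, d) (h, val e) by rewrite gh; exact: below_self.
have ie := valP e.
have stE : sstar (s * t) * (s * t) = val e.
  by rewrite sstarM -mulgA (mulgA (sstar s)) sd dt.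
have st0 : s * t <> szero.
  by move=> st0; apply: e0; rewrite -stE st0 smulr0.
have steq : s * t = val e.
  apply: deg_dom_inj => //.
    by rewrite degM // sg tg deg_idem // mulgA -(mulgA _ g) mulgV mulg1 mulVg.
  by rewrite stE (sstar_idem ie) idem_mul.
have ese : s * sstar s * val e = val e by rewrite -steq -mulgA smulVK_r.
exists s; split=> //.
by rewrite -[RHS]ese (idemC (idem_ssV s) ie) mulgA es.
Qed.

(** If the range of [s] is below [theta g e], then [t := sstar s_g * s] has the
    domain of [s] and range below [e]. Conversely [s * sstar t] has degree [g],
    hence lies below [s_g]. *)
Lemma conj1_le g e s : e \in @idem S -> s <> szero ->
  conj1 (s_ sigma g) e * s = s <->
  exists t, [/\ t <> szero, sstar t * t = sstar s * s, e * t = t & deg t = g^-1 * deg s].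
Proof.
move=> ie s0; split=> [es|[t [t0 ts et tg]]]; last first.
  pose u := s * sstar t.
  have ut : u * t = s by rewrite /u -mulgA ts mulgA smulVK.
  have u0 : u <> szero by move=> u0; apply: s0; rewrite -ut u0 smul0.
  have tV0 : sstar t <> szero by move=> tV0; apply: u0; rewrite /u tV0 smulr0.
  have ug : deg u = g by rewrite /u degM // degV // tg invgM invgK mulVKg.
  have := germ_deg u0; rewrite ug /germ.
  have uu : sstar u * u = t * sstar t.
    by rewrite /u sstarM sstarK mulgA -(mulgA t) -ts !mulgA smulVK.
  case: (s_ sigma g) => [q|] /= uE.
    have qt : q * t = s by rewrite -ut -[in RHS]uE uu -!mulgA (mulgA t) smulVK.
    have qs : sstar q * s = t.
      have quu : sstar q * q * (sstar u * u) = sstar u * u.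
        have uqu : sstar u * u = sstar u * u * (sstar q * q) * (sstar u * u).
          by rewrite -[in LHS]uE sstarM (sstar_idem (idem_sVs u)) !mulgA.
        rewrite [RHS]uqu (idemC (idem_sVs u) (idem_sVs q)) -[RHS]mulgA.
        by rewrite (idem_mul (idem_sVs u)).
      have qut : sstar q * q * t = t.
        by rewrite -[in LHS](smulVK t) -uu mulgA quu uu smulVK.
      by rewrite -qt mulgA.
    have -> : q * e * sstar q * s = s by rewrite -mulgA qs -mulgA et.
    by [].
  have tts : t * sstar t * t = s by rewrite -uu uE.
  by rewrite -tts smulVK et.
case: (s_P g) => [sg|[S1g sg0 sg]].
  by case: s0; rewrite -es sg /= !smul0.
move: es; case E : (s_ sigma g) => [q|] /= es.
  have q0 : q <> szero by move=> q0; case: s0; rewrite -es q0 !smul0.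
  have qqs : q * (sstar q * s) = s by rewrite -es -!mulgA !smulVK_r.
  have ts : sstar (sstar q * s) * (sstar q * s) = sstar s * s.
    by rewrite sstarM sstarK -mulgA qqs.
  have t0 : sstar q * s <> szero := sVs_eq_neq0 s0 ts.
  exists (sstar q * s); split=> //.
    have qsE : sstar q * s = sstar q * q * e * (sstar q * s).
      by rewrite -[in LHS]es !mulgA.
    by rewrite [RHS]qsE (idemC (idem_sVs q) ie) -!mulgA qqs.
  by rewrite degM // degV // -E sg.
(* [s_ g] is the adjoined unit, which has degree 1. *)
exists s; split=> //; have := sg; rewrite E => <-.
have n1 : sigma None = 1.
  apply: (@mulgI _ (sigma None)); rewrite mulg1 -(sigma_morphism (s := None) (t := None)) //.
    by rewrite -E.
  by rewrite -E.
by rewrite n1 invg1 mul1g.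
Qed.

Lemma idem_le_mul d e s : d \in @idem S -> e \in @idem S ->
  d * e * s = s <-> d * s = s /\ e * s = s.
Proof.
move=> id ie; split=> [des|[ds es]]; last by rewrite -mulgA es ds.
split; rewrite -des; first by rewrite !mulgA (idem_mul id).
by rewrite (idemC id ie) !mulgA (idem_mul ie).
Qed.

Lemma conj1_d g (e : E) :
  conj1 (s_ sigma g) (val (smeet1 e (d_ sigma g))) = conj1 (s_ sigma g) (val e).
Proof.
rewrite /d_; case: (s_ sigma g) => [m|] //=.
rewrite (idemC (valP e) (idem_sVs m)).
by rewrite !mulgA smulVK.
Qed.

(** By [conj1_le], the second factor [theta g (e d(g))] of the product expresses
    that the point is below [(h, e)]. *)
Lemma points_mul C C' : points (env_mul C C') = points C `&` points C'.
Proof.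
rewrite /env_mul /points; case E1 : (env_repr C) => [g d]; case E2 : (env_repr C') => [h e].
rewrite -/(points _) points_class; apply/seteqP; split=> -[k f] /=.
  move=> [s [/= s0 sf ds sg]]; move: ds.
  rewrite /= conj1_d => /idem_le_mul[||ds /conj1_le]; [exact: (valP d)|exact: idem_conj1 (valP e)|].
  move=> [||t [t0 ts et tg]] //; first exact: (valP e).
  split; first by exists s.
  exists t; split=> //=; first by rewrite ts.
  by rewrite tg sg invgM invgK mulgA -(mulgA _ g) mulgV mulg1.
move=> [[s [/= s0 sf ds sg]] [t [/= t0 tf et tg]]].
exists s; split=> //=; rewrite /= conj1_d.
apply/idem_le_mul; [exact: (valP d)|exact: idem_conj1 (valP e)|].
split=> //; apply/conj1_le => //; first exact: (valP e).
exists t; split=> //; first by rewrite tf sf.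
by rewrite tg sg invgM invgK mulgA -(mulgA _ g) mulgV mulg1.
Qed.

Lemma points0 : points (env_zero sigma) = set0.
Proof. by rewrite points_class below0. Qed.

Lemma env_mulC (C C' : Env sigma) : env_mul C C' = env_mul C' C.
Proof. by apply: points_inj; rewrite !points_mul setIC. Qed.

Lemma env_mulxx (C : Env sigma) : env_mul C C = C.
Proof. by apply: points_inj; rewrite !points_mul setIid. Qed.

Lemma env_mul_idl C C' : points C `<=` points C' -> env_mul C C' = C.
Proof. by move=> CC'; apply: points_inj; rewrite points_mul; apply/setIidl. Qed.

Lemma env_mul_emb (d e : E) :
  env_mul (env_emb sigma d) (env_emb sigma e) = env_emb sigma (smeet d e).
Proof.
apply: points_inj; rewrite points_mul !points_class.
apply/seteqP; split=> -[k f] /=.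
  move=> [[s [/= s0 sf ds sg]] [t [/= t0 tf et tg]]]; exists s; split=> //=.
  have st : s = t by apply: deg_dom_inj; rewrite ?sf ?tf ?sg ?tg.
  by apply/idem_le_mul; [exact: (valP d)|exact: (valP e)|split; rewrite // st].
move=> [s [/= s0 sf /(idem_le_mul _ (valP d) (valP e))[ds es] sg]].
by split; exists s.
Qed.

Lemma env_act_class g h (e : E) :
  env_act g (env_class sigma h e) = env_class sigma (g * h) e.
Proof.
rewrite /env_act; have := env_reprP (env_class sigma h e).
case: (env_repr _) => h' e' /= /(congr1 points); rewrite !points_class => he.
apply: points_inj; rewrite !points_class; apply/seteqP; split=> -[k f] [s [/= s0 sf es sg]].
  have [t [t0 tf et tg]] : below (h, e) (g^-1 * k, f).
    by rewrite -he; exists s; split=> //=; rewrite sg invgM mulgA.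
  by exists t; split=> //=; rewrite tg invgM mulgA.
have [t [t0 tf et tg]] : below (h', e') (g^-1 * k, f).
  by rewrite he; exists s; split=> //=; rewrite sg invgM mulgA.
by exists t; split=> //=; rewrite tg invgM mulgA.
Qed.

Definition sdom s : E := exist _ (sstar s * s) (idem_sVs s).
Definition sran s : E := exist _ (s * sstar s) (idem_ssV s).

Lemma env_act_sdom s : s <> szero ->
  env_act (deg s) (env_emb sigma (sdom s)) = env_emb sigma (sran s).
Proof.
move=> s0; rewrite env_act_class mulg1; apply: env_class_eq; apply/env_rel_arrow.
by rewrite /= invg1 mul1g; exists s.
Qed.

Lemma le_germ s g e : e \in @idem S -> s <> szero -> deg s = g ->
  s * e = s -> germ g e * (sstar s * s) = s.
Proof.
move=> ie s0 sg se; have := germ_deg s0; rewrite sg /germ.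
have ese : e * (sstar s * s) = sstar s * s.
  by rewrite (idemC ie (idem_sVs s)) -mulgA se.
by case: (s_ sigma g) => [m|] /= E; rewrite -?mulgA ese // mulgA.
Qed.

Lemma le_smulr1 s g e : e \in @idem S -> s <> szero -> deg s = g ->
  e * s = s -> s * sstar s * smulr1 e (s_ sigma g) = s.
Proof.
move=> ie s0 sg es; have := le_s_ s0; rewrite sg.
have ese : s * sstar s * e = s * sstar s.
  by rewrite -(idemC ie (idem_ssV s)) mulgA es.
by case: (s_ sigma g) => [m|] /= E; rewrite ?mulgA ese.
Qed.

(** The restriction of [s_ g^-1] and the inverse of that of [s_ g] have the same
    degree, so by [le_germ] and [le_smulr1] each is below the other. *)
Lemma germV g e : e \in @idem S -> germ g^-1 e = sstar (smulr1 e (s_ sigma g)).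
Proof.
move=> ie; set y := germ g^-1 e; set s := smulr1 e (s_ sigma g).
have ye : y * e = y.
  by rewrite /y /germ; case: (s_ sigma g^-1) => [m|] /=; rewrite -?mulgA idem_mul.
have es : e * s = s.
  by rewrite /s /smulr1; case: (s_ sigma g) => [m|] /=; rewrite ?mulgA idem_mul.
have [y0|/eqP y0] := eqVneq y szero.
  have [s0|/eqP s0] := eqVneq s szero; first by rewrite y0 s0 sstar0.
  have sV0 : sstar s <> szero by move=> /(congr1 (@sstar S)); rewrite sstarK sstar0.
  have := @le_germ (sstar s) g^-1 e ie sV0; rewrite degV // deg_smulr1 // => /(_ erefl).
  rewrite -{1}(sstar_idem ie) -sstarM es => /(_ erefl).
  by rewrite -/y y0 smul0 => /esym.
have yV0 : sstar y <> szero by move=> /(congr1 (@sstar S)); rewrite sstarK sstar0.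
have yd : deg (sstar y) = g by rewrite degV // deg_germ // invgK.
have eyV : e * sstar y = sstar y by rewrite -{1}(sstar_idem ie) -sstarM ye.
have ys := le_smulr1 ie yV0 yd eyV; rewrite sstarK -/s in ys.
have s0 : s <> szero by move=> s0; apply: yV0; rewrite -ys s0 smulr0.
have sV0 : sstar s <> szero by move=> /(congr1 (@sstar S)); rewrite sstarK sstar0.
have sVe : sstar s * e = sstar s by rewrite -{1}(sstar_idem ie) -sstarM es.
have sd : deg (sstar s) = g^-1 by rewrite degV // deg_smulr1.
have sy := le_germ ie sV0 sd sVe; rewrite sstarK -/y in sy.
have yE : y = sstar s * (sstar y * y).
  by rewrite -[LHS]sstarK -[in LHS]ys sstarM (sstar_idem (idem_sVs y)).
rewrite -[RHS]sy [LHS]yE -[in LHS]sy -mulgA (idemC (idem_ssV s) (idem_sVs y)).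
by rewrite !mulgA smulVK.
Qed.

(** By [germV], [theta g^-1 e] is the range of the inverse of [e s_g]. *)
Lemma env_theta_sdom g (e : E) :
  theta sigma g^-1 (smeet1 e (d_ sigma g^-1)) = sdom (smulr1 (val e) (s_ sigma g)).
Proof.
apply: semilat_inj; rewrite /= conj1_d.
have -> : conj1 (s_ sigma g^-1) (val e) = germ g^-1 (val e) * sstar (germ g^-1 (val e)).
  rewrite /germ; have ie := valP e; case: (s_ sigma g^-1) => [m|] /=.
    by rewrite sstarM (sstar_idem ie) [RHS]mulgA -(mulgA m (val e) (val e)) (idem_mul ie).
  by rewrite (sstar_idem ie) (idem_mul ie).
by rewrite germV ?sstarK //; exact: (valP e).
Qed.

Lemma env_theta1 (e : E) : theta sigma 1 (smeet1 e (d_ sigma 1)) = e.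
Proof.
have ie := valP e; rewrite -[X in theta _ X]invg1 -[X in d_ _ X]invg1 env_theta_sdom.
pose s := smulr1 (val e) (s_ sigma 1).
apply: semilat_inj; rewrite -[LHS]/(sstar s * s).
suff -> : s = val e by rewrite (sstar_idem ie) idem_mul.
rewrite /s; have [e0|/eqP e0] := eqVneq (val e) szero.
  by rewrite e0; case: (s_ sigma 1) => [m|] /=; rewrite ?smul0.
by have := le_s_ e0; rewrite (sstar_idem ie) (idem_mul ie) (deg_idem ie e0).
Qed.

End Grading.

(** * Partial shifts and the left regular representation *)

Section Pullback.
Variables (R : realType) (X : choiceType) (H : hilbertType R).
Implicit Types (T : l2 X H -> l2 X H) (f : X -> option X).

(** Both the operators [Lambda s] and the translations of the crossed product are
    composition with a partial injection of the index set. *)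
Definition pulls_back T f : Prop := forall xi y, T xi y = oapp xi 0 (f y).

Definition partial_inverse f f' : Prop := forall x y, f y = Some x <-> f' x = Some y.

Lemma pulls_back_le T f f' : partial_inverse f f' -> pulls_back T f -> op_le T 1.
Proof.
move=> ff' TE xi; rewrite mul1r; apply: l2_norm_le => // J.
under eq_bigr do rewrite TE; apply: sum_pullback => y y' x /ff' yx /ff'.
by rewrite yx => -[].
Qed.

Lemma pulls_back_bounded T f f' : partial_inverse f f' -> pulls_back T f -> bounded_op T.
Proof.
move=> ff' TE; split=> [a xi zeta|].
  apply: l2E => y; rewrite l2D l2Z !TE; case: (f y) => [x|] //=.
  by rewrite scaler0 addr0.
by exists 1; exact: pulls_back_le TE.
Qed.

Lemma pulls_back_delta T f f' x v : partial_inverse f f' -> pulls_back T f ->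
  T (l2_delta x v) = oapp (fun y => l2_delta y v) 0 (f' x).
Proof.
move=> ff' TE; apply: l2E => y; rewrite TE.
case E' : (f' x) => [y'|] /=.
  rewrite l2_deltaE; case: eqP => [->|yy'].
    by move/ff': E' => ->; rewrite /= l2_deltaE eqxx.
  case E : (f y) => [x'|] //=; rewrite l2_deltaE; case: eqP => // xx'.
  by move/ff': E; rewrite xx' E' => -[/esym].
case E : (f y) => [x'|] //=; rewrite l2_deltaE; case: eqP => // xx'.
by move/ff': E; rewrite xx' E'.
Qed.

Lemma pulls_back_adjoint T T' f f' : partial_inverse f f' ->
  pulls_back T f -> pulls_back T' f' -> adjoint T T'.
Proof.
move=> ff' TE TE'; have f'f : partial_inverse f' f by move=> x y; split=> /ff'.
apply: l2_fin_adjoint; [exact: pulls_back_bounded TE|exact: pulls_back_bounded TE'|].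
move=> x v y w; rewrite hdot_delta TE (pulls_back_delta _ _ f'f TE').
case E : (f y) => [z|] /=; last by rewrite hdot0l hdot0r.
by rewrite hdot_delta2 l2_deltaE [z == x]eq_sym; case: eqP => // _; rewrite hdot0l.
Qed.

End Pullback.

Section LambdaRep.
Local Open Scope group_scope.
Variables (R : realType) (S : invSemigroup0Type).
Implicit Types (s t : S) (x y z : nonzero S).

Lemma Lambda_dom_inv s : partial_inverse (@Lambda_dom S s) (@Lambda_dom S (sstar s)).
Proof.
by move=> x y; split=> /Lambda_domP []; rewrite ?sstarK => sx yx;
  apply/Lambda_domP; rewrite ?sstarK; split;
  rewrite yx ?mulgA ?smulVK ?sstarVK ?sx.
Qed.

Lemma Lambda_dom_mul s t y :
  Lambda_dom (s * t) y = obind (@Lambda_dom S t) (Lambda_dom s y).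
Proof.
have split_dom x : sstar (s * t) * (s * t) * val x = val x <->
    sstar t * t * val x = val x /\ sstar s * s * (t * val x) = t * val x.
  have -> : sstar (s * t) * (s * t) * val x = sstar t * (sstar s * s * (t * val x)).
    by rewrite sstarM !mulgA.
  split=> [E|[E1 ->]]; last by rewrite mulgA.
  split; first by rewrite -E !mulgA sstarVK.
  rewrite -[in RHS]E [RHS]mulgA [RHS]mulgA (idemC (idem_ssV t) (idem_sVs s)).
  by rewrite -!mulgA smulVK_r !mulgA.
apply/eqP; case E : (Lambda_dom (s * t) y) => [x|]; last first.
  case E1 : (Lambda_dom s y) => [z|] //=; case E2 : (Lambda_dom t z) => [x|] //.
  move/Lambda_domP: E1 => [sz yz]; move/Lambda_domP: E2 => [tx zx].
  have : Lambda_dom (s * t) y = Some x.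
    apply/Lambda_domP; split; last by rewrite yz zx mulgA.
    by apply/split_dom; rewrite -zx.
  by rewrite E.
move/Lambda_domP: E => [/split_dom[tx sx] yE].
have tx0 : t * val x != szero.
  by apply: contra_not_neq (elimN eqP (valP x)) => tx0; rewrite -tx -mulgA tx0 smulr0.
pose z : nonzero S := exist _ (t * val x) tx0.
have -> : Lambda_dom s y = Some z.
  by apply/Lambda_domP; split; [exact: sx|rewrite yE /= mulgA].
by rewrite /= (_ : Lambda_dom t z = Some x) //; apply/Lambda_domP.
Qed.

Lemma Lambda_star_rep :
  star_rep (fun s t => s * t) (@sstar S) (@Lambda R S).
Proof.
have LE s : pulls_back (@Lambda R S s) (@Lambda_dom S s) by move=> xi y; exact: LambdaE.
split=> [s|s t|s].
- exact: pulls_back_bounded (Lambda_dom_inv s) (LE s).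
- apply/funext => xi; apply: l2E => y; rewrite /= !LambdaE Lambda_dom_mul.
  by case: (Lambda_dom s y) => //= z; rewrite LambdaE.
- exact: pulls_back_adjoint (Lambda_dom_inv s) (LE s) (LE (sstar s)).
Qed.

Lemma Lambda_l2_delta s x (v : hscalar R) : Lambda s (l2_delta x v) =
  oapp (fun y => l2_delta y v) 0%R (Lambda_dom (sstar s) x).
Proof.
apply: pulls_back_delta (Lambda_dom_inv s) _ => xi y; exact: LambdaE.
Qed.

End LambdaRep.

(** * The crossed product and its corner *)

Section Covariant.
Local Open Scope group_scope.
Variables (R : realType) (G : groupType) (A : cstarType R) (H : hilbertType R).
Variables (tau : G -> A -> A) (pi : A -> H -> H).
Hypotheses (tauP : cstar_action tau) (piP : cstar_rep pi).
Implicit Types (a b : A) (g h k : G) (xi : l2 G H) (v : H).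
Local Notation emb := (cp_emb tau pi).
Local Notation U := (@cp_unitary R G H).

Lemma cp_emb_apply a xi h : emb a xi h = pi (tau h^-1 a) (xi h).
Proof. exact: cp_embE. Qed.

Lemma cp_emb_le a : op_le (emb a) `|a|%R.
Proof.
move=> xi; apply: l2_norm_le => [|J]; first by rewrite mulr_ge0.
apply: (@le_trans _ _ (\sum_(h <- J) `|a| ^+ 2 * `|xi h| ^+ 2)%R).
  apply: ler_sum => k _; rewrite cp_emb_apply -exprMn lerXn2r ?nnegrE ?mulr_ge0 //.
  case: tauP => tauS _ _; have [tL tM tS] := tauS k^-1.
  case: piP => piL piB piM piS.
  apply: (@cstar_rep_contractive _ _ _ (fun b => pi (tau k^-1 b))).
  by split=> [c x y|x|x y|x]; rewrite ?tL ?piL ?tM ?piM ?tS.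
rewrite -mulr_sumr exprMn ler_wpM2l ?exprn_ge0 //.
by rewrite -[X in (_ <= X)%R]l2_hdot_normE psum_le_dot.
Qed.

Lemma cp_emb_linear a : linear (emb a).
Proof.
move=> c xi zeta; apply: l2E => h; rewrite l2D l2Z !cp_emb_apply.
by case: piP => _ /(_ (tau h^-1 a))[piL _] _ _; rewrite -piL.
Qed.

Lemma cp_emb_bounded a : bounded_op (emb a).
Proof. by split; [exact: cp_emb_linear|exists `|a|%R; exact: cp_emb_le]. Qed.

Lemma cp_embP c a b : emb (c *: a + b)%R = (c *: emb a + emb b)%R.
Proof.
case: tauP => tauS _ _; apply/funext => xi; apply: l2E => h.
have [tL _ _] := tauS h^-1; rewrite -[RHS]/(c *: emb a xi h + emb b xi h)%R !cp_emb_apply.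
by rewrite tL (cstar_repD piP) (cstar_repZ piP).
Qed.

Lemma cp_embM a b : emb (cmul a b) = emb a \o emb b.
Proof.
case: tauP => tauS _ _; apply/funext => xi; apply: l2E => h.
have [_ tM _] := tauS h^-1; rewrite /= !cp_emb_apply tM.
by case: piP => _ _ -> _.
Qed.

Lemma cp_emb_delta a h v : emb a (l2_delta h v) = l2_delta h (pi (tau h^-1 a) v).
Proof.
apply: l2E => k; rewrite cp_emb_apply !l2_deltaE; case: eqP => [->//|_].
by case: piP => _ /(_ (tau k^-1 a))[piL _] _ _; exact: (lin_0 piL).
Qed.

Lemma cp_emb_adj a : adjoint (emb a) (emb (cstar a)).
Proof.
apply: l2_fin_adjoint; [exact: cp_emb_bounded|exact: cp_emb_bounded|].
move=> h v k w; rewrite !cp_emb_delta !hdot_delta2; case: eqP => // <-.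
case: tauP => /(_ h^-1)[_ _ tS] _ _; case: piP => _ _ _ piS.
by rewrite piS tS.
Qed.

Lemma cp_unitary_pulls g : pulls_back (U g) (fun h => Some (g^-1 * h)).
Proof. by move=> xi h; rewrite cp_unitaryE. Qed.

Lemma cp_unitary_inv g :
  partial_inverse (fun h => Some (g^-1 * h)) (fun h => Some (g * h)).
Proof.
by move=> h k; split=> -[<-]; rewrite ?mulKg ?mulVKg.
Qed.

Lemma cp_unitary_bounded g : bounded_op (U g).
Proof. exact: pulls_back_bounded (cp_unitary_inv g) (cp_unitary_pulls g). Qed.

Lemma cp_unitary_delta g h v : U g (l2_delta h v) = l2_delta (g * h) v.
Proof. exact: pulls_back_delta (cp_unitary_inv g) (cp_unitary_pulls g). Qed.

Lemma cp_unitary_adj g : adjoint (U g) (U g^-1).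
Proof.
apply: pulls_back_adjoint (cp_unitary_inv g) (cp_unitary_pulls g) _.
by move=> xi h; rewrite cp_unitaryE invgK.
Qed.

Lemma cp_unitary1 : U 1 = id.
Proof. by apply/funext => xi; apply: l2E => h; rewrite cp_unitaryE invg1 mul1g. Qed.

Lemma cp_unitaryM g h : U (g * h) = U g \o U h.
Proof.
apply/funext => xi; apply: l2E => k.
by rewrite /= !cp_unitaryE invgM mulgA.
Qed.

Lemma cp_covariant g a : U g \o emb a = emb (tau g a) \o U g.
Proof.
apply/funext => xi; apply: l2E => h; rewrite /= cp_unitaryE !cp_emb_apply cp_unitaryE.
by case: tauP => _ _ tM; rewrite -tM invgM invgK.
Qed.

End Covariant.

Section Corner.
Local Open Scope group_scope.
Variables (R : realType) (S : invSemigroup0Type) (G : groupType).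
Variable sigma : option S -> G.
Hypothesis S_zero_F_inverse : zero_F_inverse S.
Hypothesis sigma_morphism : morphism_to_group sigma.
Hypothesis sigma_injective : set_inj (@maximal_elt S) sigma.
Variables (A : cstarType R) (p : Env sigma -> A).
Hypothesis p_rep : semilattice_rep (@env_mul S G sigma) (env_zero sigma) p.
Variables (tau : G -> A -> A) (tau_induced : induced_action p tau).
Variables (H : hilbertType R) (pi : A -> H -> H).
Hypothesis piP : cstar_rep pi.
Implicit Types (s t : S) (g h k : G) (C : Env sigma) (e : semilat S).

Let tauP : cstar_action tau := tau_induced.1.
Local Notation emb := (cp_emb tau pi).
Local Notation U := (@cp_unitary R G H).
Local Notation deg s := (sigma (Some s)).
Local Notation q C := (emb (p C)).
Local Notation B := (crossed_product tau pi).

Lemma env_proj_adj C : adjoint (q C) (q C).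
Proof.
by have := cp_emb_adj tauP piP (p C); case: p_rep => /(_ C)[-> _].
Qed.

Lemma env_proj_mul C C' : q C \o q C' = q (env_mul C C').
Proof. by rewrite -cp_embM //; case: p_rep => _ _ ->. Qed.

Lemma env_proj_idem C : q C \o q C = q C.
Proof. by rewrite -cp_embM //; case: p_rep => /(_ C)[_ ->]. Qed.

Lemma env_proj0 : q (env_zero sigma) = 0%R.
Proof.
case: p_rep => _ -> _; have := cp_embP tauP piP (-1) 0%R 0%R.
by rewrite scaleN1r addNr scaleN1r addNr.
Qed.

Lemma env_proj_shift g C : U g \o q C = q (env_act g C) \o U g.
Proof. by rewrite cp_covariant // tau_induced.2. Qed.

(** The indices multiply as in the semidirect product of [Env sigma] by [G]. *)
Definition cp_gen (x : Env sigma * G) : l2 G H -> l2 G H := q x.1 \o U x.2.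
Definition cp_gen_mul (x y : Env sigma * G) :=
  (env_mul x.1 (env_act x.2 y.1), x.2 * y.2).
Definition cp_gen_star (x : Env sigma * G) := (env_act x.2^-1 x.1, x.2^-1).

(** The image of [s] in the corner. Since [s] is the restriction of [s_ g] to its
    domain, [g] its degree, this is the translation by [g] cut down to the domain
    of [s]. For [s = szero] the degree is arbitrary, and the operator is 0. *)
Definition corner_gen (s : S) : l2 G H -> l2 G H :=
  U (deg s) \o q (env_emb sigma (sdom s)).

Lemma cp_gen_star_rep : star_rep cp_gen_mul cp_gen_star cp_gen.
Proof.
split=> [x|x y|x].
- by apply: bounded_op_comp; [exact: cp_emb_bounded|exact: cp_unitary_bounded].
- rewrite /cp_gen /= -env_proj_mul cp_unitaryM.
  rewrite -[RHS]/(q x.1 \o (U x.2 \o q y.1) \o U y.2).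
  by rewrite env_proj_shift.
- rewrite /cp_gen /= -env_proj_shift.
  exact: adjoint_comp (env_proj_adj _) (cp_unitary_adj _).
Qed.

Lemma corner_gen_cp s :
  corner_gen s = cp_gen (env_act (deg s) (env_emb sigma (sdom s)), deg s).
Proof. exact: env_proj_shift. Qed.

Lemma sdom0 : env_emb sigma (sdom szero) = env_zero sigma.
Proof.
by congr env_class; apply: semilat_inj; rewrite /= smulr0.
Qed.

Lemma sran0 : env_emb sigma (sran szero) = env_zero sigma.
Proof.
by congr env_class; apply: semilat_inj; rewrite /= smul0.
Qed.

Lemma corner_gen0 : corner_gen szero = 0%R.
Proof.
rewrite /corner_gen sdom0 env_proj0; apply/funext => xi /=.
by have [/(@lin_0 _ _ _ _)] := @cp_unitary_bounded R G H (deg szero).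
Qed.

Lemma corner_gen_ran s : corner_gen s = q (env_emb sigma (sran s)) \o U (deg s).
Proof.
have [->|/eqP s0] := eqVneq s szero; first by rewrite corner_gen0 sran0 env_proj0.
by rewrite /corner_gen env_proj_shift env_act_sdom.
Qed.

(** Moving the range projection of [t] past the domain projection of [s] replaces
    [t] by its restriction [r], with [s * r = s * t]. *)
Lemma corner_gen_star_rep : star_rep (fun s t => s * t) (@sstar S) corner_gen.
Proof.
split=> [s|s t|s].
- by apply: bounded_op_comp; [exact: cp_unitary_bounded|exact: cp_emb_bounded].
- pose r := sstar s * s * t.
  have rE : env_mul (env_emb sigma (sdom s)) (env_emb sigma (sran t)) =
      env_emb sigma (sran r).
    rewrite env_mul_emb //; congr env_class; apply: semilat_inj; rewrite /= /r.
    rewrite sstarM (sstar_idem (idem_sVs s)) [RHS]mulgA -(mulgA (sstar s * s) t).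
    rewrite (idemC (idem_sVs s) (idem_ssV t)) -[RHS]mulgA.
    by rewrite (idem_mul (idem_sVs s)).
  have -> : corner_gen s \o corner_gen t = U (deg s) \o q (env_emb sigma (sran r)) \o U (deg t).
    by rewrite -rE -env_proj_mul (corner_gen_ran t).
  have sr : s * r = s * t by rewrite /r !mulgA smulVK.
  have [r0|/eqP r0] := eqVneq r szero.
    rewrite r0 sran0 env_proj0 -sr r0 smulr0 corner_gen0.
    apply/funext => xi /=.
    by have [/(@lin_0 _ _ _ _)->] := @cp_unitary_bounded R G H (deg s).
  have st0 : s * t <> szero.
    by move=> st0; apply: r0; rewrite /r -mulgA st0 smulr0.
  have t0 : t <> szero by move=> t0; apply: st0; rewrite t0 smulr0.
  have dr : deg r = deg t.
    by rewrite /r degM // deg_idem ?mul1g ?idem_sVs // => ss0; apply: r0; rewrite /r ss0 smul0.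
  have := corner_gen_ran r; rewrite dr => /(congr1 (fun T => U (deg s) \o T)) => rr.
  rewrite -[RHS]rr /corner_gen dr degM // cp_unitaryM.
  congr (_ \o _ \o q (env_class _ _ _)); apply: semilat_inj => /=.
  rewrite /r !sstarM sstarK -!mulgA; congr (_ * _).
  by rewrite (mulgA (sstar s) s) !mulgA sstarVK.
- have [->|/eqP s0] := eqVneq s szero; first by rewrite sstar0 corner_gen0; exact: adjoint0.
  rewrite (corner_gen_ran (sstar s)) degV // (_ : sran (sstar s) = sdom s).
    exact: adjoint_comp (cp_unitary_adj _) (env_proj_adj _).
  by apply: semilat_inj; rewrite /= sstarK.
Qed.

Hypothesis p_gen : smallest (@cstar_subalg R A) (range p) = setT.

(** The projections [p C] generate [A], and the elements [a] of [A] whose two-sided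
    translates [U g \o emb a \o U h] all lie in [D] form a C*-subalgebra; the
    one-sided products would not be stable under the involution. *)
Lemma cp_gen_coef (D : set (l2 G H -> l2 G H)) : op_cstar_subalg D ->
  range cp_gen `<=` D -> forall a g, D (emb a \o U g).
Proof.
case=> Db [D0 Dl] Dm Da Dc Dgen.
pose Z := [set a : A | forall g h, D (U g \o emb a \o U h)].
have ZP : cstar_subalg Z.
  have e0 : emb 0%R = 0%R.
    by have := cp_embP tauP piP (-1) 0%R 0%R; rewrite scaleN1r addNr scaleN1r addNr.
  have ub g : linear (U g) by have [] := @cp_unitary_bounded R G H g.
  split.
  - move=> g h; rewrite e0; have -> // : U g \o 0%R \o U h = 0%R.
    by apply/funext => xi /=; exact: (lin_0 (ub g)).
  - move=> c a b Za Zb g h; rewrite (cp_embP tauP piP).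
    have -> : U g \o (c *: emb a + emb b)%R \o U h =
        (c *: (U g \o emb a \o U h) + (U g \o emb b \o U h))%R.
      apply/funext => xi.
      by rewrite -[LHS]/(U g (c *: emb a (U h xi) + emb b (U h xi)))%R (ub g).
    by apply: Dl; [exact: Za|exact: Zb].
  - move=> a b Za Zb g h; rewrite (cp_embM tauP piP).
    have -> : U g \o (emb a \o emb b) \o U h =
        (U g \o emb a \o U 1) \o (U 1 \o emb b \o U h) by rewrite cp_unitary1.
    by apply: Dm; [exact: Za|exact: Zb].
  - move=> a Za g h; apply: Da (Za h^-1 g^-1) _.
    have := adjoint_comp (adjoint_comp (cp_unitary_adj h^-1) (cp_emb_adj tauP piP a))
      (cp_unitary_adj g^-1).
    by rewrite !invgK.
  - move=> a Za g h; apply: Dc; split.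
      apply: bounded_op_comp; last exact: cp_unitary_bounded.
      by apply: bounded_op_comp; [exact: cp_unitary_bounded|exact: cp_emb_bounded].
    move=> e eps; have [b [Zb ab]] := Za _ (nbhsx_ballx a e eps).
    exists (U g \o emb b \o U h); first exact: Zb.
    move=> xi; rewrite /= -(lin_sub (ub g)).
    have Ule k zeta : (`|U k zeta| <= `|zeta|)%R.
      by rewrite -[leRHS]mul1r; apply: pulls_back_le (cp_unitary_inv k) (cp_unitary_pulls _) _.
    apply: le_trans (Ule _ _) _.
    have -> : (emb a (U h xi) - emb b (U h xi) = emb (a - b)%R (U h xi))%R.
      have -> : (a - b = -1 *: b + a)%R by rewrite scaleN1r addrC.
      rewrite (cp_embP tauP piP).
      by rewrite -[RHS]/(-1 *: emb b (U h xi) + emb a (U h xi))%R scaleN1r addrC.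
    apply: le_trans (cp_emb_le tauP piP _ _) _; apply: ler_pM => //.
    by move: ab; rewrite -ball_normE => /ltW.
have ZT a : Z a.
  have : setT a by []; rewrite -p_gen; apply; split=> // _ [C _ <-] g h.
  rewrite env_proj_shift -[X in D X]/(q (env_act g C) \o (U g \o U h)) -cp_unitaryM; apply: Dgen.
  by exists (env_act g C, g * h).
by move=> a g; have := ZT a 1 g; rewrite cp_unitary1.
Qed.

Lemma crossed_productE : B = op_closure (range (lincomb cp_gen)).
Proof.
have DP := op_closure_lincomb_subalg cp_gen_star_rep.
apply/seteqP; split.
  apply: (smallest_sub DP) => _ [a [g ->]]; apply: (cp_gen_coef DP).
  rewrite -(op_cstar_lincomb cp_gen_star_rep); exact: sub_gen_smallest.
move=> T TD E [EP gE]; apply: (op_closure_lincomb_sub EP _ TD).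
by move=> _ [[C g] _ <-]; apply: gE; exists (p C), g.
Qed.

Lemma crossed_product_subalg : op_cstar_subalg B.
Proof. by rewrite crossed_productE; exact: op_closure_lincomb_subalg cp_gen_star_rep. Qed.

Lemma cp_gen_in x : B (cp_gen x).
Proof. by move=> E [_]; apply; exists (p x.1), x.2. Qed.

Section Unit.
Variable P : l2 G H -> l2 G H.
Hypothesis P_unit : unit_projection p tau pi P.

Lemma unit_linear : linear P. Proof. by case: P_unit => -[[]]. Qed.
Lemma unit_adj : adjoint P P. Proof. by case: P_unit => -[]. Qed.
Lemma unit_bounded : bounded_op P. Proof. by case: P_unit => -[]. Qed.

Lemma unit_emb_l e : P \o q (env_emb sigma e) = q (env_emb sigma e).
Proof. by case: P_unit => _ _ ->; rewrite env_theta1. Qed.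

Lemma unit_emb_r e : q (env_emb sigma e) \o P = q (env_emb sigma e).
Proof.
apply: (@adjoint_uniq _ _ (q (env_emb sigma e))); last exact: env_proj_adj.
by rewrite -{1}unit_emb_l; apply: adjoint_comp; [exact: unit_adj|exact: env_proj_adj].
Qed.

Lemma unit_class_r g e : q (env_class sigma g^-1 e) \o P =
  q (env_emb sigma (sdom (smulr1 (val e) (s_ sigma g)))).
Proof.
apply: (@adjoint_uniq _ _ (P \o q (env_class sigma g^-1 e))).
  by apply: adjoint_comp; [exact: unit_adj|exact: env_proj_adj].
case: P_unit => _ _ ->; rewrite env_theta_sdom //; exact: env_proj_adj.
Qed.

(** [e U_g 1 = U_g [g^-1, e] 1], and the unit multiplies [[g^-1, e]] to the image
    of [e] under [theta g^-1], which is the domain of [e s_g]. *)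
Lemma emb_unitary_unit e g :
  q (env_emb sigma e) \o U g \o P = corner_gen (smulr1 (val e) (s_ sigma g)).
Proof.
have -> : env_emb sigma e = env_act g (env_class sigma g^-1 e).
  by rewrite env_act_class // mulgV.
rewrite -env_proj_shift -[LHS]/(U g \o (q (env_class sigma g^-1 e) \o P)) unit_class_r.
set s := smulr1 _ _; have [s0|/eqP s0] := eqVneq s szero; last first.
  by rewrite /corner_gen /s deg_smulr1 //; exact: (valP e).
rewrite s0 sdom0 env_proj0 corner_gen0; apply/funext => xi /=.
by have [/(@lin_0 _ _ _ _)] := @cp_unitary_bounded R G H g.
Qed.

Lemma unit_corner_gen s : P \o corner_gen s \o P = corner_gen s.
Proof.
have VE := corner_gen_ran s; rewrite VE.
rewrite -[LHS]/((P \o q (env_emb sigma (sran s))) \o U (deg s) \o P) unit_emb_l.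
rewrite -VE /corner_gen -[LHS]/(U (deg s) \o (q (env_emb sigma (sdom s)) \o P)).
by rewrite unit_emb_r.
Qed.

Lemma unit_cp_gen x : exists s, P \o cp_gen x \o P = corner_gen s.
Proof.
case: x => C g; rewrite /cp_gen /= -(env_reprP C).
case: (env_repr C) => h e /=; case: P_unit => _ _ PE.
exists (smulr1 (val (theta sigma h (smeet1 e (d_ sigma h)))) (s_ sigma g)).
by rewrite -emb_unitary_unit -PE.
Qed.

Lemma unit_lincomb_cp L : exists L',
  P \o lincomb cp_gen L \o P = lincomb corner_gen L'.
Proof.
elim: L => [|q L [L' IH]].
  exists [::]; rewrite !lincomb_nil; apply/funext => xi /=.
  exact: (lin_0 unit_linear).
have [s sE] := unit_cp_gen q.2.
exists ((q.1, s) :: L'); rewrite !lincomb_cons -IH /= -sE.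
by apply/funext => xi; exact: unit_linear.
Qed.

(** Compressing by [P] turns each generator of the crossed product into a
    [corner_gen s], and fixes the latter. *)
Lemma cornerE : corner B P = op_closure (range (lincomb corner_gen)).
Proof.
have [M M0 PM] := bounded_op_le unit_bounded.
have cut (T T' : l2 G H -> l2 G H) (e : R[i]) : (0 < e)%R -> op_le (T - T')%R e ->
    op_le ((P \o T \o P) - (P \o T' \o P))%R (M * M * e)%R.
  move=> e0 TT' xi; rewrite -[(_ - _)%R xi]/(P (T (P xi)) - P (T' (P xi)))%R.
  rewrite -(lin_sub unit_linear); apply: le_trans (PM _) _.
  have -> : (M * M * e * `|xi| = M * (e * (M * `|xi|)))%R by ring.
  apply: ler_wpM2l => //; apply: le_trans (TT' _) _.
  by rewrite ler_wpM2l // ltW.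
have cgb : range (lincomb corner_gen) `<=` @bounded_op R (l2 G H).
  by move=> _ [L _ <-]; exact: (lincomb_bounded corner_gen_star_rep).
apply/seteqP; split.
  move=> _ [b bB <-]; have bb : bounded_op b.
    by case: crossed_product_subalg => /(_ b bB).
  move: bB; rewrite crossed_productE => bD.
  apply: (@op_closure_le _ _ _ _ (M * M)%R).
  - by apply: bounded_op_comp unit_bounded; exact: bounded_op_comp unit_bounded bb.
  - by rewrite mulr_ge0.
  move=> e e0 _; have [_ [L _ <-] bL] := op_closureP bD e0.
  have [L' LE] := unit_lincomb_cp L.
  by exists (lincomb corner_gen L'); [exists L'|rewrite -LE; exact: cut].
move=> T TD; exists T.
  apply: (op_closure_lincomb_sub crossed_product_subalg _ TD) => _ [s _ <-].
  by rewrite corner_gen_cp; exact: cp_gen_in.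
apply/eqP; rewrite -subr_eq0; apply/eqP.
apply: (@op_eq0_small _ _ _ (M * M + 1)%R); first by rewrite addr_ge0 // mulr_ge0.
move=> e e0; have [_ [L _ <-] TL] := op_closureP TD e0.
have PLP : P \o lincomb corner_gen L \o P = lincomb corner_gen L.
  elim: L {TL} => [|q L IH].
    by rewrite lincomb_nil; apply/funext => xi /=; exact: (lin_0 unit_linear).
  rewrite lincomb_cons -{2}IH -{2}(unit_corner_gen q.2).
  by apply/funext => xi; exact: unit_linear.
rewrite -(subrK (lincomb corner_gen L) (P \o T \o P)) -addrA mulrDl mul1r.
apply: op_leD; first by rewrite -PLP; exact: cut.
by rewrite -opprB; exact: op_leN.
Qed.

(** With [C = [h, e]], the generator [C U_g] factors through the unit as
    [(U_h e) 1 (e U_{h^-1 g})]: every class is a translate of one below the unit. *)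
Lemma unit_full_corner : full_corner B P.
Proof.
rewrite /full_corner {1}crossed_productE; apply: op_closureS => _ [L _ <-] D [DP BD].
apply: lincomb_subspace => // _ [[C g] _ <-]; apply: BD.
case E : (env_repr C) => [h e].
have CE : C = env_class sigma h e.
  by rewrite -(env_reprP C) E.
exists (cp_gen (C, h)), (cp_gen (env_emb sigma e, h^-1 * g)); split; try exact: cp_gen_in.
have CA : C = env_act h (env_emb sigma e) by rewrite env_act_class // mulg1.
rewrite /cp_gen /= {2}CA -env_proj_shift.
rewrite -[RHS]/(U h \o ((q (env_emb sigma e) \o P) \o q (env_emb sigma e)) \o U (h^-1 * g)).
rewrite unit_emb_r env_proj_idem env_proj_shift -CA.
by rewrite -[RHS]/(q C \o (U h \o U (h^-1 * g))) -cp_unitaryM mulVKg.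
Qed.

End Unit.
End Corner.

(** * Characters of the enveloping semilattice *)

(** Characters take values in the complex numbers, seen as a C*-algebra. *)
Section ScalarCstar.
Variable R : realType.
Implicit Types x y z : hscalar R.

Definition scalar_mul x y : hscalar R := (x : R[i]) * (y : R[i]).
Definition scalar_conj x : hscalar R := (x : R[i])^*.

Fact scalar_mulA x y z : scalar_mul x (scalar_mul y z) = scalar_mul (scalar_mul x y) z.
Proof. exact: mulrA. Qed.
Fact scalar_mulPl (a : R[i]) x y z :
  scalar_mul (a *: x + y) z = a *: scalar_mul x z + scalar_mul y z.
Proof. by rewrite /scalar_mul mulrDl -mulrA. Qed.
Fact scalar_mulPr (a : R[i]) x y z :
  scalar_mul z (a *: x + y) = a *: scalar_mul z x + scalar_mul z y.
Proof. by rewrite /scalar_mul mulrDr mulrCA. Qed.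
Fact scalar_conjP (a : R[i]) x y :
  scalar_conj (a *: x + y) = a^* *: scalar_conj x + scalar_conj y.
Proof. by rewrite /scalar_conj rmorphD rmorphM. Qed.
Fact scalar_conjK x : scalar_conj (scalar_conj x) = x.
Proof. exact: conjCK. Qed.
Fact scalar_conjM x y :
  scalar_conj (scalar_mul x y) = scalar_mul (scalar_conj y) (scalar_conj x).
Proof. by rewrite /scalar_conj /scalar_mul rmorphM mulrC. Qed.
Fact scalar_normM_le x y : `|scalar_mul x y| <= `|x| * `|y|.
Proof. by rewrite -(@normrM R[i]). Qed.
Fact scalar_norm_star x : `|scalar_mul (scalar_conj x) x| = `|x| ^+ 2.
Proof. by rewrite (@normrM R[i]) norm_conjC. Qed.

HB.instance Definition _ := CompleteNormedModule_isCstar.Build R (hscalar R)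
  scalar_mulA scalar_mulPl scalar_mulPr scalar_conjP scalar_conjK scalar_conjM
  scalar_normM_le scalar_norm_star.

End ScalarCstar.

HB.instance Definition _ (S : invSemigroup0Type) (G : groupType) (sigma : option S -> G) :=
  gen_eqMixin (Env sigma).

Section Characters.
Local Open Scope group_scope.
Variables (R : realType) (S : invSemigroup0Type) (G : groupType).
Variable sigma : option S -> G.
Hypothesis S_zero_F_inverse : zero_F_inverse S.
Hypothesis sigma_morphism : morphism_to_group sigma.
Hypothesis sigma_injective : set_inj (@maximal_elt S) sigma.
Variables (A : cstarType R) (p : Env sigma -> A).
Hypothesis p_univ : is_Cstar_u (@env_mul S G sigma) (env_zero sigma) p.
Variables (H : hilbertType R) (pi : A -> H -> H).
Hypothesis pi_faithful : faithful_rep pi.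
Implicit Types (C : Env sigma) (x : G * S).

Definition character x (C : Env sigma) : hscalar R := (`[< points C x >])%:R.

Lemma character_rep x : semilattice_rep (@env_mul S G sigma) (env_zero sigma) (character x).
Proof.
split=> [C||C C'].
- split; first by rewrite -[LHS]/((`[< points C x >]%:R : R[i])^*)%R rmorph_nat.
  by rewrite -[LHS]/(_ * _)%R -natrM mulnb andbb.
- by rewrite /character points0 // asboolF.
- rewrite -[RHS]/(_ * _)%R -natrM mulnb; congr (_%:R).
  by rewrite points_mul // asbool_and.
Qed.

Lemma env_proj_comm C C' : cmul (p C) (p C') = cmul (p C') (p C).
Proof. by case: p_univ => -[_ _ pM] _ _; rewrite -!pM env_mulC. Qed.

Lemma points_trans a (e : semilat S) C : points C (a, val e) ->
  points (env_class sigma a e) `<=` points C.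
Proof.
rewrite -(env_reprP C) !points_class //; case: (env_repr C) => g d /=.
move=> [s [/= s0 se ds sg]] [k f] [t [/= t0 tf et tg]].
have st : sstar (s * t) * (s * t) = sstar t * t.
  by rewrite sstarM -mulgA (mulgA (sstar s)) se et.
have st0 : s * t <> szero := sVs_eq_neq0 t0 st.
exists (s * t); split=> //=; first by rewrite st.
  by rewrite mulgA ds.
by rewrite degM // sg tg mulgA -(mulgA _ a) mulgV mulg1.
Qed.

(** The product of the [p C] with [C] above the point and the [1 - p C] with [C] not
    above it, over finitely many [C], is nonzero, because universality of [A]
    extends the character of the point to [A], where it takes the value 1 on this
    product. Any nonzero vector in the range of the product is as required. *)
Lemma character_vector a (e : semilat S) (Y : seq (Env sigma)) : val e <> szero ->
  exists2 v : H, `|v|%R = 1%R & forall C, C \in Y ->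
    pi (p C) v = if `[< points C (a, val e) >] then v else 0%R.
Proof.
move=> e0; case: (p_univ) => -[pP p0 pM] _ /(_ _ _ (character_rep (a, val e))).
move=> [chi [[chiL chiM _] chiE]].
have aff D : points D (a, val e) -> cmul (p D) (p (env_class sigma a e)) = p (env_class sigma a e).
  move=> De; rewrite env_proj_comm -pM env_mul_idl //; exact: points_trans.
have [b [b1 bY]] : exists b : A, chi b = 1%R /\
    (forall C, points C (a, val e) -> cmul (p C) b = b) /\
    (forall C, C \in Y -> ~ points C (a, val e) -> cmul (p C) b = 0%R).
  elim: Y => [|D Y [b [b1 [bT bF]]]].
    exists (p (env_class sigma a e)); rewrite chiE /character asboolT; last first.
      by rewrite points_class //; exact: below_self.
    by split=> //; split.
  have [De|De] := pselect (points D (a, val e)).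
    exists b; split=> //; split=> // C; rewrite inE => /predU1P[->//|CY]; exact: bF.
  exists (b - cmul (p D) b)%R; split.
    have -> : (b - cmul (p D) b = -1 *: cmul (p D) b + b)%R by rewrite scaleN1r addrC.
    rewrite chiL chiM chiE b1 /character asboolF //.
    by rewrite -[cmul _ _]/(0 * 1)%R mul0r scaler0 add0r.
  have comm C : cmul (p C) (b - cmul (p D) b)%R = (cmul (p C) b - cmul (p D) (cmul (p C) b))%R.
    by rewrite cmulDr cmulNr !cmulA (env_proj_comm C).
  split=> [C CT|C]; rewrite comm; first by rewrite bT.
  rewrite inE => /predU1P[->|CY] CF.
    by rewrite cmulA (pP D).2 subrr.
  by rewrite bF // cmul0r subrr.
case: pi_faithful => piP pi_inj.
have pi0 : pi 0%R = fun=> 0%R.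
  by apply/funext => x; have := cstar_repZ piP 0%R 0%R x; rewrite !scale0r.
have [w bw0] : exists w, pi b w <> 0%R.
  apply: contrapT => /forallNP nb.
  have b0 : b = 0%R.
    apply: pi_inj; rewrite pi0; apply/funext => x.
    by apply: contrapT; exact: nb.
  have : (1 : R[i])%R = 0%R.
    by rewrite -b1 b0; exact: (lin_0 chiL).
  by move/eqP; rewrite oner_eq0.
have pnM C (x : H) : pi (p C) (pi b x) = pi (cmul (p C) b) x.
  by case: piP => _ _ -> _.
have pL C : linear (pi (p C)) by case: piP => _ /(_ (p C))[].
exists (`|pi b w|^-1 *: pi b w)%R.
  by rewrite normrZ normfV normr_id mulVf // normr_eq0; apply/eqP.
move=> C CY; rewrite (lin_scale (pL C)) pnM.
have [Ce|Ce] := pselect (points C (a, val e)).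
  by rewrite bY.1 // asboolT.
by rewrite bY.2 // pi0 scaler0 asboolF.
Qed.

End Characters.

(** * Comparison of norms *)

Section Compare.
Local Open Scope group_scope.
Variables (R : realType) (S : invSemigroup0Type) (G : groupType).
Variable sigma : option S -> G.
Hypothesis S_zero_F_inverse : zero_F_inverse S.
Hypothesis sigma_morphism : morphism_to_group sigma.
Hypothesis sigma_injective : set_inj (@maximal_elt S) sigma.
Variables (A : cstarType R) (p : Env sigma -> A).
Hypothesis p_univ : is_Cstar_u (@env_mul S G sigma) (env_zero sigma) p.
Variables (tau : G -> A -> A) (tau_induced : induced_action p tau).
Variables (H : hilbertType R) (pi : A -> H -> H).
Hypothesis pi_faithful : faithful_rep pi.
Implicit Types (s t : S) (x y : nonzero S) (g h k : G) (C : Env sigma).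
Implicit Types (v w e : H) (L : seq (R[i] * S)).

Let p_rep : semilattice_rep (@env_mul S G sigma) (env_zero sigma) p.
Proof. by case: p_univ. Qed.
Let piP : cstar_rep pi := pi_faithful.1.
Let tauP : cstar_action tau := tau_induced.1.
Local Notation deg s := (sigma (Some s)).
Local Notation V := (corner_gen p tau pi).
Local Notation La := (@Lambda R S).
Local Notation delta h v := (@l2_delta R G H h v).
Local Notation hdelta x := (@l2_delta R (nonzero S) (hscalar R) x (1%R : R[i])).

(** The class whose projection [corner_gen s] applies to the value at [h], by
    [corner_gen_delta]. *)
Definition env_dom h s : Env sigma := env_class sigma h^-1 (sdom s).

Lemma env_domP h s k (f : S) : points (env_dom h s) (k, f) <->
  exists t, [/\ t <> szero, sstar t * t = f, sstar s * s * t = t & deg t = h * k].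
Proof.
rewrite points_class //; split=> -[t [/= t0 tf st tg]]; exists t; split=> //=.
  by rewrite tg invgK.
by rewrite tg invgK.
Qed.

Lemma pi_linear (a : A) : linear (pi a).
Proof. by case: piP => _ /(_ a)[]. Qed.

Lemma corner_gen_delta s h v :
  V s (delta h v) = delta (deg s * h) (pi (p (env_dom h s)) v).
Proof.
rewrite /corner_gen /= cp_emb_delta // cp_unitary_delta; congr l2_delta.
congr (pi _ v); rewrite tau_induced.2; congr p.
by rewrite env_act_class // mulg1.
Qed.

Lemma env_proj_pi_mul C C' v : pi (p C) (pi (p C') v) = pi (p (env_mul C C')) v.
Proof. by case: p_rep => _ _ ->; case: piP => _ _ ->. Qed.

Lemma env_proj_pi_adj C : adjoint (pi (p C)) (pi (p C)).
Proof. by case: piP => _ _ _ /(_ (p C)); case: p_rep => /(_ C)[-> _]. Qed.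

(** If the relevant projections act on the unit vector [e] by the character of the
    point [(k, f)], then the corner acts on the vectors [delta h e] exactly as [S]
    acts by left multiplication on its elements of domain [f], where [h]
    corresponds to the element of degree [h * k]: degree and domain determine an
    element, so the two families have the same Gram matrix. *)
Lemma compare_lincomb (I : choiceType) (r : seq I) (h : I -> G) (a : I -> R[i])
    (y : I -> option (nonzero S)) (k : G) (f : S) (e : H) L : `|e|%R = 1%R ->
  (forall i x, i \in r -> y i = Some x ->
     sstar (val x) * val x = f /\ deg (val x) = h i * k) ->
  (forall i s, i \in r -> s \in [seq q.2 | q <- L] -> pi (p (env_dom (h i) s)) e =
     if oapp (fun x => sstar s * s * val x == val x) false (y i) then e else 0%R) ->
  `|lincomb V L (\sum_(i <- r) a i *: delta (h i) e)|%R =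
  `|lincomb La L (\sum_(i <- r) a i *: oapp (fun x => hdelta x) 0%R (y i))|%R.
Proof.
move=> e1 yP eP.
have VL s : linear (V s).
  by have [/(_ s)[]] := corner_gen_star_rep S_zero_F_inverse sigma_morphism
    sigma_injective p_rep tau_induced piP.
have LL s : linear (La s) by have [/(_ s)[]] := Lambda_star_rep R S.
pose J := [seq (q, i) | q <- L, i <- r].
have expand (K K' : lmodType R[i]) (T : S -> K -> K') (TL : forall s, linear (T s)) (d : I -> K) :
    (\sum_(q <- L) q.1 *: T q.2 (\sum_(i <- r) a i *: d i) =
     \sum_(j <- J) (j.1.1 * a j.2) *: T j.1.2 (d j.2))%R.
  rewrite big_allpairs_dep /=; apply: eq_bigr => q _.
  rewrite (lin_sum (TL _)) scaler_sumr; apply: eq_bigr => i _.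
  by rewrite (lin_scale (TL _)) scalerA.
rewrite /lincomb (expand _ _ _ VL) (expand _ _ _ LL); apply: norm_sum_gram.
have dom q i : q \in L -> i \in r ->
    (V q.2 (delta (h i) e) = 0%R /\
     La q.2 (oapp (fun x => hdelta x) 0%R (y i)) = 0%R) \/
    exists z, [/\ V q.2 (delta (h i) e) = delta (deg q.2 * h i) e,
      La q.2 (oapp (fun x => hdelta x) 0%R (y i)) = hdelta z,
      sstar (val z) * val z = f & deg (val z) = deg q.2 * h i * k].
  move=> qL ir; rewrite corner_gen_delta eP //; last exact: map_f.
  case E : (y i) => [x|] /=; last by left; rewrite l2_delta0 (lin_0 (LL _)).
  have [xf xg] := yP _ _ ir E.
  case: eqP => sx; rewrite Lambda_l2_delta; last first.
    left; rewrite l2_delta0; split=> //.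
    case E' : (Lambda_dom _ x) => [z|] //.
    by move/Lambda_dom_inv/Lambda_domP: E'; rewrite !sstarK => -[/sx].
  have {}sx : sstar q.2 * q.2 * val x = val x := sx.
  have sx0 : q.2 * val x != szero.
    by apply: contra_not_neq (elimN eqP (valP x)) => sx0; rewrite -sx -mulgA sx0 smulr0.
  pose z : nonzero S := exist _ (q.2 * val x) sx0.
  right; exists z; split=> //.
  - have -> // : Lambda_dom (sstar q.2) x = Some z.
    by apply/(Lambda_dom_inv q.2)/Lambda_domP; split.
  - by rewrite /= sstarM -mulgA (mulgA (sstar q.2)) sx.
  - by rewrite /= degM ?xg ?mulgA //; exact/eqP.
move=> [q i] [q' i'] /allpairsP[[? ?] [/= qL ir [-> ->]]] /allpairsP[[? ?] [/= qL' ir' [-> ->]]].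
rewrite !hdotZl !hdotZr; congr (_ * (_ * _))%R.
have [[-> ->]|[z [-> -> zf zg]]] := dom _ _ qL ir; first by rewrite !hdot0l.
have [[-> ->]|[z' [-> -> zf' zg']]] := dom _ _ qL' ir'; first by rewrite !hdot0r.
rewrite !hdot_delta2 hdot_normE e1 expr1n.
have -> : hdot (1%R : hscalar R) (1%R : hscalar R) = 1%R.
  by rewrite hdot_normE normr1 expr1n.
congr (if _ then _ else _); apply/eqP/eqP => [E|E].
  apply/val_inj; apply: (deg_dom_inj S_zero_F_inverse sigma_morphism sigma_injective).
  - exact: (elimN eqP (valP z)).
  - by rewrite zg zg' E.
  - by rewrite zf zf'.
by apply: (@mulIg _ k); rewrite -zg -zg' E.
Qed.

(** Pythagoras, both before and after applying [T]. *)
Lemma split_bound (K : hilbertType R) (T : K -> K) (M : R[i]) (v w : K) :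
  linear T -> (0 <= M)%R -> hdot v w = 0%R -> hdot (T v) (T w) = 0%R ->
  (`|T v| <= M * `|v|)%R -> (`|T w| <= M * `|w|)%R ->
  (`|T (v + w)| <= M * `|v + w|)%R.
Proof.
move=> TL M0 vw Tvw Tv Tw; rewrite -(@ler_pXn2r _ 2) ?nnegrE ?mulr_ge0 //.
rewrite (lin_add TL) exprMn !norm_sqD // mulrDr -!exprMn.
by rewrite lerD // lerXn2r ?nnegrE ?mulr_ge0.
Qed.

(** Left multiplication preserves domains, so a finitely supported vector splits
    orthogonally by domain; on one domain [f], [character_vector] provides a vector
    [e] to which [compare_lincomb] applies. *)
Lemma lambda_le_corner : norm_dominated V La.
Proof.
move=> L M M0 VM.
have LP := Lambda_star_rep R S; have TL : linear (lincomb La L) := (lincomb_bounded LP L).1.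
apply: op_le_l2_fin => //; first exact: lincomb_bounded LP L.
move=> r; move: {2}(size r) (leqnn (size r)) => n; elim: n r => [|n IH] r.
  rewrite leqn0 => /nilP-> v _.
  by rewrite /l2_fin big_nil (lin_0 TL) normr0 mulr0.
case: r => [|x0 r'] sr v ur; first exact: IH.
set r := x0 :: r' in sr ur *.
pose f := sstar (val x0) * val x0; pose dom x := sstar (val x) * val x == f.
have rE : l2_fin r v = (l2_fin [seq x <- r | dom x] v + l2_fin [seq x <- r | ~~ dom x] v)%R.
  by rewrite /l2_fin !big_filter (bigID dom).
have u1 : uniq [seq x <- r | dom x] by exact: filter_uniq.
have u2 : uniq [seq x <- r | ~~ dom x] by exact: filter_uniq.
rewrite rE; apply: split_bound => //.
- rewrite /l2_fin hdot_suml big_seq big1 // => x; rewrite mem_filter => /andP[xd _].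
  rewrite hdot_sumr big_seq big1 // => x'; rewrite mem_filter => /andP[xd' _].
  rewrite hdot_delta2; case: eqP => // xx'; move: xd'; by rewrite -xx' xd.
- rewrite /l2_fin !(lin_sum TL) hdot_suml big_seq big1 // => x; rewrite mem_filter => /andP[xd _].
  rewrite hdot_sumr big_seq big1 // => x'; rewrite mem_filter => /andP[xd' _].
  rewrite /lincomb hdot_suml big1 // => q _; rewrite hdot_sumr big1 // => q' _.
  rewrite hdotZl hdotZr !Lambda_l2_delta.
  case E : (Lambda_dom _ x) => [z|] /=; last by rewrite hdot0l !mulr0.
  case E' : (Lambda_dom _ x') => [z'|] /=; last by rewrite hdot0r !mulr0.
  rewrite hdot_delta2; case: eqP => [zz'|_]; last by rewrite !mulr0.
  move/(Lambda_dom_inv q.2)/Lambda_domP: E => [sx zx].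
  move/(Lambda_dom_inv q'.2)/Lambda_domP: E' => [sx' zx'].
  have zd : sstar (val z) * val z = sstar (val x) * val x.
    by rewrite zx sstarM -mulgA (mulgA (sstar q.2)) sx.
  have zd' : sstar (val z') * val z' = sstar (val x') * val x'.
    by rewrite zx' sstarM -mulgA (mulgA (sstar q'.2)) sx'.
  by move: xd'; rewrite /dom -zd' -zz' zd (eqP xd) eqxx.
- have if0 : f \in @idem S by exact: idem_sVs.
  have f0 : f <> szero by apply: sstar_sVs_neq0; exact: (elimN eqP (valP x0)).
  pose fE : semilat S := exist _ f if0.
  have [e e1 eP] := character_vector S_zero_F_inverse sigma_morphism sigma_injective
    p_univ pi_faithful (e := fE) 1
    [seq env_dom (deg (val x)) s | x <- r, s <- [seq q.2 | q <- L]] f0.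
  set r1 := [seq x <- r | dom x] in u1 *.
  have r1P x : x \in r1 -> x \in r /\ sstar (val x) * val x = f.
    by rewrite mem_filter => /andP[/eqP].
  have xP x x' : x \in r1 -> Some x = Some x' ->
      sstar (val x') * val x' = f /\ deg (val x') = deg (val x) * 1.
    by move=> ir [<-]; rewrite mulg1; have [_ ->] := r1P _ ir.
  have sP x s : x \in r1 -> s \in [seq q.2 | q <- L] ->
      pi (p (env_dom (deg (val x)) s)) e =
      if sstar s * s * val x == val x then e else 0%R.
    move=> xr sL; have [xr' xf] := r1P _ xr; rewrite eP; last first.
      by apply/allpairsP; exists (x, s).
    congr (if _ then _ else _); apply/asboolP/eqP => [/env_domP[t [t0 tf st tg]]|sx].
      suff -> : val x = t by [].
      apply: (deg_dom_inj S_zero_F_inverse sigma_morphism sigma_injective).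
      - exact: (elimN eqP (valP x)).
      - by rewrite tg mulg1.
      - by rewrite tf xf.
    apply/env_domP; exists (val x); rewrite mulg1; split=> //.
    exact: (elimN eqP (valP x)).
  have E := @compare_lincomb _ r1 (fun x => deg (val x)) v (fun x => Some x) 1 f e L e1 xP sP.
  have E1 : (\sum_(x <- r1) v x *: hdelta x)%R = l2_fin r1 v.
    by apply: eq_bigr => x _; rewrite -l2_deltaZ -[(_ *: _)%R]/(_ * _)%R mulr1.
  rewrite /= E1 in E; rewrite -E; apply: le_trans (VM _) _.
  rewrite -E1 ler_wpM2l // le_eqVlt; apply/orP; left; apply/eqP.
  apply: norm_sum_gram => x x' /r1P[_ xf] /r1P[_ xf'].
  rewrite !hdotZl !hdotZr !hdot_delta2 !hdot_normE e1 normr1.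
  suff -> : (deg (val x) == deg (val x')) = (x == x') by [].
  apply/eqP/eqP => [xx'|->//]; apply/val_inj.
  apply: (deg_dom_inj S_zero_F_inverse sigma_morphism sigma_injective) => //.
    exact: (elimN eqP (valP x)).
  by rewrite xf xf'.
- apply: IH => //; rewrite /r /= /dom eqxx /=; apply: leq_trans (_ : size r' <= n)%N => //.
  by rewrite size_filter count_size.
Qed.

Section Dominated.
Variables (L : seq (R[i] * S)) (M : R[i]) (r : seq G).
Hypotheses (M0 : (0 <= M)%R) (LM : op_le (lincomb La L) M) (ur : uniq r).

Let T := lincomb V L.
Let TL : linear T :=
  (lincomb_bounded (corner_gen_star_rep S_zero_F_inverse sigma_morphism
    sigma_injective p_rep tau_induced piP) L).1.

(** Only these finitely many projections occur when [T] is applied to a vector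
    supported in [r]. *)
Let Y := [seq env_dom h s | h <- r, s <- [seq q.2 | q <- L]].

Let Y_in h q : h \in r -> q \in L -> env_dom h q.2 \in Y.
Proof. by move=> hr qL; apply/allpairsP; exists (h, q.2); split=> //; exact: map_f. Qed.

Let bounded_on (v : G -> H) : Prop := (`|T (l2_fin r v)| <= M * `|l2_fin r v|)%R.

Lemma corner_fin (v : G -> H) : T (l2_fin r v) =
  (\sum_(h <- r) \sum_(q <- L) q.1 *: delta (deg q.2 * h)%g (pi (p (env_dom h q.2)) (v h)))%R.
Proof.
rewrite /l2_fin (lin_sum TL); apply: eq_bigr => h _.
by apply: eq_bigr => q _; rewrite corner_gen_delta.
Qed.

Lemma bounded_on_split (v w : G -> H) :
  (forall h, h \in r -> hdot (w h) (v h - w h)%R = 0%R) ->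
  (forall h h' C C', h \in r -> h' \in r -> C \in Y -> C' \in Y ->
     hdot (pi (p C) (w h)) (pi (p C') (v h' - w h')%R) = 0%R) ->
  bounded_on w -> bounded_on (fun h => v h - w h)%R -> bounded_on v.
Proof.
move=> vw Tvw bw bvw; rewrite /bounded_on.
have -> : l2_fin r v = (l2_fin r w + l2_fin r (fun h => v h - w h))%R.
  rewrite /l2_fin -big_split; apply: eq_bigr => h _ /=.
  by rewrite -l2_deltaD addrC subrK.
apply: split_bound => //.
  rewrite /l2_fin hdot_suml big_seq big1 // => h hr.
  rewrite hdot_sumr big_seq big1 // => h' h'r; rewrite hdot_delta2.
  by case: eqP => // <-; exact: vw.
rewrite !corner_fin hdot_suml big_seq big1 // => h hr.
rewrite hdot_suml big_seq big1 // => q qL.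
rewrite hdot_sumr big_seq big1 // => h' h'r.
rewrite hdot_sumr big_seq big1 // => q' q'L.
rewrite hdotZl hdotZr hdot_delta2 Tvw ?Y_in //.
by case: ifP => _; rewrite !mulr0.
Qed.

Lemma bounded_on0 (v : G -> H) : (forall h C, h \in r -> C \in Y -> pi (p C) (v h) = 0%R) ->
  bounded_on v.
Proof.
move=> v0; rewrite /bounded_on corner_fin big_seq big1 ?normr0 ?mulr_ge0 // => h hr.
by rewrite big_seq big1 // => q qL; rewrite v0 ?Y_in // l2_delta0 scaler0.
Qed.

(** Here [compare_lincomb] applies. The indices [h] without an element of degree
    [h * a] and domain [f] contribute nothing to the image, and dropping them only
    decreases the norm of the argument. *)
Lemma bounded_on_line a (f : S) (e : H) (c : G -> R[i]) : `|e|%R = 1%R ->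
  (forall C, C \in Y -> pi (p C) e = if `[< points C (a, f) >] then e else 0%R) ->
  bounded_on (fun h => c h *: e)%R.
Proof.
move=> e1 eP.
pose yP h (x : nonzero S) := sstar (val x) * val x = f /\ deg (val x) = h * a.
have /choice[y yE] : forall h, exists o : option (nonzero S),
    if o is Some x then yP h x else forall x, ~ yP h x.
  move=> h; have [[x xP]|nx] := pselect (exists x, yP h x); first by exists (Some x).
  by exists None => x xP; apply: nx; exists x.
have y1 h x : h \in r -> y h = Some x -> yP h x.
  by move=> _ hx; have := yE h; rewrite hx.
have y2 h s : h \in r -> s \in [seq q.2 | q <- L] -> pi (p (env_dom h s)) e =
    if oapp (fun x => sstar s * s * val x == val x) false (y h) then e else 0%R.
  move=> hr sL; rewrite eP; last by apply/allpairsP; exists (h, s).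
  suff -> : `[< points (env_dom h s) (a, f) >] =
    oapp (fun x => sstar s * s * val x == val x) false (y h) by [].
  have := yE h; case: (y h) => [x [xf xg]|nx] /=; last first.
    apply: asboolF => /env_domP[t [t0 tf st tg]].
    by apply: (nx (exist _ t (introN eqP t0))).
  apply/asboolP/eqP => [/env_domP[t [t0 tf st tg]]|sx].
    suff -> : sval x = t by [].
    apply: (deg_dom_inj S_zero_F_inverse sigma_morphism sigma_injective).
    - exact: (elimN eqP (valP x)).
    - by rewrite tg xg.
    - by rewrite tf xf.
  apply/env_domP; exists (val x); split=> //.
  exact: (elimN eqP (valP x)).
have E := @compare_lincomb _ r id c y a f e L e1 y1 y2.
have E1 : (\sum_(h <- r) c h *: delta (id h) e)%R = l2_fin r (fun h => c h *: e)%R.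
  by apply: eq_bigr => h _; rewrite l2_deltaZ.
rewrite /bounded_on -E1 E; apply: le_trans (LM _) _; rewrite ler_wpM2l // E1.
rewrite -(@ler_pXn2r _ 2) ?nnegrE // l2_fin_norm // norm_sq_sum_orth //.
  apply: ler_sum => h _; rewrite !normrZ e1 mulr1 exprMn ler_piMr ?exprn_ge0 //.
  case: (y h) => [x|] /=; last by rewrite normr0 expr0n.
  by rewrite norm_delta (@normr1 R[i]) expr1n.
move=> h h' hr h'r /eqP hh'; rewrite hdotZl hdotZr.
case E2 : (y h) => [x|] /=; last by rewrite hdot0l !mulr0.
case E3 : (y h') => [x'|] /=; last by rewrite hdot0r !mulr0.
rewrite hdot_delta2; case: eqP => [xx'|_]; last by rewrite !mulr0.
have [_ xg] := y1 _ _ hr E2; have [_ xg'] := y1 _ _ h'r E3.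
by case: hh'; apply: (@mulIg _ a); rewrite -xg -xg' xx'.
Qed.

(** Split off the component of [v] along one of its nonzero values:
    [bounded_on_line] handles that component, and the rest has smaller support. *)
Lemma bounded_on_character a (f : S) (v : G -> H) :
  (forall h C, h \in r -> C \in Y ->
     pi (p C) (v h) = if `[< points C (a, f) >] then v h else 0%R) ->
  bounded_on v.
Proof.
pose supp (u : G -> H) := [seq h <- r | u h != 0%R].
move: {2}(size (supp v)) (leqnn (size (supp v))) => n; elim: n v => [|n IH] v.
  rewrite leqn0 => /nilP sv vP; apply: bounded_on0 => h C hr CY.
  suff -> : v h = 0%R by exact: (lin_0 (pi_linear _)).
  apply/eqP/negPn/negP => vh0; have : h \in supp v by rewrite mem_filter vh0.
  by rewrite sv.
move=> sn vP; case Es : (supp v) => [|h0 s'].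
  by apply: IH => //; rewrite Es.
have : h0 \in supp v by rewrite Es mem_head.
rewrite mem_filter => /andP[vh0 h0r].
pose e := (`|v h0|^-1 *: v h0)%R.
have e1 : `|e|%R = 1%R by rewrite /e normrZ normfV normr_id mulVf // normr_eq0.
have eP C : C \in Y -> pi (p C) e = if `[< points C (a, f) >] then e else 0%R.
  move=> CY; rewrite /e (lin_scale (pi_linear _)) vP //.
  by case: ifP => _ //; rewrite scaler0.
pose c h := hdot (v h) e.
have orth u : hdot e (u - hdot u e *: e)%R = 0%R.
  rewrite hdotDr hdotNr hdotZr hdot_normE e1 expr1n mulr1.
  by rewrite (hdotC u e) subrr.
have wP h C : h \in r -> C \in Y -> pi (p C) (v h - c h *: e)%R =
    if `[< points C (a, f) >] then (v h - c h *: e)%R else 0%R.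
  move=> hr CY; rewrite (lin_sub (pi_linear _)) (lin_scale (pi_linear _)) vP // eP //.
  by case: ifP => _ //; rewrite scaler0 subrr.
apply: (@bounded_on_split v (fun h => c h *: e)%R).
- by move=> h hr; rewrite hdotZl orth mulr0.
- move=> h h' C C' hr h'r CY C'Y; rewrite wP // (lin_scale (pi_linear _)) eP //.
  case: ifP => _; last by rewrite scaler0 hdot0l.
  case: ifP => _; last by rewrite hdot0r.
  by rewrite hdotZl orth mulr0.
- exact: bounded_on_line eP.
- apply: IH => //; rewrite -ltnS; apply: leq_trans sn.
  have h0s : h0 \in supp v by rewrite mem_filter vh0.
  rewrite -(prednK (_ : 0 < size (supp v))%N) ?Es // -Es -(size_rem h0s) ltnS.
  apply: uniq_leq_size => [|h]; first exact: filter_uniq.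
  rewrite mem_filter => /andP[wh hr]; rewrite mem_rem_uniq ?filter_uniq // !inE.
  rewrite mem_filter hr andbT; apply/andP; split.
    apply: contraNneq wh => ->; have vE : v h0 = (`|v h0| *: e)%R.
      by rewrite /e scalerA divff ?scale1r // normr_eq0.
    by rewrite /c {2}vE hdotZl hdot_normE e1 expr1n mulr1 -vE subrr.
  by apply: contraNneq wh => vh; rewrite /c vh hdot0l scale0r subrr.
Qed.

(** The product of the projections fixing [v] is again in the semilattice, so it is
    the class of some [(a, f)], and [f] is nonzero as the product fixes [v]. A
    projection above this class fixes [v], and conversely, so the eigenvalues are
    those of the character of [(a, f)]. *)
Lemma bounded_on_eigen (v : G -> H) :
  (forall C, C \in Y -> (forall h, h \in r -> pi (p C) (v h) = v h) \/
                        (forall h, h \in r -> pi (p C) (v h) = 0%R)) ->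
  bounded_on v.
Proof.
move=> vE; have [[h0 [h0r vh0]]|v0] := pselect (exists h, h \in r /\ v h <> 0%R); last first.
  apply: bounded_on0 => h C hr CY; suff -> : v h = 0%R by exact: (lin_0 (pi_linear _)).
  by apply: contrapT => vh; apply: v0; exists h.
have : (forall h C, h \in r -> C \in Y -> pi (p C) (v h) = 0%R) \/
    exists D, (forall h, h \in r -> pi (p D) (v h) = v h) /\
      forall C, C \in Y -> (forall h, h \in r -> pi (p C) (v h) = v h) ->
        points D `<=` points C.
  elim: (Y) vE => [|C Y' IH] vE; first by left.
  have [|Y0|[D [Dv DY]]] := IH.
  - by move=> C' C'Y; apply: vE; rewrite inE C'Y orbT.
  - have [Cv|C0] := vE C (mem_head _ _).
      right; exists C; split=> // C'; rewrite inE => /predU1P[-> _|C'Y C'v]; first by [].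
      by case: vh0; rewrite -(C'v _ h0r) Y0 //.
    left=> h C' hr; rewrite inE => /predU1P[->|C'Y]; [exact: C0|exact: Y0].
  - right; have [Cv|C0] := vE C (mem_head _ _).
      exists (env_mul D C); rewrite points_mul //; split=> [h hr|C'].
        by rewrite -env_proj_pi_mul Cv // Dv.
      rewrite inE => /predU1P[-> _ x []//|C'Y C'v x [Dx _]]; exact: DY C'v _ Dx.
    exists D; split=> // C'; rewrite inE => /predU1P[->|C'Y]; last exact: DY.
    by move=> Cv; case: vh0; rewrite -(Cv _ h0r) C0 //.
case=> [|[D [Dv DY]]]; first by move=> v0; apply: bounded_on0.
have DE := env_reprP D; case: (env_repr D) DE => a fE /= DE.
have f0 : val fE <> szero.
  move=> f0; apply: vh0; rewrite -(Dv _ h0r).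
  have -> : D = env_zero sigma.
    apply: (points_inj S_zero_F_inverse sigma_morphism sigma_injective).
    rewrite points0 // -DE points_class // (_ : fE = semilat0 S) ?below0 //.
    exact: semilat_inj.
  by case: p_rep => _ -> _; have := cstar_repZ piP 0%R 0%R (v h0); rewrite !scale0r.
have Df : points D (a, val fE).
  by rewrite -DE points_class //; exact: (below_self sigma_morphism).
apply: (@bounded_on_character a (val fE)) => h C hr CY.
have [Cv|C0] := vE C CY.
  by rewrite asboolT; [exact: Cv|exact: DY Cv _ Df].
rewrite asboolF ?C0 // => /(points_trans S_zero_F_inverse sigma_morphism sigma_injective).
rewrite DE => DC; apply: vh0.
have DCD : env_mul D C = D by exact: env_mul_idl.
by rewrite -(Dv _ h0r) -DCD -env_proj_pi_mul C0 // (lin_0 (pi_linear _)).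
Qed.

(** The projections commute, so [v] splits orthogonally into joint eigenvectors, by
    induction on the list [Z] of projections yet to be diagonalised. *)
Lemma bounded_on_all (v : G -> H) : bounded_on v.
Proof.
have : forall C, C \in Y -> C \notin Y ->
    (forall h, h \in r -> pi (p C) (v h) = v h) \/
    (forall h, h \in r -> pi (p C) (v h) = 0%R) by move=> C ->.
move: {2}Y => Z; elim: Z v => [|D Z IH] v vE.
  by apply: bounded_on_eigen => C CY; exact: vE.
have pcomm C C' u : pi (p C) (pi (p C') u) = pi (p C') (pi (p C) u).
  by rewrite !env_proj_pi_mul env_mulC.
have pid C u : pi (p C) (pi (p C) u) = pi (p C) u by rewrite env_proj_pi_mul env_mulxx.
have psub C u w : pi (p C) (u - w)%R = (pi (p C) u - pi (p C) w)%R := lin_sub (pi_linear _) u w.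
have vE' C : C \in Y -> C \notin Z -> C <> D ->
    (forall h, h \in r -> pi (p C) (v h) = v h) \/
    (forall h, h \in r -> pi (p C) (v h) = 0%R).
  by move=> CY CZ CD; apply: vE; rewrite // inE negb_or CZ andbT; exact/eqP.
apply: (@bounded_on_split v (fun h => pi (p D) (v h))).
- by move=> h _; rewrite env_proj_pi_adj psub pid subrr hdot0r.
- move=> h h' C C' _ _ _ _; rewrite (pcomm C D) env_proj_pi_adj.
  by rewrite (pcomm D C') psub pid subrr (lin_0 (pi_linear _)) hdot0r.
- apply: IH => C CY CZ; have [->|/eqP CD] := eqVneq C D; first by left=> h _; exact: pid.
  have [Cv|C0] := vE' C CY CZ CD; [left=> h hr|right=> h hr].
    by rewrite pcomm Cv.
  by rewrite pcomm C0 // (lin_0 (pi_linear _)).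
- apply: IH => C CY CZ; have [->|/eqP CD] := eqVneq C D.
    by right=> h _; rewrite psub pid subrr.
  have [Cv|C0] := vE' C CY CZ CD; [left=> h hr|right=> h hr].
    by rewrite psub pcomm Cv.
  by rewrite psub pcomm C0 // (lin_0 (pi_linear _)) subrr.
Qed.

End Dominated.

Lemma corner_le_lambda : norm_dominated La V.
Proof.
move=> L M M0 LM; have VP := corner_gen_star_rep S_zero_F_inverse sigma_morphism
  sigma_injective p_rep tau_induced piP.
apply: op_le_l2_fin => //; first exact: lincomb_bounded VP L.
by move=> r v ur; exact: bounded_on_all M0 LM ur v.
Qed.

End Compare.

(** * The left regular C*-algebra as a full corner *)

Theorem corollary4p10 (R : realType) (S : invSemigroup0Type) (G : groupType)
    (sigma : option S -> G)
    (G_countable : countable [set: G])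
    (S_zero_F_inverse : zero_F_inverse S)
    (sigma_morphism : morphism_to_group sigma)
    (sigma_injective : set_inj (@maximal_elt S) sigma)
    (* A = C*_u(Env(E)) *)
    (A : cstarType R) (p : Env sigma -> A)
    (A_universal : is_Cstar_u (@env_mul S G sigma) (env_zero sigma) p)
    (tau : G -> A -> A) (tau_induced : induced_action p tau)
    (H : hilbertType R) (pi : A -> H -> H)
    (pi_faithful : faithful_rep pi) (pi_nondegenerate : nondegenerate_rep pi)
    (* P = 1 *)
    (P : l2 G H -> l2 G H) (P_unit : unit_projection p tau pi P) :
  let B := crossed_product tau pi in
  let iota (e : semilat S) := cp_emb tau pi (p (env_emb sigma e)) in
  let U := @cp_unitary R G H in
  full_corner B P /\
  exists phi : (l2 (nonzero S) (hscalar R) -> l2 (nonzero S) (hscalar R)) ->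
               (l2 G H -> l2 G H),
    op_star_iso (@Cstar_r R S) (corner B P) phi /\
    forall (e : semilat S) (g : G),
      phi (Lambda (smulr1 (val e) (s_ sigma g))) = iota e \o (P \o U g \o P) /\
      iota e \o (P \o U g \o P) = iota e \o U g \o P.
Proof.
move=> B iota U.
have p_rep : semilattice_rep (@env_mul S G sigma) (env_zero sigma) p by case: A_universal.
have p_gen : smallest (@cstar_subalg R A) (range p) = setT by case: A_universal.
have piP := pi_faithful.1.
split.
  exact: (unit_full_corner S_zero_F_inverse sigma_morphism sigma_injective
    p_rep tau_induced piP p_gen P_unit).
have LP := Lambda_star_rep R S.
have VP := corner_gen_star_rep S_zero_F_inverse sigma_morphism sigma_injective
  p_rep tau_induced piP.
have [phi [phiP phiE]] := op_star_iso_extension LP VP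
  (corner_le_lambda S_zero_F_inverse sigma_morphism sigma_injective
    A_universal tau_induced pi_faithful)
  (lambda_le_corner S_zero_F_inverse sigma_morphism sigma_injective
    A_universal tau_induced pi_faithful).
exists phi; split.
  rewrite /Cstar_r (op_cstar_lincomb LP).
  by rewrite (cornerE S_zero_F_inverse sigma_morphism sigma_injective
    p_rep tau_induced piP p_gen P_unit).
move=> e g; have cut : iota e \o (P \o U g \o P) = iota e \o U g \o P.
  have iotaP := unit_emb_r S_zero_F_inverse sigma_morphism sigma_injective
    p_rep tau_induced piP P_unit e.
  by rewrite -[LHS]/((iota e \o P) \o U g \o P) iotaP.
split=> //; rewrite phiE cut.
by rewrite (emb_unitary_unit S_zero_F_inverse sigma_morphism sigma_injective
  p_rep tau_induced piP P_unit).
Qed.
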